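(* Let $\nu>-\tfrac12$, $p,q,\lambda>0$, and let $w$ be a weight function satisfying $\int_x^\infty\frac{w(t)}{t^3}dt=O\big(\frac{w(x)}{x^2}\big)$ as $x\to\infty$. Let $f\in E_{H_\nu}(p,q,\lambda,w)$. Then: (1) If $p\ge1$, there exist $l>0$ and $C>0$ such that for all $k\in\mathbb N_0$, $$|\langle f,\psi_k^\nu\rangle|\le C\,2^{2k}\,\Gamma(k+\nu+1)\,e^{2k\log q-\frac1l\varphi^*(2lk)},$$ where $\varphi(t)=w(e^t)$. (2) If $p<1$, there exist $l>0$ and $C>0$ such that for all $k\in\mathbb N_0$, $$|\langle f,\psi_k^\nu\rangle|\le C\,2^{2k}\,\Gamma(k+\nu+1)\,e^{2k\log q-\frac1l\zeta_{p,q}^*(2lk)},$$ where $\zeta_{p,q}(t)=\frac1{4q^2}\sqrt{\frac{1-p}{1+p}}\,e^{2t}+w(e^t)$.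
   Context: A weight function is an unbounded non-decreasing $w:[0,\infty)\to[0,\infty)$. Young conjugate: $\phi^*(v)=\sup_{u\ge0}[uv-\phi(u)]$. $J_\nu$ is the Bessel function; $\frac{J_\nu(z)}{z^\nu}=2^{-\nu}\sum_{k\ge0}\frac{(-1)^k}{k!\Gamma(k+\nu+1)}(z/2)^{2k}$ (entire). Hankel transform: $H_\nu f(s)=\int_0^\infty f(r)\frac{J_\nu(sr)}{(sr)^\nu}r^{2\nu+1}dr$. For $p,q,\lambda>0$, $E_{H_\nu}(p,q,\lambda,w)$ is the set of $f\in(L^1\cap L^2)(\mathbb R^+,r^{2\nu+1}dr)$ such that for some $C>0$, $|f(r)|\le Ce^{-pr^2/2+\lambda w(qr)}$ and $|H_\nu f(s)|\le Ce^{-ps^2/2+\lambda w(qs)}$ for all $r,s>0$. Laguerre functions $\psi_k^\nu(s)=L_k^\nu(s^2)e^{-s^2/2}$, with $L_k^\nu$ the Laguerre polynomials of type $\nu$ ($\sum_kL_k^\nu(x)r^k=(1-r)^{-\nu-1}e^{-xr/(1-r)}$). $\langle f,g\rangle=\int_0^\infty f(r)\overline{g(r)}r^{2\nu+1}dr$. *)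

(* Defs.v *)
From HB Require Import structures.
From mathcomp Require Import all_boot all_order all_algebra.
From mathcomp Require Import all_classical all_reals all_analysis.
From mathcomp Require Import complex.
Set Implicit Arguments. Unset Strict Implicit. Unset Printing Implicit Defensive.
Import Order.TTheory GRing.Theory Num.Theory.
Import numFieldNormedType.Exports.
Local Open Scope classical_set_scope.
Local Open Scope ring_scope.



Section Defs.
Context {R : realType}.
Local Notation mu := (@lebesgue_measure R).

Definition Rpos : set R := `]0, +oo[.

Definition cR (x : R) : R[i] := complex.Complex x 0.
Definition cmod (z : R[i]) : R :=
  Num.sqrt (complex.Re z ^+ 2 + complex.Im z ^+ 2).

Definition cintegral (g : R -> R[i]) : R[i] :=
  complex.Complex (Rintegral mu Rpos (fun r => complex.Re (g r)))
                  (Rintegral mu Rpos (fun r => complex.Im (g r))).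

Definition Gamma (x : R) : R :=
  Rintegral mu Rpos (fun t => t `^ (x - 1) * expR (- t)).

(* J_nu(z) / z^nu = 2^(-nu) sum_k (-1)^k / (k! Gamma(k+nu+1)) (z/2)^(2k) *)
Definition besselJn (nu z : R) : R :=
  2 `^ (- nu) *
  limn (fun n : nat => \sum_(0 <= k < n)
           ((-1) ^+ k / (k`!%:R * Gamma (k%:R + nu + 1)) * (z / 2) ^+ (2 * k))).

Definition hankel (nu : R) (f : R -> R[i]) (s : R) : R[i] :=
  cintegral (fun r => (f r * cR (besselJn nu (s * r) * r `^ (2 * nu + 1)))%R).

Definition inner (nu : R) (f : R -> R[i]) (g : R -> R) : R[i] :=
  cintegral (fun r => (f r * cR (g r * r `^ (2 * nu + 1)))%R).

Definition Lnu (nu : R) (n : nat) (f : R -> R[i]) : Prop :=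
  measurable_fun Rpos (fun r => complex.Re (f r)) /\
  measurable_fun Rpos (fun r => complex.Im (f r)) /\
  (\int[mu]_(r in Rpos) ((cmod (f r)) ^+ n * r `^ (2 * nu + 1))%:E < +oo)%E.

Definition weight_function (w : R -> R) : Prop :=
  (forall x, 0 <= x -> 0 <= w x) /\
  (forall x y, 0 <= x -> x <= y -> w x <= w y) /\
  (forall M, exists x, 0 <= x /\ M < w x).

Definition weight_growth (w : R -> R) : Prop :=
  exists M x0 : R, forall x, x0 <= x ->
    (\int[mu]_(t in `[x, +oo[) ((w t / t ^+ 3)%:E) <= (M * (w x / x ^+ 2))%:E)%E.

Definition E_Hnu (nu p q lam : R) (w : R -> R) (f : R -> R[i]) : Prop :=
  Lnu nu 1 f /\ Lnu nu 2 f /\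
  exists C : R, 0 < C /\
    (forall r, 0 < r -> cmod (f r) <= C * expR (- p * r ^+ 2 / 2 + lam * w (q * r))) /\
    (forall s, 0 < s ->
       cmod (hankel nu f s) <= C * expR (- p * s ^+ 2 / 2 + lam * w (q * s))).

(* Laguerre polynomial of type nu (explicit form of the generating function
   sum_k L_k^nu(x) r^k = (1-r)^(-nu-1) e^(-xr/(1-r))):
   L_k^nu(x) = sum_{j=0}^k (-1)^j binom(k+nu, k-j) x^j / j!, with
   binom(k+nu,k-j) = (nu+j+1)...(nu+k) / (k-j)! *)
Definition laguerre (nu : R) (k : nat) (x : R) : R :=
  \sum_(j < k.+1)
     ((-1) ^+ j * (\prod_(j.+1 <= i < k.+1) (nu + i%:R))
        / ((k - j)`!%:R * j`!%:R) * x ^+ j).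

Definition laguerre_fun (nu : R) (k : nat) (s : R) : R :=
  laguerre nu k (s ^+ 2) * expR (- (s ^+ 2) / 2).

Definition young (phi : R -> R) (v : R) : \bar R :=
  ereal_sup [set ((u * v - phi u)%:E) | u in `[0, +oo[].

End Defs.

(* Main.v *)
Require Import Defs.
From HB Require Import structures.
From mathcomp Require Import all_boot all_order all_algebra.
From mathcomp Require Import all_classical all_reals all_analysis.
From mathcomp Require Import measurable_realfun complex ring lra zify.
Set Implicit Arguments. Unset Strict Implicit. Unset Printing Implicit Defensive.
Import Order.TTheory GRing.Theory Num.Theory.
Import numFieldNormedType.Exports.
Local Open Scope classical_set_scope.
Local Open Scope ring_scope.

(** It suffices to treat real [f]. The normalised Laguerre coefficients
    [b_k = <f, psi_k> / Gamma(k + nu + 1)] are the Taylor coefficients of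
    [G(t) = e^t * sum_j d_j t^j / j!], where [d_j = (-1)^j m_j / Gamma(j + nu + 1)]
    and [m_j] is the [2j]-th Gaussian moment of [f]. Fubini's theorem and the
    Hankel transform of [r^(2j) e^(-r^2/2)] show that passing from [f] to [H_nu f]
    amounts to passing from [G(t)] to [G(-t)]. Hence, for [p >= 1], the two
    pointwise bounds give
      [|G(t)| <= C e^(|t| - |Re t|) e^(L w(c sqrt|t|))].
    The growth condition yields [w(v) <= D w(r) (1 + (v / r)^(2 a))] for large [r],
    with some [a < 1], so a Phragmen-Lindelof argument from the imaginary axis,
    followed by Cauchy's estimates, gives [|b_k| rho^k <= C e^(L w(c sqrt rho))],
    which is the claim with the Young conjugate spelled out.
    For [p < 1] the extra term of [zeta] is of order [e^(2t)], and since [l] is free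
    the crude bound [|b_k| rho^k <= C e^(5 rho)] is enough. *)

(** On the imaginary axis the bound for [G] allows order one and type one, and each half-plane cut
    off by the real axis has opening [pi], the critical angle for order one. The comparison
    therefore runs in a sector of half-angle [ph < pi / 2] about the imaginary axis, where a barrier
    of order [be > 1] exists. On the sides of the sector the excess [1 - sin ph <= cos ph ^ 2] is
    paid by a harmonic function with coefficient [cos ph], whose value at a fixed point vanishes as
    [ph] tends to [pi / 2].

    Constants stay explicit because the argument is run anew at every radius: for given [r] the
    growth condition majorises the weight by [E + B |t|^al], with [E] proportional to [w r] and [B]
    to [w r * r^(-2 al)]. At [|t| = r^2 / q^2] both terms are fixed multiples of [w r], provided the
    comparison multiplies [B] by a factor that depends on [al] alone; this factor is
    [1 / cos (al * pi / 2)]. *)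

(** * Complex modulus and complex exponential *)

Section ComplexModulus.
Import ComplexField.
Context {R : realType}.
Implicit Types (x y : R) (z h : R[i]).

Lemma cmodE z : cmod z = Normc.normc z.
Proof. by case: z. Qed.

Lemma cmod_ge0 z : 0 <= cmod z.
Proof. exact: sqrtr_ge0. Qed.

Lemma cmodM z h : cmod (z * h) = cmod z * cmod h.
Proof. by rewrite !cmodE Normc.normcM. Qed.

Lemma cmodD z h : cmod (z + h) <= cmod z + cmod h.
Proof. by rewrite !cmodE le_normcD. Qed.

Lemma cmodN z : cmod (- z) = cmod z.
Proof. by rewrite !cmodE normcN. Qed.

Lemma cmodB z h : cmod (z - h) <= cmod z + cmod h.
Proof. by rewrite -(cmodN h) cmodD. Qed.

Lemma cmod_distC z h : cmod (z - h) = cmod (h - z).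
Proof. by rewrite -cmodN opprB. Qed.

Lemma cmod_leDB z h : cmod z <= cmod h + cmod (z - h).
Proof. by rewrite -{1}(subrK h z) addrC cmodD. Qed.

Lemma cmod_cR x : cmod (cR x) = `|x|.
Proof. by rewrite /cmod/= expr0n/= addr0 sqrtr_sqr. Qed.

Lemma cmod0 : cmod (0 : R[i]) = 0.
Proof. by have := cmod_cR 0; rewrite normr0. Qed.

Lemma cmod1 : cmod (1 : R[i]) = 1.
Proof. by have := cmod_cR 1; rewrite normr1. Qed.

Lemma cmodX z n : cmod (z ^+ n) = cmod z ^+ n.
Proof. by elim: n => [|n IH]; rewrite ?expr0 ?cmod1// !exprS cmodM IH. Qed.

Lemma cmod_sum (I : Type) (s : seq I) (P : pred I) (F : I -> R[i]) :
  cmod (\sum_(i <- s | P i) F i) <= \sum_(i <- s | P i) cmod (F i).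
Proof.
elim/big_rec2: _ => [|i y z _ le_yz]; first by rewrite cmod0.
by rewrite (le_trans (cmodD _ _))// lerD2l.
Qed.

Lemma Re_le_cmod z : `|complex.Re z| <= cmod z.
Proof. by rewrite -sqrtr_sqr ler_wsqrtr// lerDl sqr_ge0. Qed.

Lemma Im_le_cmod z : `|complex.Im z| <= cmod z.
Proof. by rewrite -sqrtr_sqr ler_wsqrtr// lerDr sqr_ge0. Qed.

Lemma cmod_le_ReIm z : cmod z <= `|complex.Re z| + `|complex.Im z|.
Proof.
case: z => a b; rewrite /cmod/=.
rewrite -[leRHS]ger0_norm ?addr_ge0// -sqrtr_sqr ler_wsqrtr//.
rewrite sqrrD !real_normK ?num_real// lerD2r lerDl.
by rewrite mulrn_wge0// mulr_ge0.
Qed.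

Lemma cRD x y : cR (x + y) = cR x + cR y.
Proof. by congr complex.Complex; rewrite addr0. Qed.

Lemma cRM x y : cR (x * y) = cR x * cR y.
Proof. by congr complex.Complex; rewrite ?mulr0 ?mul0r ?addr0 ?subr0. Qed.

Lemma cR0 : cR (0 : R) = 0. Proof. by []. Qed.
Lemma cR1 : cR (1 : R) = 1. Proof. by []. Qed.

Lemma cR_sum (I : Type) (s : seq I) (P : pred I) (F : I -> R) :
  cR (\sum_(i <- s | P i) F i) = \sum_(i <- s | P i) cR (F i).
Proof. by apply: (big_morph (@cR R)) => // x y; exact: cRD. Qed.

Lemma cRX x n : cR (x ^+ n) = cR x ^+ n.
Proof. by elim: n => [//|n IH]; rewrite !exprS cRM IH. Qed.

Definition cexp z : R[i] := complex.Complex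
  (expR (complex.Re z) * cos (complex.Im z))
  (expR (complex.Re z) * sin (complex.Im z)).

Lemma cexpD z h : cexp (z + h) = cexp z * cexp h.
Proof.
case: z h => [a b] [c d]; congr complex.Complex => /=.
  by rewrite expRD cosD; ring.
by rewrite expRD sinD; ring.
Qed.

Lemma cexp0 : cexp 0 = 1.
Proof. by congr complex.Complex; rewrite /= expR0 ?cos0 ?sin0 mul1r. Qed.

Lemma cmod_cexp z : cmod (cexp z) = expR (complex.Re z).
Proof.
by rewrite /cmod /= !exprMn -mulrDr cos2Dsin2 mulr1 sqrtr_sqr ger0_norm// expR_ge0.
Qed.

End ComplexModulus.

(** * Cauchy products of truncated series *)

Section CauchyProduct.
Context {R : realType}.

Lemma sum_convE (A : pzRingType) (u v : nat -> A) n :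
  \sum_(0 <= k < n) \sum_(0 <= i < k.+1) u i * v (k - i)%N =
  \sum_(0 <= i < n) u i * \sum_(0 <= j < n - i) v j.
Proof.
elim: n => [|n IH]; first by rewrite !big_nil.
rewrite big_nat_recr//= IH big_nat_recr//= addrA.
rewrite [RHS]big_nat_recr//= subSnn big_nat1 subnn; congr (_ + _).
rewrite -big_split/= big_nat [RHS]big_nat; apply: eq_bigr => i /andP[_ i_n].
by rewrite subSn 1?ltnW// big_nat_recr//= mulrDr.
Qed.

(** The square and the triangular partial sums differ by the pairs with [i + j >= n]. These lie
    outside the square of side [n./2], so the difference is at most the mass of the big square minus
    that of the small one, measured by the majorants. *)
Lemma cauchy_product_error (u v : nat -> R[i]) (U V : nat -> R) n :
  (forall i, cmod (u i) <= U i) -> (forall i, cmod (v i) <= V i) ->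
  cmod ((\sum_(0 <= i < n) u i) * (\sum_(0 <= i < n) v i) -
    \sum_(0 <= k < n) \sum_(0 <= i < k.+1) u i * v (k - i)%N)
  <= series U n * series V n - series U n./2 * series V n./2.
Proof.
move=> uU vV.
have U0 i : 0 <= U i by rewrite (le_trans _ (uU i))// cmod_ge0.
have V0 i : 0 <= V i by rewrite (le_trans _ (vV i))// cmod_ge0.
rewrite sum_convE mulr_suml -sumrB.
have nd (W : nat -> R) : (forall i, 0 <= W i) ->
    {homo series W : m p / (m <= p)%N >-> m <= p}.
  by move=> W0; apply/nondecreasing_seqP => m; rewrite seriesSr lerDl.
have SE (W : nat -> R) m : \sum_(0 <= k < m) W k = series W m by [].
apply: (@le_trans _ _ (\sum_(0 <= i < n) U i * (series V n - series V (n - i)%N))).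
  apply: (le_trans (cmod_sum _ _ _)); apply: ler_sum_nat => i /andP[_ i_n].
  rewrite -mulrBr cmodM; apply: ler_pM; rewrite ?cmod_ge0//.
  rewrite (big_cat_nat (n := (n - i)%N))//= ?leq_subr// addrAC subrr add0r.
  rewrite (le_trans (cmod_sum _ _ _))// sub_series_geq ?leq_subr//.
  by apply: ler_sum => j _.
have h2 : (n./2 <= n)%N by rewrite -[leqRHS]odd_double_half -addnn addnA leq_addl.
rewrite -(SE U n) (big_cat_nat (n := n./2))//= [in leRHS](big_cat_nat (n := n./2))//=.
rewrite (SE U) mulrDl addrAC -mulrBr lerD//.
  rewrite -(SE U) mulr_suml; apply: ler_sum_nat => i /andP[_ i_n].
  rewrite ler_wpM2l// lerB// nd//.
  by move: i_n; lia.
rewrite mulr_suml; apply: ler_sum_nat => i _.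
by rewrite ler_wpM2l// gerBl (le_trans _ (nd V V0 0%N _ _))// -SE big_nil.
Qed.

Lemma cvg_cauchy_error (U V : nat -> R) :
  cvgn (series U) -> cvgn (series V) ->
  (series U n * series V n - series U n./2 * series V n./2) @[n --> \oo] --> 0.
Proof.
move=> cU cV.
have half : n./2 @[n --> \oo] --> \oo.
  move=> A [N _ NA]; exists N.*2 => // n /= Nn; apply: NA => /=.
  by rewrite -(doubleK N) half_leq.
rewrite -(subrr (limn (series U) * limn (series V))).
apply: cvgB; first exact: cvgM.
apply: cvgM; exact: cvg_comp half _.
Qed.

End CauchyProduct.

(** * Taylor polynomials of the complex exponential *)

Section ExpSeries.
Context {R : realType}.
Implicit Types (x y : R) (z h : R[i]).

Definition cexp_sum n z : R[i] := \sum_(0 <= k < n) z ^+ k * cR (k`!%:R^-1).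

Lemma le_series_expR x n : 0 <= x -> series (exp_coeff x) n <= expR x.
Proof.
move=> x0; rewrite /expR; apply: (nondecreasing_cvgn_le _ (is_cvg_series_exp_coeff x)).
by apply/nondecreasing_seqP => m; rewrite seriesSr lerDl exp_coeff_ge0.
Qed.

Lemma cvg_series_expR x : series (exp_coeff x) @ \oo --> expR x.
Proof. exact: is_cvg_series_exp_coeff. Qed.

Lemma cmod_cexp_term z k : cmod (z ^+ k * cR (k`!%:R^-1)) = exp_coeff (cmod z) k.
Proof. by rewrite cmodM cmodX cmod_cR ger0_norm// invr_ge0. Qed.

Lemma exp_coeff_homo x y k : 0 <= x -> x <= y -> exp_coeff x k <= exp_coeff y k.
Proof. by move=> x0 xy; rewrite ler_wpM2r ?invr_ge0// lerXn2r// nnegrE (le_trans x0). Qed.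

Lemma cexp_sumR x n : cexp_sum n (cR x) = cR (series (exp_coeff x) n).
Proof. by rewrite cR_sum; apply: eq_bigr => k _; rewrite cRM cRX. Qed.

(** Powers of the imaginary unit in the shape of [cos_coeff] and [sin_coeff], so that the partial
    sums can be matched term by term. *)
Lemma expr_imag y k : (complex.Complex 0 y) ^+ k =
  complex.Complex ((~~ odd k)%:R * (-1) ^+ k./2 * y ^+ k)
                  ((odd k)%:R * (-1) ^+ k.-1./2 * y ^+ k).
Proof.
elim: k => [|k IH]; first by congr complex.Complex; rewrite ?expr0 ?mul1r ?mul0r.
rewrite exprSr {}IH /= negbK; have [ko|ke] := boolP (odd k); congr complex.Complex => /=.
- rewrite !(mul0r, mulr0) sub0r mul1r mul1r.
  have -> : uphalf k = k.-1./2.+1 by move: ko; lia.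
  by rewrite exprS exprSr; ring.
- by rewrite !(mul0r, mulr0) addr0.
- by rewrite !(mul0r, mulr0) subr0.
- by rewrite !(mul0r, mulr0) addr0 exprSr; ring.
Qed.

Lemma cexp_sum_imag y n : cexp_sum n (complex.Complex 0 y) =
  complex.Complex (series (cos_coeff y) n) (series (sin_coeff y) n).
Proof.
elim: n => [|n IH]; first by rewrite /cexp_sum /series/= !big_nil.
rewrite !seriesSr /cexp_sum big_nat_recr//= -/(cexp_sum n _) IH expr_imag.
by congr complex.Complex => /=; rewrite /cos_coeff/= !(mulr0, mul0r) ?(subr0, add0r, addr0).
Qed.

Lemma cexp_sumD z h n :
  cmod (cexp_sum n z * cexp_sum n h - cexp_sum n (z + h)) <=
  series (exp_coeff (cmod z)) n * series (exp_coeff (cmod h)) n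
  - series (exp_coeff (cmod z)) n./2 * series (exp_coeff (cmod h)) n./2.
Proof.
have := @cauchy_product_error R (fun k => z ^+ k * cR (k`!%:R^-1))
  (fun k => h ^+ k * cR (k`!%:R^-1)) (exp_coeff (cmod z)) (exp_coeff (cmod h)) n.
have -> : \sum_(0 <= k < n) \sum_(0 <= i < k.+1)
    z ^+ i * cR (i`!%:R^-1) * (h ^+ (k - i) * cR ((k - i)`!%:R^-1)) =
    cexp_sum n (z + h).
  apply: eq_bigr => k _; rewrite addrC exprDn big_mkord mulr_suml.
  apply: eq_bigr => i _; have ik : (i <= k)%N by rewrite -ltnS.
  have natC m : (m%:R : R[i]) = cR m%:R.
    by elim: m => [//|m IHm]; rewrite -!natr1 cRD -IHm.
  rewrite -[_ *+ 'C(k, i)]mulr_natr natC.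
  have key : cR (i`!%:R^-1) * cR ((k - i)`!%:R^-1) =
      cR ('C(k, i)%:R) * cR (k`!%:R^-1) :> R[i].
    rewrite -!cRM -(bin_fact ik) !natrM; congr cR.
    by field; rewrite !pnatr_eq0 -!lt0n !fact_gt0 bin_gt0 ik.
  by rewrite -[RHS]mulrA -key; ring.
by apply => i; rewrite cmod_cexp_term.
Qed.

(** [z] is split into its real and imaginary parts, where the real exponential, cosine and sine
    series apply; the Cauchy product error makes the partial sums asymptotically multiplicative. *)
Lemma cexp_sum_cvg z e : 0 < e ->
  \forall n \near \oo, cmod (cexp_sum n z - cexp z) <= e.
Proof.
move=> e0; case: z => x y.
have zE : complex.Complex x y = cR x + complex.Complex 0 y.
  by congr complex.Complex; rewrite ?addr0 ?add0r.
have /cvgrPdist_le c1 := cvg_cauchy_error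
  (is_cvg_series_exp_coeff (cmod (cR x))) (is_cvg_series_exp_coeff (cmod (complex.Complex 0 y))).
have /cvgrPdist_le c2 : series (exp_coeff x) n * series (cos_coeff y) n @[n --> \oo] -->
   expR x * cos y.
  by apply: cvgM; [exact: cvg_series_expR | rewrite unlock; exact: is_cvg_series_cos_coeff].
have /cvgrPdist_le c3 : series (exp_coeff x) n * series (sin_coeff y) n @[n --> \oo] -->
   expR x * sin y.
  by apply: cvgM; [exact: cvg_series_expR | rewrite unlock; exact: is_cvg_series_sin_coeff].
have e3 : 0 < e / 3 by rewrite divr_gt0.
near=> n.
have -> : cexp_sum n (complex.Complex x y) - cexp (complex.Complex x y) =
  (cexp_sum n (cR x) * cexp_sum n (complex.Complex 0 y) - cexp (complex.Complex x y))
   - (cexp_sum n (cR x) * cexp_sum n (complex.Complex 0 y) -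
     cexp_sum n (cR x + complex.Complex 0 y)) by rewrite -zE; ring.
rewrite (le_trans (cmodB _ _))// (_ : e = (e / 3 + e / 3) + e / 3); last by field.
apply: lerD; last first.
  apply: le_trans (cexp_sumD _ _ _) _; apply: le_trans (ler_norm _) _.
  by rewrite -normrN -sub0r; near: n; exact: c1.
rewrite (le_trans (cmod_le_ReIm _))// cexp_sumR cexp_sum_imag /=.
rewrite !mul0r subr0 addr0; apply: lerD; rewrite distrC; near: n; [exact: c2|exact: c3].
Unshelve. all: by end_near. Qed.

Lemma cexp_sum_tail z m n : (m <= n)%N ->
  cmod (cexp_sum n z - cexp_sum m z) <= \sum_(m <= k < n) exp_coeff (cmod z) k.
Proof.
move=> mn; rewrite /cexp_sum (big_cat_nat (n := m))//= addrAC subrr add0r.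
rewrite (le_trans (cmod_sum _ _ _))//.
by apply: ler_sum => k _; rewrite cmod_cexp_term.
Qed.

(** The real tail at [x] dominates, so the error is uniform on the disc of radius [x]. *)
Lemma cexp_sum_unif z x n : cmod z <= x ->
  cmod (cexp_sum n z - cexp z) <= expR x - series (exp_coeff x) n.
Proof.
move=> zx; have x0 : 0 <= x by rewrite (le_trans _ zx)// cmod_ge0.
apply/ler_addgt0Pr => e e0.
near \oo => p.
have np : (n <= p)%N by near: p; exact: nbhs_infty_ge.
rewrite (_ : _ - _ = (cexp_sum p z - cexp z) - (cexp_sum p z - cexp_sum n z)); last by ring.
rewrite (le_trans (cmodB _ _))// addrC lerD//; last by near: p; exact: cexp_sum_cvg.
apply: le_trans (cexp_sum_tail z np) _.
apply: (@le_trans _ _ (series (exp_coeff x) p - series (exp_coeff x) n)).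
  rewrite sub_series_geq//; apply: ler_sum => k _.
  by apply: exp_coeff_homo => //; exact: cmod_ge0.
by rewrite lerD2r le_series_expR.
Unshelve. all: by end_near. Qed.

(** All remaining terms carry a factor [|h|^3], and [1 / (i + 3)! <= 1 / i!] sums what is left to at
    most [expR |h|]. *)
Lemma cexp_jet0 h : cmod h <= 1 ->
  cmod (cexp h - (1 + h + h ^+ 2 * cR (2^-1))) <= expR 1 * cmod h ^+ 3.
Proof.
move=> h1; apply/ler_addgt0Pr => e e0.
near \oo => p.
have np : (3 <= p)%N by near: p; exact: nbhs_infty_ge.
have -> : 1 + h + h ^+ 2 * cR (2^-1) = cexp_sum 3 h.
  rewrite /cexp_sum !big_nat_recr//= big_nil/= invr1 !cR1 !mulr1 add0r expr0 expr1.
  by rewrite (_ : 2`! = 2)%N.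
rewrite (_ : _ - _ = (cexp_sum p h - cexp_sum 3 h) - (cexp_sum p h - cexp h)); last by ring.
rewrite (le_trans (cmodB _ _))// lerD//; last by near: p; exact: cexp_sum_cvg.
apply: le_trans (cexp_sum_tail h np) _.
rewrite -{1}[3%N]add0n big_addn mulrC.
apply: (@le_trans _ _ (cmod h ^+ 3 * \sum_(0 <= i < p - 3) exp_coeff (cmod h) i)).
  rewrite mulr_sumr; apply: ler_sum => i _ /=.
  rewrite /exp_coeff/= addnC exprD -mulrA ler_wpM2l ?exprn_ge0 ?cmod_ge0//.
  rewrite ler_wpM2l ?exprn_ge0 ?cmod_ge0//.
  rewrite lef_pV2 ?posrE ?ltr0n ?fact_gt0// ler_nat.
  by rewrite leq_fact// leq_addl.
rewrite ler_wpM2l ?exprn_ge0 ?cmod_ge0//.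
apply: le_trans (le_series_expR _ (cmod_ge0 h)) _.
by rewrite ler_expR.
Unshelve. all: by end_near. Qed.

End ExpSeries.

(** * Second-order complex expansions and a maximum principle *)

Section Jets.
Import ComplexField.
Context {R : realType}.
Implicit Types (x y : R) (z h : R[i]) (F G : R[i] -> R[i]).

(** A pointwise form of holomorphy, stable under sums, scalar multiples and the exponential. The
    cubic error is what the maximum principle needs: it is negligible against a perturbation of size
    [r ^ 2]. *)
Definition jet2 F z := exists a b c : R[i], exists M d : R,
  [/\ 0 <= M, 0 < d, d <= 1 & forall h, cmod h <= d ->
     cmod (F (z + h) - (a + b * h + c * h ^+ 2)) <= M * cmod h ^+ 3].

Lemma jet2D F G z : jet2 F z -> jet2 G z -> jet2 (fun t => F t + G t) z.
Proof.
move=> [a [b [c [M [d [M0 d0 d1 H]]]]]] [a' [b' [c' [M' [d' [M'0 d'0 d'1 H']]]]]].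
exists (a + a'), (b + b'), (c + c'), (M + M'), (Num.min d d'); split.
- exact: addr_ge0.
- by rewrite lt_min d0.
- by rewrite ge_min d1.
move=> h; rewrite le_min => /andP[hd hd'].
rewrite (_ : _ - _ = (F (z + h) - (a + b * h + c * h ^+ 2)) +
  (G (z + h) - (a' + b' * h + c' * h ^+ 2))); last by ring.
by rewrite mulrDl (le_trans (cmodD _ _))// lerD ?H ?H'.
Qed.

Lemma jet2Z k F z : jet2 F z -> jet2 (fun t => k * F t) z.
Proof.
move=> [a [b [c [M [d [M0 d0 d1 H]]]]]].
exists (k * a), (k * b), (k * c), (cmod k * M), d; split=> //.
  by rewrite mulr_ge0 ?cmod_ge0.
move=> h hd; rewrite (_ : _ - _ = k * (F (z + h) - (a + b * h + c * h ^+ 2))); last by ring.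
by rewrite cmodM -mulrA ler_wpM2l ?cmod_ge0// H.
Qed.

Lemma jet2_id z : jet2 id z.
Proof.
exists z, 1, 0, 0, 1; split=> // h _.
by rewrite (_ : _ - _ = 0) ?cmod0 ?mul0r//; ring.
Qed.

Lemma jet2_sum (I : Type) (s : seq I) (F : I -> R[i] -> R[i]) z :
  (forall i, jet2 (F i) z) -> jet2 (fun t => \sum_(i <- s) F i t) z.
Proof.
move=> jF; elim: s => [|i s IH].
  under eq_fun do rewrite big_nil.
  exists 0, 0, 0, 0, 1; split=> // h _.
  by rewrite (_ : _ - _ = 0) ?cmod0 ?mul0r//; ring.
by under eq_fun do rewrite big_cons; exact: jet2D.
Qed.

Lemma jet2_cexp F z : jet2 F z -> jet2 (fun t => cexp (F t)) z.
Proof.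
move=> [a [b [c [M [d [M0 d0 d1 H]]]]]].
pose K := cmod b + cmod c + M.
have K0 : 0 <= K by rewrite !addr_ge0 ?cmod_ge0.
pose M' := cmod (cexp a) * (M + (cmod c + M) * (cmod b + K) + expR 1 * K ^+ 3).
(* The increment [k] of [F] satisfies [|k| <= K |h|]; the radius [(K + 1)^-1] keeps [|k| <= 1], as
   [cexp_jet0] requires. *)
exists (cexp a), (cexp a * b), (cexp a * (c + b ^+ 2 * cR (2^-1))), M',
  (Num.min d (K + 1)^-1).
have K1 : 0 < K + 1 by rewrite ltr_wpDl.
split.
- rewrite mulr_ge0 ?cmod_ge0//; apply: addr_ge0; last first.
    by rewrite mulr_ge0 ?expR_ge0 ?exprn_ge0.
  by rewrite addr_ge0// mulr_ge0 ?addr_ge0 ?cmod_ge0.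
- by rewrite lt_min d0 invr_gt0.
- by rewrite ge_min d1.
move=> h; rewrite le_min => /andP[hd hK].
have h0 := cmod_ge0 h; have h1 : cmod h <= 1 by exact: le_trans hd _.
have h2 : cmod h ^+ 2 <= cmod h by rewrite expr2 ler_piMr.
have h3 : cmod h ^+ 3 <= cmod h ^+ 2 by rewrite exprS ler_piMl ?exprn_ge0.
pose e := F (z + h) - (a + b * h + c * h ^+ 2).
have He : cmod e <= M * cmod h ^+ 3 by exact: H.
pose k := b * h + c * h ^+ 2 + e.
have Fk : F (z + h) = a + k by rewrite /k /e; ring.
have kb : cmod (k - b * h) <= (cmod c + M) * cmod h ^+ 2.
  rewrite (_ : k - _ = c * h ^+ 2 + e); last by rewrite /k; ring.
  rewrite (le_trans (cmodD _ _))// mulrDl lerD//; first by rewrite cmodM cmodX.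
  by rewrite (le_trans He)// ler_wpM2l.
have kK : cmod k <= K * cmod h.
  have -> : K * cmod h = cmod b * cmod h + (cmod c + M) * cmod h by rewrite /K; ring.
  rewrite (le_trans (cmod_leDB _ (b * h)))// cmodM lerD2l.
  by rewrite (le_trans kb)// ler_wpM2l// addr_ge0 ?cmod_ge0.
have k1 : cmod k <= 1.
  rewrite (le_trans kK)// (le_trans (ler_wpM2l K0 hK))// ler_pdivrMr// mul1r.
  by rewrite lerDl.
rewrite Fk cexpD.
set r := cexp k - (1 + k + k ^+ 2 * cR (2^-1)).
have Hr : cmod r <= expR 1 * (K * cmod h) ^+ 3.
  rewrite (le_trans (cexp_jet0 k1))// ler_wpM2l ?expR_ge0// lerXn2r//.
    by rewrite nnegrE cmod_ge0.
  by rewrite nnegrE mulr_ge0.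
(* The expansion contains [(b h)^2 / 2] instead of [k^2 / 2]; the difference
   [(k - b h)(k + b h) / 2] is of order [|h|^3]. *)
rewrite (_ : _ - _ = cexp a * (e + (k - b * h) * (k + b * h) * cR (2^-1) + r)); last first.
  rewrite (_ : cexp k = r + (1 + k + k ^+ 2 * cR (2^-1))); last by rewrite /r; ring.
  by rewrite /k; ring.
rewrite cmodM /M' -[leRHS]mulrA ler_wpM2l ?cmod_ge0//.
rewrite (le_trans (cmodD _ _))// [leRHS]mulrDl lerD//; last first.
  by rewrite (le_trans Hr)// exprMn mulrA.
rewrite (le_trans (cmodD _ _))// [leRHS]mulrDl lerD// !cmodM cmod_cR.
have half : `|2^-1 : R| <= 1 by rewrite ger0_norm; lra.
apply: (@le_trans _ _ (cmod (k - b * h) * cmod (k + b * h))).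
  by rewrite ler_piMr// mulr_ge0 ?cmod_ge0.
rewrite exprSr mulrACA; apply: ler_pM; rewrite ?cmod_ge0//.
  by rewrite (le_trans (cmodD _ _))// cmodM mulrDl addrC lerD2l.
Qed.

Lemma jet2_lip F z : jet2 F z -> exists2 K, 0 <= K & exists2 d, 0 < d &
  forall h, cmod h <= d -> cmod (F (z + h) - F z) <= K * cmod h.
Proof.
move=> [a [b [c [M [d [M0 d0 d1 H]]]]]].
exists (cmod b + cmod c + M); first by rewrite !addr_ge0 ?cmod_ge0.
exists d => // h hd.
have Fz : F z = a.
  have := H 0; rewrite cmod0 addr0 !(mulr0, expr0n) /= !addr0 => /(_ (ltW d0)) le0.
  have /eqP : cmod (F z - a) = 0 by apply/eqP; rewrite eq_le le0 cmod_ge0.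
  rewrite cmodE => /eqP/Normc.eq0_normc/eqP; rewrite subr_eq0 => /eqP//.
have h0 := cmod_ge0 h; have h1 : cmod h <= 1 by exact: le_trans hd _.
have h2 : cmod h ^+ 2 <= cmod h by rewrite expr2 ler_piMr.
have h3 : cmod h ^+ 3 <= cmod h by rewrite (le_trans _ h2)// exprS ler_piMl ?exprn_ge0.
rewrite Fz (_ : _ - _ = (b * h + c * h ^+ 2) +
   (F (z + h) - (a + b * h + c * h ^+ 2))); last by ring.
rewrite (le_trans (cmodD _ _))// mulrDl lerD//; last first.
  by rewrite (le_trans (H _ hd))// ler_wpM2l.
by rewrite (le_trans (cmodD _ _))// [leRHS]mulrDl -cmodM lerD// cmodM cmodX ler_wpM2l// cmod_ge0.
Qed.

(* The averages of [h] and [h ^+ 2] over the four directions vanish. *)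
Lemma jet2_mean F z : jet2 F z -> exists2 M, 0 <= M & exists2 d, 0 < d &
  forall r, 0 < r <= d ->
  cmod (F z) <= (cmod (F (z + cR r)) + cmod (F (z - cR r)) +
     cmod (F (z + complex.Complex 0 r)) + cmod (F (z - complex.Complex 0 r))) / 4
     + M * r ^+ 3.
Proof.
move=> [a [b [c [M [d [M0 d0 d1 H]]]]]]; exists M => //; exists d => // r /andP[r0 rd].
have Fz : F z = a.
  have := H 0; rewrite cmod0 addr0 !(mulr0, expr0n) /= !addr0 => /(_ (ltW d0)) le0.
  have /eqP : cmod (F z - a) = 0 by apply/eqP; rewrite eq_le le0 cmod_ge0.
  rewrite cmodE => /eqP/Normc.eq0_normc/eqP; rewrite subr_eq0 => /eqP//.
have ci : cmod (complex.Complex 0 r) = r.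
  by rewrite /cmod/= expr0n add0r sqrtr_sqr gtr0_norm.
have cr : cmod (cR r) = r by rewrite cmod_cR gtr0_norm.
have := H (cR r); have := H (- cR r); have := H (complex.Complex 0 r).
have := H (- complex.Complex 0 r).
rewrite !cmodN cr ci => /(_ rd) H1 /(_ rd) H2 /(_ rd) H3 /(_ rd) H4.
have i2 : complex.Complex 0 r ^+ 2 = - cR r ^+ 2.
  by congr complex.Complex => /=; ring.
have E : 4 * cmod a <= cmod (F (z + cR r)) + cmod (F (z - cR r)) +
     cmod (F (z + complex.Complex 0 r)) + cmod (F (z - complex.Complex 0 r))
     + 4 * (M * r ^+ 3).
  have -> : 4 * cmod a = cmod (cR 4 * a) by rewrite cmodM cmod_cR ger0_norm.
  have e4 : cR 4 = 4 :> R[i].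
    by rewrite (_ : 4 = 1 + 1 + 1 + 1 :> R) ?cRD ?cR1; ring.
  set e1 := F (z - complex.Complex 0 r) - _ in H1.
  set e2 := F (z + complex.Complex 0 r) - _ in H2.
  set e3 := F (z - cR r) - _ in H3.
  set e5 := F (z + cR r) - _ in H4.
  rewrite (_ : cR 4 * a = F (z + cR r) + F (z - cR r) + F (z + complex.Complex 0 r)
     + F (z - complex.Complex 0 r) - (e1 + e2 + e3 + e5)); last first.
    by rewrite e4 /e1 /e2 /e3 /e5 !sqrrN i2; ring.
  rewrite (le_trans (cmodB _ _))// lerD//.
    do 2 (rewrite (le_trans (cmodD _ _))// lerD2r).
    exact: cmodD.
  have -> : 4 * (M * r ^+ 3) = M * r ^+ 3 + M * r ^+ 3 + M * r ^+ 3 + M * r ^+ 3 by ring.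
  by do 3 (rewrite (le_trans (cmodD _ _))// lerD//).
rewrite Fz; lra.
Qed.

(** Adding [ep * x ^ 2] makes [|F|] strictly subharmonic: the four-point mean of the perturbation
    exceeds its value at the centre by [ep * r ^ 2 / 2], which at an interior maximum the cubic
    error cannot offset for small [r]. *)
Lemma maximum_principle_rect F (x1 x2 y1 y2 M : R) :
  (forall z, jet2 F z) ->
  (forall x y, x1 <= x <= x2 -> y1 <= y <= y2 ->
     [\/ x = x1, x = x2, y = y1 | y = y2] ->
     cmod (F (complex.Complex x y)) <= M) ->
  forall x y, x1 <= x <= x2 -> y1 <= y <= y2 ->
    cmod (F (complex.Complex x y)) <= M.
Proof.
move=> jF bd x y xI yI; rewrite leNgt; apply/negP => Mlt.
pose X := x1 ^+ 2 + x2 ^+ 2 + 1.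
have X0 : 0 < X by rewrite ltr_wpDl// addr_ge0// sqr_ge0.
(* [X] bounds the square of the abscissa on the rectangle, and [ep * X] is half the excess over [M]
   at [(x, y)]; the perturbed function at [(x, y)] thus still beats all its boundary values. *)
pose ep := (cmod (F (complex.Complex x y)) - M) / (2 * X).
have ep0 : 0 < ep by rewrite divr_gt0 ?subr_gt0// mulr_gt0.
have xX t : x1 <= t <= x2 -> t ^+ 2 <= X.
  move=> /andP[t1 t2]; rewrite /X; have [t0|t0] := leP 0 t.
    have : t ^+ 2 <= x2 ^+ 2 by rewrite lerXn2r// nnegrE// (le_trans t0).
    by have := sqr_ge0 x1; lra.
  have : (- t) ^+ 2 <= (- x1) ^+ 2 by rewrite lerXn2r// ?nnegrE; lra.
  by rewrite !sqrrN; have := sqr_ge0 x2; lra.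
pose g (p : R * R) := cmod (F (complex.Complex p.1 p.2)) + ep * (p.1 ^+ 2).
pose A : set (R * R) := `[x1, x2] `*` `[y1, y2].
have A0 : A !=set0 by exists (x, y); split; rewrite /= in_itv.
have cA : compact A by apply: compact_setX; exact: segment_compact.
have cg : continuous g.
  move=> p; apply: cvgD; last first.
    by apply: cvgMr; rewrite /=; apply: (@continuous_comp _ _ _ fst (fun t : R => t ^+ 2));
      [exact: cvg_fst | exact: exprn_continuous].
  have [K K0 [d d0 HK]] := jet2_lip (jF (complex.Complex p.1 p.2)).
  apply/cvgrPdist_le => e e0.
  pose d' := Num.min d (e / (K + 1)) / 2.
  have K1 : 0 < K + 1 by rewrite ltr_wpDl.
  have d'0 : 0 < d' by rewrite divr_gt0// lt_min d0 divr_gt0.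
  have /cvgrPdist_le/(_ _ d'0) n1 : (fst : R * R -> R) q @[q --> p] --> p.1 by exact: cvg_fst.
  have /cvgrPdist_le/(_ _ d'0) n2 : (snd : R * R -> R) q @[q --> p] --> p.2 by exact: cvg_snd.
  near=> q.
  have h1 : `|p.1 - q.1| <= d' by near: q; exact: n1.
  have h2 : `|p.2 - q.2| <= d' by near: q; exact: n2.
  pose h := complex.Complex (q.1 - p.1) (q.2 - p.2).
  have qE : complex.Complex q.1 q.2 = complex.Complex p.1 p.2 + h.
    by congr complex.Complex => /=; ring.
  have hd : cmod h <= Num.min d (e / (K + 1)).
    rewrite (le_trans (cmod_le_ReIm _))//= (distrC q.1) (distrC q.2).
    by rewrite (le_trans (lerD h1 h2))// -splitr.
  move: hd; rewrite le_min => /andP[hd he].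
  rewrite qE; have HKh := HK _ hd.
  have KE : K * cmod h <= e.
    rewrite (le_trans (ler_wpM2l K0 he))// mulrCA ler_piMr ?(ltW e0)//.
    by rewrite ler_pdivrMr// mul1r lerDl.
  rewrite ler_norml; apply/andP; split.
    rewrite lerNl opprB lerBlDl (le_trans (cmod_leDB _ (F (complex.Complex p.1 p.2))))//.
    by rewrite lerD2l (le_trans HKh).
  rewrite lerBlDl (le_trans (cmod_leDB _ (F (complex.Complex p.1 p.2 + h))))//.
  by rewrite lerD2l cmod_distC (le_trans HKh).
have [[u v] + gmax] := compact_EVT_max A0 cA (continuous_subspaceT cg).
rewrite inE /A /= => -[]; rewrite /= !in_itv /= => uI vI.
have gle p : x1 <= p.1 <= x2 -> y1 <= p.2 <= y2 -> g p <= g (u, v).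
  by move=> h1 h2; apply: gmax; rewrite inE; split; rewrite /= in_itv.
have guv : M + ep * X < g (u, v).
  apply: (@lt_le_trans _ _ (g (x, y))); last exact: gle.
  have epX : ep * X = (cmod (F (complex.Complex x y)) - M) / 2.
    by rewrite /ep; field; rewrite gt_eqF.
  have xx : 0 <= ep * x ^+ 2 by rewrite mulr_ge0 ?(ltW ep0) ?sqr_ge0.
  by rewrite /g/= epX; move: Mlt xx; lra.
have [ub|unb] := pselect [\/ u = x1, u = x2, v = y1 | v = y2].
  have := bd _ _ uI vI ub; move: guv; rewrite /g/=.
  have : ep * u ^+ 2 <= ep * X by rewrite ler_wpM2l ?(ltW ep0)// xX.
  by lra.
have [u1 u2 v1 v2] : [/\ x1 < u, u < x2, y1 < v & v < y2].
  move: uI vI => /andP[u1 u2] /andP[v1 v2].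
  split; rewrite lt_neqAle ?u1 ?u2 ?v1 ?v2 andbT; apply/eqP => E; apply: unb.
  - by rewrite E; exact: Or41.
  - exact: Or42.
  - by rewrite E; exact: Or43.
  - exact: Or44.
have [K K0 [d d0 HK]] := jet2_mean (jF (complex.Complex u v)).
pose m := Num.min (Num.min (u - x1) (x2 - u)) (Num.min (v - y1) (y2 - v)).
(* The four neighbours stay in the rectangle and in the range of the expansion, and
   [4 K r ^ 3 < ep r ^ 2]. *)
pose r := Num.min (Num.min d m) (ep / (4 * (K + 1))).
have K1 : 0 < K + 1 by rewrite ltr_wpDl.
have r0 : 0 < r by rewrite !lt_min d0 !subr_gt0 u1 u2 v1 v2 divr_gt0// mulr_gt0.
have rd : r <= d by rewrite !ge_min lexx.
have [ru1 ru2 rv1 rv2] : [/\ r <= u - x1, r <= x2 - u, r <= v - y1 & r <= y2 - v].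
  by split; rewrite /r /m !ge_min lexx ?orbT.
have re : r * (4 * (K + 1)) <= ep.
  by rewrite -ler_pdivlMr ?mulr_gt0// /r ge_min lexx orbT.
have := HK r; rewrite r0 rd => /(_ isT) HH.
have := gle (u + r, v); have := gle (u - r, v); have := gle (u, v + r).
have := gle (u, v - r); rewrite /g /=.
have xI1 : x1 <= u + r <= x2 by apply/andP; split; lra.
have xI2 : x1 <= u - r <= x2 by apply/andP; split; lra.
have yI1 : y1 <= v + r <= y2 by apply/andP; split; lra.
have yI2 : y1 <= v - r <= y2 by apply/andP; split; lra.
move=> /(_ uI yI2) G1 /(_ uI yI1) G2 /(_ xI2 vI) G3 /(_ xI1 vI) G4.
move: HH.
have -> : complex.Complex u v + cR r = complex.Complex (u + r) v.
  by congr complex.Complex; rewrite /= addr0.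
have -> : complex.Complex u v - cR r = complex.Complex (u - r) v.
  by congr complex.Complex; rewrite /= ?oppr0 ?addr0.
have -> : complex.Complex u v + complex.Complex 0 r = complex.Complex u (v + r).
  by congr complex.Complex; rewrite /= addr0.
have -> : complex.Complex u v - complex.Complex 0 r = complex.Complex u (v - r).
  by congr complex.Complex; rewrite /= ?oppr0 ?addr0.
have r2 : 0 < r ^+ 2 by rewrite exprn_gt0.
have KR : 4 * (K * r ^+ 3) < ep * r ^+ 2.
  rewrite exprS mulrCA mulrA mulrA ltr_pM2r//; move: re r0; rewrite !mulrDr; lra.
have E1 : ep * (u + r) ^+ 2 = ep * u ^+ 2 + 2 * (ep * u * r) + ep * r ^+ 2 by ring.
have E2 : ep * (u - r) ^+ 2 = ep * u ^+ 2 - 2 * (ep * u * r) + ep * r ^+ 2 by ring.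
have epr : 0 < ep * r ^+ 2 by rewrite mulr_gt0.
move: G1 G2 G3 G4 KR epr; rewrite E1 E2; lra.
Unshelve. all: by end_near. Qed.

End Jets.

(** * Phragmen-Lindelof comparison in logarithmic coordinates *)

Section PhragmenLindelof.
Context {R : realType}.
Implicit Types (x y : R) (z h t : R[i]) (b : nat -> R).

Definition cpoly b n t : R[i] := \sum_(0 <= k < n) cR (b k) * t ^+ k.

(* An entire function is handled through its Taylor polynomials only: an upper
   bound for the function is a bound for the polynomials up to a uniformly
   small error on bounded sets. *)
Definition taylor_bound b (C B al : R) := forall T e : R, 0 < e ->
  \forall n \near \oo, forall t, cmod t <= T ->
    cmod (cpoly b n t) <=
      C * expR (cmod t - `|complex.Re t| + B * cmod t `^ al) + e.

Lemma ler_cos : {in `[0, pi : R] &, {mono (@cos R) : x y /~ x <= y}}.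
Proof. by move=> x y xI yI; rewrite leNgt ltr_cos// -leNgt. Qed.

Lemma sin_le_id x : 0 <= x -> sin x <= x.
Proof.
move=> x0; have [|c _] := MVT_segment x0 (fun u _ => is_derive_sin u).
  by apply: continuous_subspaceT => u; exact: continuous_sin.
by rewrite sin0 !subr0 => ->; rewrite ler_piMl// cos_le1.
Qed.

Lemma cexpX z k : cexp z ^+ k = cexp (cR k%:R * z).
Proof.
elim: k => [|k IH]; first by rewrite cR0 mul0r cexp0.
by rewrite exprS IH -cexpD -natr1 cRD cR1; congr cexp; ring.
Qed.

Lemma expR_powR x al : expR x `^ al = expR (al * x).
Proof. by rewrite -expRM mulrC. Qed.

(** For [t = i s e^z], the strip [|y| < pi / 2] in [z = x + i y] is the half-plane selected by the
    sign [s], and [y = 0] is the imaginary axis. The polynomial is multiplied by [cexp Psi], of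
    modulus [expR (- P)]. Of the three nonnegative terms of [P], the one in [a] pays for the type on
    the sides, the one in [al] for the weight, the one in [be] for the far end; the first and the
    last cost at most [1 / 2] each at [(x0, y0)]. *)
Lemma phragmen_lindelof_axis b (C B al s x0 y0 : R) :
  0 < C -> 0 <= B -> 0 < al -> al < 1 -> `|s| = 1 -> `|y0| < pi / 2 ->
  taylor_bound b C B al ->
  \forall n \near \oo,
    cmod (cpoly b n (complex.Complex 0 s * cexp (complex.Complex x0 y0))) <=
    2 * C * expR 3 * expR (B / cos (al * (pi / 2)) * expR (al * x0)).
Proof.
move=> C0 B0 al0 al1 s1 y0pi HT.
have pi20 : 0 < (pi / 2 : R) by rewrite divr_gt0 ?pi_gt0.
have inI (u : R) : 0 <= u -> u <= pi / 2 -> u \in `[0, pi].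
  by move=> u0 u1; rewrite in_itv/= u0/=; move: pi20; lra.
(* The first bound keeps [|y0| <= ph]; the second makes [a * expR x0 <= 1 / 2], because
   [a = sin de <= de]. *)
pose de : R := Num.min ((pi / 2 - `|y0|) / 2) (expR (- x0) / 2).
have de0 : 0 < de by rewrite lt_min !divr_gt0 ?subr_gt0 ?expR_gt0.
have depi : de < pi / 2.
  rewrite (@le_lt_trans _ _ ((pi / 2 - `|y0|) / 2)) ?ge_min ?lexx//.
  by have := normr_ge0 y0; lra.
pose ph : R := pi / 2 - de.
have ph0 : 0 < ph by rewrite subr_gt0.
have phpi : ph < pi / 2 by rewrite /ph; lra.
have y0ph : `|y0| <= ph.
  have : de <= (pi / 2 - `|y0|) / 2 by rewrite ge_min lexx.
  rewrite /ph; lra.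
pose a : R := cos ph.
have a0 : 0 < a by apply: cos_gt0_pihalf; apply/andP; split; lra.
have ax0 : a * expR x0 <= 2^-1.
  have : a <= de.
    rewrite /a /ph -cosN opprB cosBpihalf.
    by apply: sin_le_id; exact: ltW.
  have : de <= expR (- x0) / 2 by rewrite /de ge_min lexx orbT.
  move=> h1 h2; have := le_trans h2 h1.
  rewrite -(ler_pM2r (expR_gt0 x0)) mulrAC -expRD addNr expR0 mul1r //.
(* [be * ph = ph + (pi / 2 - ph) * ph / pi], which is still below [pi / 2]. *)
pose be : R := 1 + (pi / 2 - ph) / pi.
have be1 : 1 < be by rewrite /be ltrDl divr_gt0 ?pi_gt0// subr_gt0.
have beph : be * ph < pi / 2.
  rewrite /be mulrDl mul1r mulrAC -ltrBrDl ltr_pdivrMr ?pi_gt0//.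
  by rewrite ltr_pM2l ?subr_gt0//; have := @pi_gt0 R; lra.
pose c : R := cos (be * ph).
have beph0 : 0 < be * ph by rewrite mulr_gt0// (lt_trans _ be1).
have c0 : 0 < c by apply: cos_gt0_pihalf; apply/andP; split; lra.
pose ep : R := expR (- (be * x0)) / 2.
have ep0 : 0 < ep by rewrite divr_gt0 ?expR_gt0.
have alpi : al * (pi / 2) < pi / 2 by rewrite gtr_pMl.
have alpi0 : 0 < al * (pi / 2) by rewrite mulr_gt0.
pose ca : R := cos (al * (pi / 2)).
have ca0 : 0 < ca by apply: cos_gt0_pihalf; apply/andP; split; lra.
pose B' := B / ca.
have B'0 : 0 <= B' by rewrite divr_ge0// ltW.
(* Up to [- (B / al)] both [expR x] and [B * expR (al * x)] are at most [1]; from the second entry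
   of [x2] on, the [be] term alone is at least [(1 + B) * expR x]. *)
pose x1 := Num.min x0 (- (B / al)).
pose x2 := Num.max x0 ((1 + B) / (ep * c * (be - 1))).
have x10 : x1 <= x0 by rewrite ge_min lexx.
have x20 : x0 <= x2 by rewrite le_max lexx.
have cosge (k y : R) : 0 <= k -> k * ph <= pi / 2 -> `|y| <= ph -> 0 <= cos (k * y).
  move=> k0 kp yp; rewrite -cos_norm normrM ger0_norm//.
  have := ler_wpM2l k0 yp; have := mulr_ge0 k0 (normr_ge0 y) => h1 h2.
  by apply: cos_ge0_pihalf; apply/andP; split; lra.
have alph : al * ph <= pi / 2.
  by rewrite (le_trans _ (ltW alpi))// ler_pM2l// ltW.
pose P x y := a * expR x * cos y + B' * expR (al * x) * cos (al * y) +
    ep * expR (be * x) * cos (be * y).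
have P_ge x y : `|y| <= ph -> [/\ 0 <= a * expR x * cos y,
    0 <= B' * expR (al * x) * cos (al * y) & 0 <= ep * expR (be * x) * cos (be * y)].
  move=> yp; split; apply: mulr_ge0.
  - by rewrite mulr_ge0 ?expR_ge0// ltW.
  - by have := cosge 1 y; rewrite !mul1r; apply=> //; exact: ltW.
  - by rewrite mulr_ge0 ?expR_ge0.
  - by rewrite cosge// ltW.
  - by rewrite mulr_ge0 ?expR_ge0// ltW.
  - by rewrite cosge// ltW// (lt_trans _ be1).
pose E x y := expR x - `|expR x * sin y| + B * expR (al * x).
have EP x y : x1 <= x <= x2 -> `|y| <= ph -> [\/ x = x1, x = x2, y = - ph | y = ph] ->
    E x y - P x y <= 2.
  move=> xI yp; have [p1 p2 p3] := P_ge x y yp.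
  (* On the long sides [1 - sin ph <= 1 - sin ph ^ 2 = a * cos ph] makes the first term of [P]
     sufficient, and [cos (al * ph) >= cos (al * pi / 2)] the second. *)
  have top : `|y| = ph -> E x y - P x y <= 2.
    move=> yE.
    have h1 : expR x - `|expR x * sin y| <= a * expR x * cos y.
      have -> : cos y = a by rewrite -cos_norm yE.
      rewrite normrM (ger0_norm (expR_ge0 _)).
      have -> : `|sin y| = sin ph.
        have sp : 0 <= sin ph.
          by apply: sin_ge0_pi; apply/andP; split; move: phpi ph0; lra.
        rewrite -yE in sp *; case: (ger0P y) sp => _; rewrite ?sinN => sp.
          by rewrite ger0_norm.
        by rewrite ler0_norm// -oppr_ge0.
      rewrite mulrAC mulrC -{1}[expR x]mul1r -mulrBl ler_wpM2r ?expR_ge0//.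
      rewrite -expr2 cos2sin2; have := sin_le1 ph.
      have : 0 <= sin ph by apply: sin_ge0_pi; apply/andP; split; move: phpi ph0; lra.
      set u := sin ph => u0 u1; have : u ^+ 2 <= u by rewrite expr2 ler_piMr.
      lra.
    have h2 : B * expR (al * x) <= B' * expR (al * x) * cos (al * y).
      rewrite mulrAC ler_wpM2r ?expR_ge0// /B' -mulrA ler_peMr//.
      rewrite mulrC ler_pdivlMr// mul1r -[cos (al * y)]cos_norm normrM yE (gtr0_norm al0).
      have alph0 : 0 <= al * ph by rewrite ltW// mulr_gt0.
      rewrite ler_cos; [|exact: inI (ltW alpi0) (ltW alpi)|exact: inI].
      by rewrite ler_pM2l// ltW.
    rewrite /E /P; move: p3 h1 h2; lra.
  case => [xE|xE|yE|yE]; last 2 first.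
  - by apply: top; rewrite yE normrN gtr0_norm.
  - by apply: top; rewrite yE gtr0_norm.
  - have xb : x <= - (B / al) by rewrite xE ge_min lexx orbT.
    have e1 : expR x <= 1.
      by rewrite expR_le1 (le_trans xb)// oppr_le0 divr_ge0// ltW.
    have e2 : B * expR (al * x) <= 1.
      apply: (@le_trans _ _ (B * expR (- B))).
        rewrite ler_wpM2l// ler_expR; have := ler_wpM2l (ltW al0) xb.
        by rewrite mulrN mulrCA divff ?gt_eqF// mulr1.
      rewrite expRN ler_pdivrMr ?expR_gt0// mul1r.
      by apply: le_trans (expR_ge1Dx B); rewrite lerDr.
    rewrite /E /P; have := normr_ge0 (expR x * sin y); move: p1 p2 p3 e1 e2; lra.
  - have xb : (1 + B) / (ep * c * (be - 1)) <= x by rewrite xE le_max lexx orbT.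
    have be0 : 0 < be - 1 by rewrite subr_gt0.
    have D0 : 0 < ep * c * (be - 1) by apply: mulr_gt0 => //; exact: mulr_gt0.
    have xp : 0 <= x.
      by rewrite (le_trans _ xb)// divr_ge0 ?addr_ge0// ltW.
    have e1 : expR (al * x) <= expR x by rewrite ler_expR ler_piMl// ltW.
    have e2 : (1 + B) * expR x <= ep * expR (be * x) * c.
      have bxE : be * x = (be - 1) * x + x by ring.
      have -> : ep * expR (be * x) * c = ep * (c * expR ((be - 1) * x)) * expR x.
        by rewrite bxE expRD; ring.
      rewrite ler_wpM2r ?expR_ge0//.
      move: xb; rewrite ler_pdivrMr// => xb; apply: (le_trans xb).
      have -> : x * (ep * c * (be - 1)) = ep * (c * ((be - 1) * x)) by ring.
      rewrite (ler_pM2l ep0) (ler_pM2l c0).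
      by apply: le_trans (expR_ge1Dx _); rewrite lerDr.
    have e3 : c <= cos (be * y).
      rewrite -[cos (be * y)]cos_norm normrM (ger0_norm (ltW (lt_trans ltr01 be1))).
      have : be * `|y| <= be * ph by rewrite ler_wpM2l// (ltW (lt_trans ltr01 be1)).
      have : 0 <= be * `|y| by rewrite mulr_ge0// (ltW (lt_trans ltr01 be1)).
      move=> h1 h2; rewrite ler_cos//; apply: inI => //; try exact: ltW.
      exact: (le_trans h2 (ltW beph)).
    have e4 : ep * expR (be * x) * c <= ep * expR (be * x) * cos (be * y).
      by rewrite ler_wpM2l// mulr_ge0 ?expR_ge0// ltW.
    have e5 := ler_wpM2l B0 e1.
    rewrite /E /P; have := normr_ge0 (expR x * sin y).
    move: e2; rewrite mulrDl mul1r; move: p1 p2 e4 e5; lra.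
have T0 : 0 < expR x2 by exact: expR_gt0.
near=> n.
(* The error of the Taylor polynomials is taken to be [C] itself, whence the factor [2] in the
   conclusion. *)
have Hn : forall t, cmod t <= expR x2 -> cmod (cpoly b n t) <=
    C * expR (cmod t - `|complex.Re t| + B * cmod t `^ al) + C.
  by near: n; exact: HT.
pose om : R[i] := complex.Complex 0 s.
have om1 : cmod om = 1.
  by rewrite /cmod/= expr0n add0r sqrtr_sqr.
pose Psi z := cR (- a) * cexp z + (cR (- B') * cexp (cR al * z) +
   cR (- ep) * cexp (cR be * z)).
pose Phi z := \sum_(0 <= k < n) (cR (b k) * om ^+ k) * cexp (cR k%:R * z + Psi z).
have jPhi z : jet2 Phi z.
  apply: jet2_sum => k; apply: jet2Z; apply: jet2_cexp; apply: jet2D.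
    by apply: jet2Z; exact: jet2_id.
  apply: jet2D; first by apply: jet2Z; apply: jet2_cexp; exact: jet2_id.
  by apply: jet2D; apply: jet2Z; apply: jet2_cexp; apply: jet2Z; exact: jet2_id.
have PhiE z : Phi z = cpoly b n (om * cexp z) * cexp (Psi z).
  rewrite /Phi /cpoly mulr_suml; apply: eq_bigr => k _.
  by rewrite exprMn cexpX cexpD; ring.
have RePsi x y : complex.Re (Psi (complex.Complex x y)) = - P x y.
  by rewrite /Psi /P /= !mul0r !subr0 !addr0; ring.
have PhiM x y : cmod (Phi (complex.Complex x y)) =
    cmod (cpoly b n (om * cexp (complex.Complex x y))) * expR (- P x y).
  by rewrite PhiE cmodM cmod_cexp RePsi.
have tmod x y : cmod (om * cexp (complex.Complex x y)) = expR x.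
  by rewrite cmodM om1 cmod_cexp mul1r.
have tRe x y : `|complex.Re (om * cexp (complex.Complex x y))| = `|expR x * sin y|.
  by rewrite /= mul0r sub0r normrN normrM s1 mul1r.
have Pge0 x y : `|y| <= ph -> 0 <= P x y.
  by move=> /(P_ge x y)[p1 p2 p3]; rewrite !addr_ge0.
have := @maximum_principle_rect R Phi x1 x2 (- ph) ph (2 * C * expR 2) jPhi.
move=> /(_ _ x0 y0).
have xI0 : x1 <= x0 <= x2 by rewrite x10.
have yI0 : - ph <= y0 <= ph by rewrite -ler_norml.
move=> /(_ _ xI0 yI0) MP.
have {}MP : cmod (Phi (complex.Complex x0 y0)) <= 2 * C * expR 2.
  apply: MP => x y xI; rewrite -ler_norml => yI bdy.
  rewrite PhiM.
  have xx2 : expR x <= expR x2 by rewrite ler_expR; case/andP: xI.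
  have := Hn (om * cexp (complex.Complex x y)); rewrite tmod tRe => /(_ xx2) H1.
  apply: (@le_trans _ _ ((C * expR (E x y) + C) * expR (- P x y))).
    by rewrite ler_wpM2r ?expR_ge0// (le_trans H1)// expR_powR.
  have h2 : expR (E x y) * expR (- P x y) <= expR 2.
    by rewrite -expRD ler_expR; exact: EP.
  have h3 : expR (- P x y) <= expR 2.
    by rewrite ler_expR; have := Pge0 x y yI; lra.
  rewrite mulrDl -mulrA.
  have -> : 2 * C * expR 2 = C * expR 2 + C * expR 2 by ring.
  by rewrite lerD// ler_wpM2l// ltW.
move: MP; rewrite PhiM expRN ler_pdivrMr ?expR_gt0// => MP.
apply: (le_trans MP); rewrite -!mulrA ler_pM2l// ler_pM2l// -!expRD ler_expR.
(* The [1] here and the [2] in the exponent of the boundary bound add up to the exponent [3]. *)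
have : P x0 y0 <= 1 + B / ca * expR (al * x0).
  rewrite /P -/B'.
  have h1 : a * expR x0 * cos y0 <= 2^-1.
    by apply: (le_trans _ ax0); rewrite ler_piMr ?cos_le1// mulr_ge0 ?expR_ge0// ltW.
  have h2 : B' * expR (al * x0) * cos (al * y0) <= B' * expR (al * x0).
    by rewrite ler_piMr ?cos_le1// mulr_ge0 ?expR_ge0.
  have h3 : ep * expR (be * x0) * cos (be * y0) <= 2^-1.
    have -> : ep * expR (be * x0) = 2^-1.
      by rewrite /ep mulrAC -expRD addNr expR0 mul1r.
    by rewrite ler_piMr ?cos_le1// invr_ge0.
  move: h1 h2 h3; lra.
rewrite -/ca; lra.
Unshelve. all: by end_near. Qed.

End PhragmenLindelof.

(** * From bounds on circles to Taylor coefficients *)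

Section CoefficientBound.
Context {R : realType}.
Implicit Types (x y : R) (z h t : R[i]) (b d : nat -> R).

(** The angle is measured from the imaginary axis: [s] is the sign of [Im t] and
    [sin y = - s * Re t / |t|], of modulus below [1] off the real axis. *)
Lemma polar_upper_lower t : complex.Im t != 0 -> exists s y : R,
  [/\ `|s| = 1, `|y| < pi / 2 &
    t = complex.Complex 0 s * cexp (complex.Complex (ln (cmod t)) y)].
Proof.
case: t => p q /= q0; set r := cmod _.
have q2 : 0 < q ^+ 2 by rewrite lt_def sqr_ge0 sqrf_eq0 q0.
have r2 : r ^+ 2 = p ^+ 2 + q ^+ 2.
  by rewrite sqr_sqrtr//= addr_ge0 ?sqr_ge0.
have r0 : 0 < r.
  by rewrite lt_def cmod_ge0 andbT -sqrf_eq0 r2 gt_eqF// ltr_wpDl ?sqr_ge0.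
pose s := Num.sg q; have s1 : `|s| = 1 by rewrite normr_sg q0.
have s2 : s * s = 1 by rewrite -expr2 sqr_sg q0.
pose v := - (s * p / r).
have v2 : 1 - v ^+ 2 = (`|q| / r) ^+ 2.
  rewrite /v sqrrN !exprMn exprVn r2 sqr_sg q0 mul1r real_normK ?num_real//.
  by field; rewrite -r2 gt_eqF// exprn_gt0.
have v1 : `|v| < 1.
  rewrite -(@ltr_pXn2r _ 2)// ?nnegrE// expr1n real_normK ?num_real//.
  rewrite -subr_gt0 v2 exprn_gt0// divr_gt0// normr_gt0//.
move: (v1); rewrite ltr_norml => /andP[vN vP].
have vI : -1 <= v <= 1 by rewrite !ltW.
exists s, (asin v); split=> //.
  by rewrite ltr_norml asin_gtNpi2 ?asin_ltpi2// ?vN ?vP ?(ltW vN) ?(ltW vP).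
have e : expR (ln r) = r by rewrite lnK// posrE.
congr complex.Complex; rewrite /= e !mul0r ?sub0r ?addr0.
  rewrite asinK ?in_itv//=.
  have -> : - (s * (r * v)) = s * s * p by rewrite /v; field; rewrite gt_eqF.
  by rewrite s2 mul1r.
rewrite cos_asin// v2 sqrtr_sqr ger0_norm ?divr_ge0// ?(ltW r0)//.
by rewrite [r * _]mulrC divfK ?gt_eqF// add0r /s -numEsg.
Qed.

Lemma circle_bound b (C B al : R) t :
  0 < C -> 0 <= B -> 0 < al -> al < 1 -> 0 < cmod t ->
  taylor_bound b C B al ->
  \forall n \near \oo, cmod (cpoly b n t) <=
    2 * C * expR 3 * expR (B / cos (al * (pi / 2)) * cmod t `^ al).
Proof.
move=> C0 B0 al0 al1 t0 HT.
have [im0|im0] := eqVneq (complex.Im t) 0; last first.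
  have [s [y [s1 ypi tE]]] := polar_upper_lower im0.
  have := @phragmen_lindelof_axis R b C B al s (ln (cmod t)) y C0 B0 al0 al1 s1 ypi HT.
  by rewrite -tE -(expR_powR (ln (cmod t))) lnK// posrE.
(* On the real axis [|t| - |Re t| = 0], so the hypothesis suffices without any comparison. *)
have tRe : `|complex.Re t| = cmod t.
  by rewrite /cmod im0 expr0n addr0 sqrtr_sqr.
have ca0 : 0 < cos (al * (pi / 2)) :> R.
  have pi20 : 0 < (pi / 2 : R) by rewrite divr_gt0 ?pi_gt0.
  have : al * (pi / 2) < pi / 2 by rewrite gtr_pMl.
  have : 0 < al * (pi / 2) by rewrite mulr_gt0.
  by move=> h1 h2; apply: cos_gt0_pihalf; apply/andP; split; lra.
have HT' := HT (cmod t) C C0.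
near=> n.
have : cmod (cpoly b n t) <=
   C * expR (cmod t - `|complex.Re t| + B * cmod t `^ al) + C.
  by near: n; apply: filterS HT' => n; exact.
rewrite tRe subrr add0r => /le_trans; apply.
have p0 : 0 <= cmod t `^ al by exact: powR_ge0.
have e1 : expR (B * cmod t `^ al) <= expR (B / cos (al * (pi / 2)) * cmod t `^ al).
  rewrite ler_expR ler_wpM2r// ler_peMr//.
  by rewrite invf_ge1// cos_le1.
set Y := expR (B / _ * _) in e1 *.
have Y1 : 1 <= Y.
  by rewrite -expR0 ler_expR mulr_ge0// divr_ge0// ltW.
have E3 : 1 <= expR 3 :> R by rewrite -expR0 ler_expR.
apply: (@le_trans _ _ (2 * C * Y)); last first.
  rewrite [leRHS]mulrAC ler_peMr//; apply: mulr_ge0; last exact: le_trans Y1.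
  by rewrite mulr_ge0// ltW.
have -> : 2 * C * Y = C * Y + C * Y by ring.
by rewrite lerD// ?ler_pM2l// ler_peMr// ltW.
Unshelve. all: by end_near. Qed.

Lemma near_forall_ltn (P : nat -> nat -> Prop) N :
  (forall j, \forall n \near \oo, P j n) ->
  \forall n \near \oo, forall j, (j < N)%N -> P j n.
Proof.
move=> HP; elim: N => [|N IH]; first by near=> n.
near=> n => j; rewrite ltnS leq_eqVlt => /orP[/eqP->|jN].
  by near: n; exact: HP.
by move: j jN; near: n.
Unshelve. all: by end_near. Qed.

(** The threshold for [n] may depend on the point of the circle, so the Cauchy integral is replaced
    by an average over finitely many points, the [N]-th roots of unity times [r]. Other indices
    below [N] average to zero; those from [N] on contribute at most a tail, which is below [e]. *)
Lemma cauchy_coef b (M r : R) k :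
  0 < r -> cvgn (series (fun k => `|b k| * r ^+ k)) ->
  (forall t, cmod t = r -> \forall n \near \oo, cmod (cpoly b n t) <= M) ->
  `|b k| * r ^+ k <= M.
Proof.
move=> r0 cv HM; apply/ler_addgt0Pr => e e0.
set u := fun k => `|b k| * r ^+ k.
have u0 m : 0 <= u m by rewrite mulr_ge0// exprn_ge0// ltW.
have : \forall N \near \oo, limn (series u) - e <= series u N.
  have /cvgrPdist_le/(_ _ e0) : series u @ \oo --> limn (series u) by [].
  apply: filterS => N; rewrite ler_norml => /andP[_]; lra.
move=> tailN.
near \oo => N.
have kN : (k < N)%N by near: N; exact: nbhs_infty_gt.
have N0 : (0 < N)%N by exact: leq_ltn_trans kN.
have tN : limn (series u) - e <= series u N by near: N.
have nd : nondecreasing_seq (series u).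
  by apply/nondecreasing_seqP => m; rewrite seriesSr lerDl.
pose th : R := 2 * pi / N%:R.
pose om : R[i] := cexp (complex.Complex 0 th).
have omX m : om ^+ m = cexp (complex.Complex 0 (m%:R * th)).
  rewrite /om cexpX; congr cexp; congr complex.Complex => /=; ring.
have om1 : cmod om = 1 by rewrite cmod_cexp/= expR0.
have omN : om ^+ N = 1.
  rewrite omX (_ : N%:R * th = pi *+ 2); last first.
    by rewrite /th mulr2n; field; rewrite pnatr_eq0 -lt0n.
  by congr complex.Complex; rewrite /= expR0 ?cos2pi ?sin2pi mul1r.
have omd m : (0 < m)%N -> (m < N)%N -> om ^+ m != 1.
  move=> m0 mN; rewrite omX; apply/eqP => -[]; rewrite expR0 mul1r => + _.
  have -> : m%:R * th = (m%:R * pi / N%:R) *+ 2.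
    by rewrite /th mulr2n; field; rewrite pnatr_eq0 -lt0n.
  rewrite cos_mulr2n cos2sin2.
  have : 0 < sin (m%:R * pi / N%:R : R).
    apply: sin_gt0_pi; apply/andP; split.
      by rewrite divr_gt0 ?mulr_gt0 ?pi_gt0 ?ltr0n.
    by rewrite ltr_pdivrMr ?ltr0n// mulrC ltr_pM2l ?pi_gt0// ltr_nat.
  move=> s0; have : 0 < sin (m%:R * pi / N%:R : R) ^+ 2 by rewrite exprn_gt0.
  by rewrite mulr2n; lra.
have geo m : om ^+ m != 1 -> \sum_(0 <= j < N) (om ^+ m) ^+ j = 0.
  move=> mne; have := subrX1 (om ^+ m) N.
  rewrite -exprM mulnC exprM omN expr1n subrr => /esym/eqP.
  by rewrite mulf_eq0 subr_eq0 (negbTE mne)/= big_mkord => /eqP.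
pose tt j := cR r * om ^+ j.
have ttr j : cmod (tt j) = r.
  by rewrite cmodM cmodX om1 expr1n mulr1 cmod_cR gtr0_norm.
near \oo => n.
have Nn : (N <= n)%N by near: n; exact: nbhs_infty_ge.
have Hn : forall j, (j < N)%N -> cmod (cpoly b n (tt j)) <= M.
  by near: n; apply: near_forall_ltn => j; exact: HM.
(* Since [om ^+ N = 1], the weight is [om^(- j k)] written with a natural exponent. *)
pose S := \sum_(0 <= j < N) cpoly b n (tt j) * om ^+ (j * (N - k)).
have SM : cmod S <= N%:R * M.
  rewrite (le_trans (cmod_sum _ _ _))//.
  rewrite (_ : N%:R * M = \sum_(0 <= j < N) M); last first.
    by rewrite sumr_const_nat subn0 mulr_natl.
  apply: ler_sum_nat => j /andP[_ jN].
  by rewrite cmodM cmodX om1 expr1n mulr1 Hn.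
pose rest := \sum_(N <= m < n) \sum_(0 <= j < N)
   cR (b m) * cR r ^+ m * (om ^+ (m + (N - k))) ^+ j.
have SE : S = cR N%:R * (cR (b k) * cR r ^+ k) + rest.
  rewrite /S /cpoly.
  under eq_bigr do rewrite mulr_suml.
  rewrite exchange_big/= (big_cat_nat (n := N))//=; congr (_ + _); last first.
    apply: eq_bigr => m _; apply: eq_bigr => j _.
    by rewrite exprMn -!exprM mulnDl exprD ![(j * _)%N]mulnC; ring.
  have term m : \sum_(0 <= j < N) cR (b m) * tt j ^+ m * om ^+ (j * (N - k)) =
     cR (b m) * cR r ^+ m * \sum_(0 <= j < N) (om ^+ (m + (N - k))) ^+ j.
    rewrite mulr_sumr; apply: eq_bigr => j _.
    by rewrite exprMn -!exprM mulnDl exprD ![(j * _)%N]mulnC; ring.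
  under eq_bigr do rewrite term.
  have zero (i : 'I_N) : i != Ordinal kN ->
      cR (b i) * cR r ^+ i * (\sum_(0 <= j < N) (om ^+ (i + (N - k))) ^+ j) = 0.
    case: i => m mN; rewrite -val_eqE/= => mk.
    rewrite geo ?mulr0//; have [mlk|klm] := ltnP m k.
      by apply: omd; move: mlk kN; lia.
    have -> : (m + (N - k) = N + (m - k))%N by move: klm kN; lia.
    rewrite exprD omN mul1r; apply: omd; move: klm mk mN; lia.
  rewrite big_mkord (bigD1 (Ordinal kN))//= [X in _ + X]big1 ?addr0; last by move=> i; exact: zero.
  have -> : (k + (N - k) = N)%N by rewrite subnKC// ltnW.
  rewrite omN; under eq_bigr do rewrite expr1n.
  rewrite sumr_const_nat subn0 mulrC; congr (_ * _).
  by elim: (N) => [//|m IHm]; rewrite -natr1 cRD -IHm mulrSr.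
have restM : cmod rest <= N%:R * (series u n - series u N).
  rewrite sub_series_geq// mulr_sumr (le_trans (cmod_sum _ _ _))//.
  apply: ler_sum => m _; rewrite (le_trans (cmod_sum _ _ _))//.
  rewrite (_ : N%:R * u m = \sum_(0 <= j < N) u m); last first.
    by rewrite sumr_const_nat subn0 mulr_natl.
  apply: ler_sum => j _.
  by rewrite !cmodM !cmodX om1 !expr1n mulr1 !cmod_cR (gtr0_norm r0).
have un : series u n <= limn (series u) by apply: nondecreasing_cvgn_le.
have NR : 0 < N%:R :> R by rewrite ltr0n.
rewrite -(ler_pM2l NR) mulrDr.
have -> : N%:R * (`|b k| * r ^+ k) = cmod (cR N%:R * (cR (b k) * cR r ^+ k)).
  by rewrite !cmodM cmodX !cmod_cR (gtr0_norm r0) normr_nat.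
rewrite (_ : _ * _ = S - rest); last by rewrite SE addrK.
rewrite (le_trans (cmodB _ _))// lerD// (le_trans restM)// ler_pM2l//.
by move: un tN; lra.
Unshelve. all: by end_near. Qed.

End CoefficientBound.

(** * The function [G], its reflection, and the growth of its coefficients *)

Section LaguerreCoefficients.
Context {R : realType}.
Implicit Types (x y : R) (t : R[i]) (d : nat -> R).

Definition exp_conv d k : R :=
  \sum_(0 <= j < k.+1) d j / j`!%:R * (k - j)`!%:R^-1.

(** The sequence that belongs to [G(-t)] when [d] belongs to [G(t)]; the form comes from the Hankel
    transform of Gaussian monomials. *)
Definition dual_coef d j : R :=
  (-1) ^+ j * \sum_(0 <= i < j.+1) ('C(j, i)%:R * 2 ^+ (j - i)) * d i.

(* With the umbral substitution [d i = D ^ i], the two sides are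
   [(1 - (2 + D)) ^ k] and [(-1) ^ k (1 + D) ^ k]. *)
Lemma exp_conv_dual d k : exp_conv (dual_coef d) k = (-1) ^+ k * exp_conv d k.
Proof.
pose l (p : {poly R}) := \sum_(i < k.+1) p`_i * d i.
have lD p q : l (p + q) = l p + l q.
  by rewrite /l -big_split/=; apply: eq_bigr => i _; rewrite coefD mulrDl.
have l0 : l 0 = 0 by rewrite /l big1// => i _; rewrite coef0 mul0r.
have lZ c p : l (c *: p) = c * l p.
  by rewrite /l mulr_sumr; apply: eq_bigr => i _; rewrite coefZ mulrA.
have lX i : (i <= k)%N -> l 'X^i = d i.
  move=> ik; have ik' : (i < k.+1)%N by [].
  rewrite /l (bigD1 (Ordinal ik'))//= coefXn eqxx mul1r big1 ?addr0// => j ji.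
  by rewrite coefXn; move: ji; rewrite -val_eqE/= => /negbTE ->; rewrite mul0r.
have lsum n (F : nat -> {poly R}) :
    l (\sum_(0 <= i < n) F i) = \sum_(0 <= i < n) l (F i).
  exact: (big_morph l lD l0).
have lbin c j : (j <= k)%N -> l ((c%:P + 'X) ^+ j) =
    \sum_(0 <= i < j.+1) ('C(j, i)%:R * c ^+ (j - i)) * d i.
  move=> jk; rewrite exprDn -(big_mkord xpredT
    (fun i => (c%:P ^+ (j - i) * 'X^i) *+ 'C(j, i))) lsum.
  apply: eq_big_nat => i /andP[_ ij].
  rewrite -polyC_exp mul_polyC scalerMnl lZ lX; last exact: leq_trans jk.
  by rewrite -mulr_natl.
have bfact j m : (j <= m)%N -> m`!%:R * (j`!%:R^-1 * (m - j)`!%:R^-1) = 'C(m, j)%:R :> R.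
  move=> jm; rewrite -(bin_fact jm) !natrM.
  by field; rewrite !pnatr_eq0 -!lt0n !fact_gt0.
have kf : k`!%:R != 0 :> R by rewrite pnatr_eq0 -lt0n fact_gt0.
apply: (mulfI kf).
have -> : k`!%:R * ((-1) ^+ k * exp_conv d k) = l ((- (1%:P + 'X)) ^+ k).
  rewrite [in RHS]exprNn (_ : (-1) ^+ k = ((-1) ^+ k)%:P :> {poly R}); last first.
    by rewrite polyC_exp polyCN polyC1.
  rewrite mul_polyC lZ lbin// mulrCA; congr (_ * _); rewrite /exp_conv mulr_sumr.
  apply: eq_big_nat => j /andP[_ jk]; rewrite expr1n mulr1 -bfact//.
  by ring.
have -> : - (1%:P + 'X) = 1%:P + (- (2%:P + 'X)) :> {poly R}.
  by rewrite (_ : 2%:P = 1%:P + 1%:P) ?polyCD//; ring.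
rewrite exprDn -(big_mkord xpredT
  (fun j => (1%:P ^+ (k - j) * (- (2%:P + 'X)) ^+ j) *+ 'C(k, j))) lsum.
rewrite /exp_conv mulr_sumr; apply: eq_big_nat => j /andP[_ jk].
have -> : (1%:P ^+ (k - j) * (- (2%:P + 'X)) ^+ j) *+ 'C(k, j) =
    ('C(k, j)%:R * (-1) ^+ j) *: (2%:P + 'X) ^+ j :> {poly R}.
  rewrite expr1n mul1r [in LHS]exprNn -mulr_natl -mul_polyC polyCM.
  by rewrite polyC_exp polyCN polyC1 !polyC_natr mulrA.
rewrite lZ lbin// -bfact// /dual_coef; ring.
Qed.

Definition exp_dominated d (C B al : R) := forall x n, 0 <= x ->
  \sum_(0 <= j < n) `|d j| * exp_coeff x j <= C * expR (x + B * x `^ al).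

(** Absolute values are taken in the series of [d] only. Keeping [e^t] apart gives
    [|e^t| = e^(Re t)], a true gain in the left half-plane. *)
Lemma cpoly_exp_conv_bound d (C B al : R) : 0 < C -> exp_dominated d C B al ->
  forall T e : R, 0 < e -> \forall n \near \oo, forall t, cmod t <= T ->
    cmod (cpoly (exp_conv d) n t) <=
      C * expR (cmod t + complex.Re t + B * cmod t `^ al) + e.
Proof.
move=> C0 dC T0 e e0; pose T : R := `|T0|.
suff : \forall n \near \oo, forall t, cmod t <= T ->
    cmod (cpoly (exp_conv d) n t) <=
      C * expR (cmod t + complex.Re t + B * cmod t `^ al) + e.
  by apply: filterS => n Hn t tT; apply: Hn; rewrite (le_trans tT)// ler_norm.
have T_ge0 : 0 <= T by exact: normr_ge0.
pose U j : R := `|d j| * exp_coeff T j.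
have U0 j : 0 <= U j by rewrite mulr_ge0// exp_coeff_ge0.
pose D := C * expR (T + B * T `^ al).
have cU : cvgn (series U).
  apply: nondecreasing_is_cvgn.
    by apply/nondecreasing_seqP => m; rewrite seriesSr lerDl.
  by exists D => _ [n _ <-]; exact: dC.
have D0 : 0 < D by rewrite mulr_gt0// expR_gt0.
have /cvgrPdist_le E1 := cvg_cauchy_error cU (is_cvg_series_exp_coeff T).
have /cvgrPdist_le E2 := @cvg_series_expR R T.
have e2 : 0 < e / 2 by rewrite divr_gt0.
(* The truncation error of [e^t] gets multiplied by the series in [d], which is at most [D] on the
   disc. *)
have eD : 0 < e / 2 / D by rewrite divr_gt0.
near=> n => t tT.
have n1 : series U n * series (exp_coeff T) n -
    series U n./2 * series (exp_coeff T) n./2 <= e / 2.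
  apply: le_trans (ler_norm _) _; rewrite -normrN -sub0r.
  by near: n; exact: E1.
have n2 : expR T - series (exp_coeff T) n <= e / 2 / D.
  by apply: le_trans (ler_norm _) _; near: n; exact: E2.
pose u j : R[i] := cR (d j / j`!%:R) * t ^+ j.
pose v j : R[i] := t ^+ j * cR (j`!%:R^-1).
have uM j : cmod (u j) = `|d j| * exp_coeff (cmod t) j.
  by rewrite cmodM cmodX cmod_cR normrM normfV normr_nat mulrAC -mulrA.
have uU j : cmod (u j) <= U j.
  by rewrite uM ler_wpM2l// exp_coeff_homo// cmod_ge0.
have vV j : cmod (v j) <= exp_coeff T j.
  by rewrite cmod_cexp_term exp_coeff_homo// cmod_ge0.
have := cauchy_product_error n uU vV.
have -> : \sum_(0 <= k < n) \sum_(0 <= i < k.+1) u i * v (k - i)%N =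
    cpoly (exp_conv d) n t.
  apply: eq_bigr => k _; rewrite cR_sum mulr_suml; apply: eq_big_nat => i /andP[_ ik].
  have tE : t ^+ k = t ^+ i * t ^+ (k - i) by rewrite -exprD subnKC.
  by rewrite cRM /u /v tE; ring.
rewrite -/(cexp_sum n t); set g := \sum_(0 <= i < n) u i => H.
have gM : cmod g <= C * expR (cmod t + B * cmod t `^ al).
  apply: le_trans (cmod_sum _ _ _) _.
  by under eq_bigr do rewrite uM; apply: dC; exact: cmod_ge0.
have gD : cmod g <= D.
  apply: le_trans (cmod_sum _ _ _) _.
  by apply: (@le_trans _ _ (series U n)); [exact: ler_sum | exact: dC].
have EM : cmod (cexp_sum n t) <= expR (complex.Re t) + e / 2 / D.
  rewrite (le_trans (cmod_leDB _ (cexp t)))// cmod_cexp lerD2l.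
  by rewrite (le_trans (cexp_sum_unif n tT)).
rewrite (le_trans (cmod_leDB _ (g * cexp_sum n t)))// cmod_distC.
rewrite (_ : e = e / 2 + e / 2); last by rewrite -splitr.
rewrite addrA lerD//; last exact: le_trans H n1.
rewrite cmodM; apply: le_trans (ler_wpM2l (cmod_ge0 g) EM) _; rewrite mulrDr; apply: lerD.
  by rewrite addrAC expRD mulrA; apply: ler_wpM2r gM; exact: expR_ge0.
apply: le_trans (ler_wpM2r (ltW eD) gD) _.
by rewrite mulrC divfK// (gt_eqF D0).
Unshelve. all: by end_near. Qed.

Lemma taylor_bound_exp_conv d (C B al : R) : 0 < C ->
  exp_dominated d C B al -> exp_dominated (dual_coef d) C B al ->
  taylor_bound (exp_conv d) C B al.
Proof.
move=> C0 H1 H2 T e e0.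
near=> n => t tT.
have [t0|t0] := leP (complex.Re t) 0.
  have -> : - `|complex.Re t| = complex.Re t by rewrite ler0_norm ?opprK.
  by move: t tT {t0}; near: n; exact: cpoly_exp_conv_bound.
(* In the right half-plane the gain comes from the dual sequence at [- t], whose real part is
   negative. *)
have -> : cpoly (exp_conv d) n t = cpoly (exp_conv (dual_coef d)) n (- t).
  apply: eq_bigr => k _; rewrite exp_conv_dual cRM (exprNn t) cRX.
  rewrite (_ : cR (-1) = -1); last by congr complex.Complex; rewrite oppr0.
  by rewrite mulrACA -exprD addnn -mul2n exprM sqrrN !expr1n mul1r.
have -> : - `|complex.Re t| = complex.Re (- t) by rewrite gtr0_norm//; case: (t).
rewrite -(cmodN t).
have : cmod (- t) <= T by rewrite cmodN.
move: (- t) => {t0 tT}t tT.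
by move: t tT; near: n; exact: cpoly_exp_conv_bound.
Unshelve. all: by end_near. Qed.

Theorem exp_conv_growth d (C B al r : R) k :
  0 < C -> 0 <= B -> 0 < al -> al < 1 -> 0 < r ->
  exp_dominated d C B al -> exp_dominated (dual_coef d) C B al ->
  `|exp_conv d k| * r ^+ k <=
    2 * C * expR 3 * expR (B / cos (al * (pi / 2)) * r `^ al).
Proof.
move=> C0 B0 al0 al1 r0 H1 H2; apply: cauchy_coef => //; last first.
  move=> t tr; rewrite -tr; apply: circle_bound => //; first by rewrite tr.
  exact: taylor_bound_exp_conv.
set u := fun k => _.
have u0 m : 0 <= u m by rewrite mulr_ge0// exprn_ge0// ltW.
apply: nondecreasing_is_cvgn.
  by apply/nondecreasing_seqP => m; rewrite seriesSr lerDl.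
(* The triangular double sum is bounded by the sum of the [U i] times [expR r]. *)
exists (C * expR (r + B * r `^ al) * expR r) => _ [n _ <-].
pose U j : R := `|d j| * exp_coeff r j.
have U0 j : 0 <= U j by rewrite mulr_ge0// exp_coeff_ge0// ltW.
apply: (@le_trans _ _ (\sum_(0 <= k < n) \sum_(0 <= i < k.+1) U i * exp_coeff r (k - i)%N)).
  apply: ler_sum => m _; rewrite /u /exp_conv.
  rewrite (le_trans (ler_wpM2r _ (ler_norm_sum _ _ _)))// ?exprn_ge0 ?(ltW r0)//.
  rewrite mulr_suml [leLHS]big_nat [leRHS]big_nat; apply: ler_sum => i /andP[_ im].
  have rE : r ^+ m = r ^+ i * r ^+ (m - i) by rewrite -exprD subnKC.
  rewrite !normrM !normfV !normr_nat /U /exp_coeff/= rE le_eqVlt; apply/orP; left.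
  by apply/eqP; ring.
rewrite sum_convE.
apply: (@le_trans _ _ (\sum_(0 <= i < n) U i * expR r)).
  apply: ler_sum => i _; rewrite ler_wpM2l//.
  exact: (le_series_expR _ (ltW r0)).
by rewrite -mulr_suml ler_wpM2r ?expR_ge0// H1// ltW.
Qed.

End LaguerreCoefficients.

(** * Power growth of the weight *)

Section WeightGrowth.
Context {R : realType}.
Local Notation mu := (@lebesgue_measure R).
Implicit Types (w : R -> R) (x y v r : R).

(** Replacing [t] by [Num.max t x] changes nothing on the domain and makes both factors monotone on
    the whole line. *)
Lemma measurable_weight_ratio w x : weight_function w -> 0 < x ->
  measurable_fun `[x, +oo[ (fun t : R => w t / t ^+ 3).
Proof.
move=> [_ [wnd _]] x0; apply: (eq_measurable_fun
    (fun t : R => w (Num.max t x) * (Num.max t x ^+ 3)^-1)).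
  by move=> t; rewrite inE /= in_itv /= andbT => xt; rewrite max_l.
have mx0 t : 0 < Num.max t x by rewrite lt_max x0 orbT.
apply: measurable_funM.
  apply: nondecreasing_measurable => // s t st; apply: wnd; first exact: ltW.
  by rewrite ge_max !le_max st lexx/= orbT.
apply: nonincreasing_measurable => // s t st.
rewrite lef_pV2 ?posrE ?exprn_gt0// lerXn2r ?nnegrE ?(ltW (mx0 _))//.
by rewrite ge_max !le_max st lexx/= orbT.
Qed.

(** Between [x] and [2 x] the integrand is at least [w x / (2 x)^3], over a length [x]. *)
Lemma weight_tail_dyadic w x : weight_function w -> 0 < x ->
  ((w x / (8 * x ^+ 2))%:E + \int[mu]_(t in `[(2 * x)%R, +oo[) (w t / t ^+ 3)%:E <=
   \int[mu]_(t in `[x, +oo[) (w t / t ^+ 3)%:E)%E.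
Proof.
move=> hw x0; have [w0 [wnd _]] := hw; 
have mw := measurable_weight_ratio hw x0.
have x2 : x <= 2 * x by lra.
have UE : `[x, +oo[%classic = `[x, 2 * x[ `|` `[2 * x, +oo[.
  apply/seteqP; split => t /=; rewrite !in_itv/= ?andbT.
    by move=> xt; have [h|h] := ltP t (2 * x); [left; rewrite xt|right].
  by move=> [/andP[]//|h]; rewrite (le_trans x2).
have pos t : `[x, +oo[%classic t -> (0 <= (w t / t ^+ 3)%:E)%E.
  rewrite /= in_itv/= andbT => xt; have t0 : 0 < t by exact: lt_le_trans xt.
  by rewrite lee_fin divr_ge0 ?exprn_ge0 ?w0// ltW.
have dis : [disjoint `[x, 2 * x[%classic & `[2 * x, +oo[%classic].
  rewrite disj_set2E; apply/eqP/seteqP; split => t //=; rewrite !in_itv/= andbT.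
  by move=> [/andP[_ h1] h2]; move: (lt_le_trans h1 h2); rewrite ltxx.
have mw' : measurable_fun (`[x, 2 * x[ `|` `[2 * x, +oo[) (EFin \o (fun t : R => w t / t ^+ 3)).
  by rewrite -UE; exact/measurable_EFinP.
have pos' t : (`[x, 2 * x[ `|` `[2 * x, +oo[) t -> (0 <= (w t / t ^+ 3)%:E)%E.
  by rewrite -UE; exact: pos.
have -> : (\int[mu]_(t in `[x, +oo[) (w t / t ^+ 3)%:E =
    \int[mu]_(t in `[x, (2 * x)%R[) (w t / t ^+ 3)%:E +
    \int[mu]_(t in `[(2 * x)%R, +oo[) (w t / t ^+ 3)%:E)%E.
  by rewrite UE; apply: ge0_integral_setU.
rewrite leeD2r//.
have -> : ((w x / (8 * x ^+ 2))%:E = \int[mu]_(t in `[x, (2 * x)%R[) (cst (w x / (2 * x) ^+ 3)%:E) t)%E.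
  rewrite integral_cst//= lebesgue_measure_itv/= lte_fin ltr_pMl// ltr1n/= -EFinB -EFinM.
  by congr EFin; field; rewrite gt_eqF.
apply: ge0_le_integral => //=.
- move=> t _; rewrite lee_fin divr_ge0 ?exprn_ge0 ?w0 ?mulr_ge0// ltW//.
- by apply/measurable_EFinP; apply: measurable_funS mw => //; rewrite UE; exact: subsetUl.
move=> t; rewrite in_itv/= => /andP[xt tx]; have t0 : 0 < t by exact: lt_le_trans xt.
rewrite lee_fin ler_pM ?invr_ge0 ?exprn_ge0 ?w0 ?wnd ?(ltW x0) ?mulr_ge0 ?(ltW x0)//.
rewrite lef_pV2 ?posrE ?exprn_gt0 ?mulr_gt0// lerXn2r ?nnegrE ?(ltW t0) ?(ltW tx)//.
by rewrite mulr_ge0// ltW.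
Qed.

Lemma powR_exprn (x a : R) n : 0 <= x -> (x `^ a) ^+ n = (x ^+ n) `^ a.
Proof.
move=> x0; elim: n => [|n IH]; first by rewrite !expr0 powR1.
by rewrite !exprS IH powRM// exprn_ge0.
Qed.

(** For the tail integral [A], the hypothesis [A x <= M w x / x^2] turns the dyadic estimate into
    [A (2 x) <= ka * A x] with [ka = 1 - 1 / (8 M)]. Iterating, then bounding [w] by the tail, gives
    [w (2^n x) <= 8 M (4 ka)^n w x]; the exponent with [4^al = 4 ka] is below [1]. *)
Lemma weight_power_growth w : weight_function w -> weight_growth w ->
  exists R0 D al : R, [/\ 0 < R0, 0 < D, 0 < al & al < 1] /\
    forall r v, R0 <= r -> 0 <= v ->
      w v <= D * w r * (1 + (v ^+ 2 / r ^+ 2) `^ al).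
Proof.
move=> hw [M0 [x0 HM0]]; have [w0 [wnd _]] := hw.
(* [M >= 1] forces [4 * ka > 1], hence [al > 0]. *)
pose M := Num.max M0 1; pose R0 := Num.max x0 1.
have M1 : 1 <= M by rewrite le_max lexx orbT.
have R01 : 1 <= R0 by rewrite le_max lexx orbT.
have R0_gt0 : 0 < R0 by rewrite (lt_le_trans ltr01).
have M_gt0 : 0 < M by rewrite (lt_le_trans ltr01).
pose A x := (\int[mu]_(t in `[x, +oo[) (w t / t ^+ 3)%:E)%E.
have Apos x : 0 < x -> (0 <= A x)%E.
  move=> xp; apply: integral_ge0 => t; rewrite /= in_itv/= andbT => xt.
  have t0 : 0 < t by exact: lt_le_trans xt.
  by rewrite lee_fin divr_ge0 ?exprn_ge0 ?w0// ltW.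
have AM x : R0 <= x -> (A x <= (M * (w x / x ^+ 2))%:E)%E.
  move=> Rx; have xp : 0 < x by exact: lt_le_trans Rx.
  apply: le_trans (HM0 x _) _.
    by rewrite (le_trans _ Rx)// le_max lexx.
  rewrite lee_fin ler_wpM2r//; last by rewrite le_max lexx.
  by rewrite divr_ge0 ?w0 ?sqr_ge0// ltW.
pose a x := fine (A x).
have Aa x : R0 <= x -> A x = (a x)%:E.
  move=> Rx; rewrite /a fineK// ge0_fin_numE ?Apos ?(lt_le_trans R0_gt0)//.
  by rewrite (le_lt_trans (AM x Rx))// ltry.
have aM x : R0 <= x -> a x <= M * (w x / x ^+ 2).
  by move=> Rx; rewrite -lee_fin -Aa// AM.
have Rx2 x : R0 <= x -> R0 <= 2 * x.
  by move=> Rx; rewrite (le_trans Rx)// ler_peMl ?ler1n// (le_trans _ Rx)// ltW.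
have a0 x : R0 <= x -> 0 <= a x.
  by move=> Rx; rewrite fine_ge0// Apos// (lt_le_trans R0_gt0).
have dy x : R0 <= x -> w x / (8 * x ^+ 2) + a (2 * x) <= a x.
  move=> Rx; rewrite -lee_fin EFinD -!Aa ?Rx2//.
  by apply: weight_tail_dyadic => //; exact: lt_le_trans Rx.
pose ka := 1 - (8 * M)^-1.
have ka0 : 2^-1 <= ka.
  rewrite /ka; have : (8 * M)^-1 <= 2^-1.
    by rewrite lef_pV2 ?posrE ?mulr_gt0//; lra.
  lra.
have ka1 : ka < 1 by rewrite /ka gtrBl invr_gt0 mulr_gt0.
have aka x : R0 <= x -> a (2 * x) <= ka * a x.
  move=> Rx; have := dy x Rx; have := aM x Rx.
  have xp : 0 < x by exact: lt_le_trans Rx.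
  have -> : w x / (8 * x ^+ 2) = 8^-1 * (w x / x ^+ 2) by field; rewrite gt_eqF.
  set W := w x / x ^+ 2 => h1 h2; rewrite /ka mulrBl mul1r.
  have h3 : (8 * M)^-1 * a x <= 8^-1 * W.
    rewrite ler_pdivrMl ?mulr_gt0//.
    have -> : 8 * M * (8^-1 * W) = M * W by field.
    exact: h1.
  move: h2 h3; lra.
have Rxn n x : R0 <= x -> R0 <= 2 ^+ n * x.
  by move=> Rx; elim: n => [|n IH]; rewrite ?expr0 ?mul1r// exprS -mulrA Rx2.
have an n x : R0 <= x -> a (2 ^+ n * x) <= ka ^+ n * a x.
  move=> Rx; elim: n => [|n IH]; first by rewrite !expr0 !mul1r.
  rewrite exprS -mulrA (le_trans (aka _ (Rxn n x Rx)))// exprS -mulrA ler_wpM2l//.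
  by rewrite (le_trans _ ka0)// invr_ge0.
have wn n x : R0 <= x -> w (2 ^+ n * x) <= 8 * M * (4 * ka) ^+ n * w x.
  move=> Rx; have Rn := Rxn n x Rx; have xp : 0 < x by exact: lt_le_trans Rx.
  have y0 : 0 < 2 ^+ n * x by rewrite mulr_gt0// exprn_gt0.
  have h1 : w (2 ^+ n * x) / (8 * (2 ^+ n * x) ^+ 2) <= a (2 ^+ n * x).
    by have := dy _ Rn; have := a0 _ (Rx2 _ Rn); lra.
  have h2 := le_trans h1 (an n x Rx).
  have h3 : w (2 ^+ n * x) / (8 * (2 ^+ n * x) ^+ 2) <= ka ^+ n * (M * (w x / x ^+ 2)).
    rewrite (le_trans h2)// ler_wpM2l ?aM// exprn_ge0// (le_trans _ ka0)// invr_ge0//.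
  move: h3; rewrite ler_pdivrMr; last by rewrite mulr_gt0// exprn_gt0.
  move=> /le_trans; apply; rewrite le_eqVlt; apply/orP; left; apply/eqP.
  rewrite exprMn [(4 * ka) ^+ n]exprMn.
  have -> : (4 : R) ^+ n = 2 ^+ n * 2 ^+ n.
    by rewrite -exprMn; congr (_ ^+ _); ring.
  by field; rewrite gt_eqF.
have g1 : 1 < 4 * ka by move: ka0; lra.
have l4 : 0 < ln 4 :> R by rewrite ln_gt0// ltr1n.
pose al := ln (4 * ka) / ln 4.
have al0 : 0 < al by rewrite divr_gt0// ln_gt0.
have al1 : al < 1.
  by rewrite ltr_pdivrMr// mul1r ltr_ln ?posrE; move: ka1 g1; lra.
have al4 : 4 `^ al = 4 * ka.
  rewrite /powR pnatr_eq0/= /al divfK ?gt_eqF// lnK// posrE; lra.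
(* [8 M] comes from the iteration, the remaining [4] from [4 * ka <= 4] in the one doubling that
   passes [v / r]. *)
exists R0, (32 * M), al; split; first by split=> //; rewrite mulr_gt0.
move=> r v Rr v0; have rp : 0 < r by exact: lt_le_trans Rr.
have wr0 : 0 <= w r by rewrite w0// ltW.
have [vr|rv] := leP v r.
  apply: (le_trans (wnd _ _ v0 vr)).
  have := powR_ge0 (v ^+ 2 / r ^+ 2) al; set P := _ `^ _ => P0.
  rewrite mulrAC ler_peMl// -[1]mulr1 ler_pM//; lra.
have ex : exists n, v / r < 2 ^+ n.
  exists (Num.bound (v / r)).
  rewrite (@lt_trans _ _ (Num.bound (v / r))%:R)//.
    by apply: archi_boundP; rewrite divr_ge0// ltW.
  by rewrite -natrX ltr_nat ltn_expl.
have [[|n] nlt nmin] := ex_minnP ex.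
  by move: nlt; rewrite expr0 ltr_pdivrMr// mul1r => /(lt_trans rv); rewrite ltxx.
have nle : 2 ^+ n <= v / r.
  by rewrite leNgt; apply/negP => /nmin; rewrite ltnn.
have vle : v <= 2 ^+ n.+1 * r by rewrite -ler_pdivrMr// ltW.
apply: (le_trans (wnd _ _ v0 vle)); apply: (le_trans (wn n.+1 r Rr)).
rewrite [leRHS]mulrAC ler_wpM2r// exprS.
have p1 : (4 * ka) ^+ n <= (v ^+ 2 / r ^+ 2) `^ al.
  have -> : (4 * ka) ^+ n = (4 ^+ n) `^ al.
    by rewrite -al4; exact: powR_exprn.
  apply: ge0_ler_powR; [exact: ltW|by rewrite nnegrE exprn_ge0| |].
    by rewrite nnegrE divr_ge0 ?sqr_ge0.
  rewrite -expr_div_n (_ : 4 = 2 ^+ 2 :> R); last by rewrite expr2; lra.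
  by rewrite exprAC lerXn2r ?nnegrE ?exprn_ge0 ?divr_ge0 ?(ltW rp).
set P := _ `^ _ in p1 *.
apply: (@le_trans _ _ (8 * M * (4 * P))).
  rewrite ler_wpM2l//; first by rewrite mulr_ge0// ltW.
  by rewrite ler_pM//; [move: g1; lra|rewrite exprn_ge0//; move: g1; lra|move: ka1; lra].
by rewrite mulrDr mulr1; move: M_gt0; lra.
Qed.

End WeightGrowth.

(** * Integrals of [x^b e^(-c x^m)] over the half-line *)

Section PowerExponentialIntegrals.
Context {R : realType}.
Local Notation mu := (@lebesgue_measure R).
Implicit Types (a b c s x r : R) (f g F : R -> R).

Lemma mRpos : measurable (Rpos : set R).
Proof. exact: measurable_itv. Qed.

(* [mu] lives on the Lebesgue-Stieltjes copy of the Borel structure, which is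
   convertible to, but not unifiable with, the default one of [mRpos]. *)
Lemma mRposL : measurable (Rpos : set (measurableTypeR R)).
Proof. exact: measurable_itv. Qed.

Lemma RposE x : (Rpos x) = (0 < x).
Proof. by rewrite /Rpos /= in_itv /= andbT. Qed.

(** Compact intervals in the open half-line, on which the fundamental theorem of calculus applies;
    the shift by two keeps the endpoints distinct from [n = 0] on. *)
Definition exhaust (n : nat) : set R := `[n.+2%:R^-1, n.+2%:R].

Lemma exhaust_lt n : (n.+2%:R^-1 : R) < n.+2%:R.
Proof.
rewrite (@lt_trans _ _ 1)// ?ltr1n//.
by rewrite invf_lt1 ?ltr0n// ltr1n.
Qed.

Lemma exhaust_pos n x : exhaust n x -> 0 < x.
Proof. by rewrite /exhaust/= in_itv/= => /andP[/(lt_le_trans _)->]. Qed.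

Lemma bigcup_exhaust : \bigcup_n exhaust n = Rpos.
Proof.
apply/seteqP; split => x; first by move=> [n _ /exhaust_pos]; rewrite RposE.
rewrite RposE => x0; pose n := Num.bound (Num.max x x^-1).
have bn : Num.max x x^-1 < n%:R by apply: archi_boundP; rewrite le_max (ltW x0).
have nn : (n%:R : R) <= n.+2%:R by rewrite ler_nat -addn2 leq_addr.
move: bn; rewrite gt_max => /andP[xn xVn]; exists n => //.
rewrite /exhaust/= in_itv/=; apply/andP; split; last by rewrite (le_trans (ltW xn)).
by rewrite -(invrK x) lef_pV2 ?posrE ?invr_gt0 ?ltr0n// (le_trans (ltW xVn)).
Qed.

Lemma nondecreasing_exhaust : nondecreasing_seq exhaust.
Proof.
apply/nondecreasing_seqP => n; rewrite subsetEset => x.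
rewrite /exhaust/= !in_itv/= => /andP[h1 h2]; apply/andP; split.
  by rewrite (le_trans _ h1)// lef_pV2 ?posrE ?ltr0n// ler_nat.
by rewrite (le_trans h2)// ler_nat.
Qed.

Lemma cvg_integral_exhaust f : measurable_fun Rpos f -> (forall x, 0 < x -> 0 <= f x) ->
  (\int[mu]_(x in exhaust n) (f x)%:E @[n --> \oo] -->
   \int[mu]_(x in Rpos) (f x)%:E)%E.
Proof.
move=> mf f0; rewrite -bigcup_exhaust.
apply: ge0_nondecreasing_set_cvg_integral => //.
- exact: nondecreasing_exhaust.
- by move=> n; exact: measurable_itv.
- move=> n; apply/measurable_EFinP; apply: measurable_funS mf => //; first exact: mRpos.
  by move=> x /exhaust_pos; rewrite RposE.
- by move=> n x /exhaust_pos x0; rewrite lee_fin f0.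
Qed.

Lemma integral_exhaust f F n : (forall x, 0 < x -> is_derive x 1 F (f x)) ->
  (forall x, 0 < x -> {for x, continuous f}) ->
  (\int[mu]_(x in exhaust n) (f x)%:E = (F n.+2%:R - F n.+2%:R^-1)%:E)%E.
Proof.
move=> dF cf; rewrite EFinB; apply: continuous_FTC2 => //.
- exact: exhaust_lt.
- apply: continuous_in_subspaceT => x; rewrite inE => /exhaust_pos; exact: cf.
- have cF x : 0 < x -> {for x, continuous F}.
    by move=> x0; apply/differentiable_continuous/derivable1_diffP; have [] := dF x x0.
  split.
  + move=> x; rewrite in_itv/= => /andP[h1 _].
    have x0 : 0 < x by rewrite (lt_trans _ h1).
    by case: (dF x x0).
  + by apply: cvg_at_right_filter; apply: cF; rewrite invr_gt0.
  + by apply: cvg_at_left_filter; apply: cF.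
- move=> x; rewrite in_itv/= => /andP[h1 _]; rewrite derive1E.
  have x0 : 0 < x by rewrite (lt_trans _ h1).
  by case: (dF x x0).
Qed.

Lemma is_derive_funM f g x a b : is_derive x 1 f a -> is_derive x 1 g b ->
  is_derive x 1 (fun t => f t * g t) (a * g x + f x * b).
Proof.
move=> df dg; apply: (is_derive_eq (is_deriveM df dg)).
by rewrite addrC /GRing.scale/= [g x * _]mulrC.
Qed.

Lemma is_derive_funZ f x a c : is_derive x 1 f a ->
  is_derive x 1 (fun t => c * f t) (c * a).
Proof. by move=> df; exact: (is_derive_eq (is_deriveZ c df)). Qed.

Lemma is_derive_funN f x a : is_derive x 1 f a ->
  is_derive x 1 (fun t => - f t) (- a).
Proof. by move=> df; exact: (is_derive_eq (is_deriveN df)). Qed.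

Lemma is_derive_monomial m x : is_derive x 1 (fun t : R => t ^+ m) (m%:R * x ^+ m.-1).
Proof.
split; first exact: exprn_derivable.
by rewrite exp_derive /GRing.scale/= mulr1.
Qed.

Lemma is_derive_funexp f x a : is_derive x 1 f a ->
  is_derive x 1 (fun t => expR (f t)) (expR (f x) * a).
Proof. by move=> df; exact: (is_derive1_comp (f := expR) (g := f)). Qed.

Definition powexp b c m x := x `^ b * expR (- (c * x ^+ m)).

Lemma powexp_ge0 b c m x : 0 <= powexp b c m x.
Proof. by rewrite mulr_ge0 ?powR_ge0 ?expR_ge0. Qed.

Lemma measurable_powexp b c m (D : set R) : measurable_fun D (powexp b c m).
Proof.
apply: (@measurable_funS _ _ _ _ setT) => //.
apply: measurable_funM; first exact: measurable_powR.
apply: measurableT_comp; first exact: measurable_expR.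
apply: measurableT_comp; first exact: oppr_measurable.
by apply: measurable_funM => //; exact: exprn_measurable.
Qed.

Lemma powR_continuous b x : 0 < x -> {for x, continuous (fun y : R => y `^ b)}.
Proof.
move=> x0; apply/differentiable_continuous/derivable1_diffP.
by apply: derivable_powR; rewrite in_itv/= x0.
Qed.

Lemma powexp_continuous b c m x : 0 < x -> {for x, continuous (powexp b c m)}.
Proof.
move=> x0; apply: cvgM; first exact: powR_continuous.
apply: (@continuous_comp _ _ _ (fun x => - (c * x ^+ m)) expR); last exact: continuous_expR.
apply: cvgN; apply: cvgM; first exact: cvg_cst.
exact: exprn_continuous.
Qed.

Lemma is_derive_powexp a c m x : 0 < x -> (0 < m)%N ->
  is_derive x 1 (powexp a c m) (a * powexp (a - 1) c m x -
    c * m%:R * powexp (a + m%:R - 1) c m x).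
Proof.
move=> x0 m0.
have d1 := is_derive1_powR a x0.
have d2 := is_derive_funexp (is_derive_funN (is_derive_funZ c (is_derive_monomial m x))).
apply: (is_derive_eq (is_derive_funM d1 d2)); rewrite /powexp.
have -> : x `^ (a + m%:R - 1) = x `^ a * x ^+ m.-1.
  rewrite -powR_mulrn ?(ltW x0)// -powRD ?(gt_eqF x0) ?implybT//.
  by congr (_ `^ _); rewrite -{1}(prednK m0) -natr1; ring.
by ring.
Qed.

Lemma powR_expR_bound b c : 0 < c -> exists K, 0 < K /\
  forall x, 1 <= x -> x `^ b * expR (- (c * x)) <= K.
Proof.
move=> c0; pose N := Num.bound `|b|.
exists (N`!%:R / c ^+ N); split.
  by rewrite divr_gt0 ?ltr0n ?fact_gt0// exprn_gt0.
move=> x x1; have x0 : 0 < x by exact: lt_le_trans x1.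
apply: (@le_trans _ _ (x ^+ N * expR (- (c * x)))).
  rewrite ler_wpM2r ?expR_ge0// -powR_mulrn ?(ltW x0)// ler_powR//.
  by rewrite (le_trans (ler_norm _))// ltW// archi_boundP.
have cx0 : 0 <= c * x by rewrite mulr_ge0 ?ltW.
have key : (c * x) ^+ N / N`!%:R <= expR (c * x).
  case: (N) => [|k]; first by rewrite expr0 mulr1n divr1 -expR0 ler_expR.
  by have := @expR_ge1Dxn R (c * x) k cx0; lra.
have f0 : N`!%:R != 0 :> R by rewrite pnatr_eq0 -lt0n fact_gt0.
have -> : x ^+ N * expR (- (c * x)) =
    (c * x) ^+ N / N`!%:R / expR (c * x) * (N`!%:R / c ^+ N).
  have cN : c ^+ N != 0 by rewrite gt_eqF// exprn_gt0.
  have eN : expR (c * x) != 0 by rewrite gt_eqF// expR_gt0.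
  rewrite expRN exprMn; move: f0 cN eN; move: (N`!%:R : R) (c ^+ N) (expR _) => u v z *.
  by field; do ?(apply/andP; split).
rewrite ler_piMl//; first by rewrite divr_ge0// exprn_ge0// ltW.
by rewrite ler_pdivrMr ?expR_gt0// mul1r.
Qed.

(** The explicit primitive [- e^(-c x^s) / (c s)] is bounded, which makes this integrand a
    convenient dominating function. *)
Lemma integral_weibull s c : 0 < s -> 0 < c ->
  (\int[mu]_(x in Rpos) (x `^ (s - 1) * expR (- (c * x `^ s)))%:E < +oo)%E.
Proof.
move=> s0 c0.
pose f x := x `^ (s - 1) * expR (- (c * x `^ s)).
pose F x := - (c * s)^-1 * expR (- (c * x `^ s)).
have cs : 0 < c * s by rewrite mulr_gt0.
have dF x : 0 < x -> is_derive x 1 F (f x).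
  move=> x0; have d1 := is_derive1_powR s x0.
  have d2 := is_derive_funexp (is_derive_funN (is_derive_funZ c d1)).
  apply: (is_derive_eq (is_derive_funZ _ d2)); rewrite /f.
  by field; rewrite !gt_eqF.
have cf x : 0 < x -> {for x, continuous f}.
  move=> x0; apply: cvgM; first exact: powR_continuous.
  apply: (@continuous_comp _ _ _ (fun x => - (c * x `^ s)) expR); last exact: continuous_expR.
  by apply: cvgN; apply: cvgM; [exact: cvg_cst | exact: powR_continuous].
have mf : measurable_fun Rpos f.
  apply: (@measurable_funS _ _ _ _ setT) => //.
  apply: measurable_funM; first exact: measurable_powR.
  apply: measurableT_comp; first exact: measurable_expR.
  apply: measurableT_comp; first exact: oppr_measurable.
  by apply: measurable_funM => //; exact: measurable_powR.
have f0 x : 0 < x -> 0 <= f x by move=> _; rewrite mulr_ge0 ?powR_ge0 ?expR_ge0.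
rewrite (@le_lt_trans _ _ ((c * s)^-1)%:E) ?ltry//.
have cv := cvg_integral_exhaust mf f0.
rewrite -(cvg_lim _ cv)//; apply: lime_le; first by apply/cvg_ex; eexists; exact: cv.
near=> n; rewrite (integral_exhaust n dF cf) lee_fin /F.
rewrite !mulNr opprK.
set u := expR _; set v := expR _.
have u0 : 0 <= u by exact: expR_ge0.
have v1 : v <= 1 by rewrite expR_le1 oppr_le0 mulr_ge0 ?powR_ge0// ltW.
have i0 : 0 <= (c * s)^-1 by rewrite invr_ge0 ltW.
have : (c * s)^-1 * v <= (c * s)^-1 by rewrite ler_piMr.
have : 0 <= (c * s)^-1 * u by rewrite mulr_ge0.
lra.
Unshelve. all: by end_near. Qed.

(** Comparison with the previous integrand for [s = min (b + 1, 1)]: near [0] the power [x^(s - 1)]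
    is at least as large as [x^b], and at infinity [s <= 1] makes its decay slower. *)
Lemma integrable_powexp b c m : -1 < b -> 0 < c -> (0 < m)%N ->
  mu.-integrable Rpos (EFin \o powexp b c m).
Proof.
move=> b1 c0 m0; apply/integrableP; split.
  by apply/measurable_EFinP; exact: measurable_powexp.
under eq_integral do rewrite /= ger0_norm ?powexp_ge0//.
(* Reduces the exponent [m] to [1] at the cost of a factor [expR c]. *)
have xm x : 0 < x -> x - 1 <= x ^+ m.
  move=> x0; have [x1|x1] := leP 1 x.
    have : x <= x ^+ m by apply: ler_eXnr.
    by lra.
  by have := exprn_ge0 m (ltW x0); lra.
pose s := Num.min (b + 1) 1.
have s0 : 0 < s by rewrite lt_min; apply/andP; split; lra.
have s1 : s <= 1 by rewrite ge_min lexx orbT.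
have sb : s <= b + 1 by rewrite ge_min lexx.
have c2 : 0 < c / 2 by rewrite divr_gt0.
have [K [K0 HK]] := @powR_expR_bound (b + 1 - s) (c / 2) c2.
pose K' := (K + 1) * expR c * expR c.
have K'0 : 0 <= K' by rewrite !mulr_ge0 ?expR_ge0// addr_ge0// ltW.
have ec : 1 <= expR c by rewrite -expR0 ler_expR ltW.
have dom x : 0 < x ->
    powexp b c m x <= K' * (x `^ (s - 1) * expR (- (c / 2 * x `^ s))).
  move=> x0; rewrite /powexp.
  have -> : x `^ b = x `^ (s - 1) * x `^ (b + 1 - s).
    by rewrite -powRD ?(gt_eqF x0) ?implybT//; congr (_ `^ _); ring.
  rewrite mulrCA -mulrA ler_wpM2l ?powR_ge0//.
  have e1 : expR (- (c * x ^+ m)) <= expR c * expR (- (c * x)).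
    rewrite -expRD ler_expR; have := ler_wpM2l (ltW c0) (xm x x0); rewrite mulrBr; lra.
  apply: (@le_trans _ _ (x `^ (b + 1 - s) * (expR c * expR (- (c * x))))).
    by rewrite ler_wpM2l ?powR_ge0.
  have [x1|x1] := leP 1 x.
    have h1 := HK x x1.
    have h2 : expR (- (c / 2 * x)) <= expR (- (c / 2 * x `^ s)).
      rewrite ler_expR lerN2 ler_wpM2l ?(ltW c2)//.
      by apply: ler1_powR.
    have -> : expR (- (c * x)) = expR (- (c / 2 * x)) * expR (- (c / 2 * x)).
      by rewrite -expRD; congr expR; field.
    rewrite (_ : x `^ _ * _ = expR c * ((x `^ (b + 1 - s) * expR (- (c / 2 * x))) *
      expR (- (c / 2 * x)))); last by ring.
    have -> : K' * expR (- (c / 2 * x `^ s)) =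
        expR c * (((K + 1) * expR c) * expR (- (c / 2 * x `^ s))) by rewrite /K'; ring.
    rewrite ler_wpM2l ?expR_ge0// ler_pM ?expR_ge0//.
      by rewrite mulr_ge0 ?powR_ge0 ?expR_ge0.
    rewrite (le_trans h1)// (@le_trans _ _ (K + 1)) ?lerDl// ler_peMr//.
    by rewrite addr_ge0// ltW.
  have h1 : x `^ (b + 1 - s) <= 1.
    rewrite -[leRHS](powRr0 x).
    by apply: ger_powR; [rewrite x0 ltW | rewrite subr_ge0].
  have xs : x `^ s <= 1.
    rewrite -[leRHS](powRr0 x).
    by apply: ger_powR; [rewrite x0 ltW | exact: ltW].
  have h2 : expR (- (c * x)) <= expR c * expR (- (c / 2 * x `^ s)).
    rewrite -expRD ler_expR.
    have h3 := ler_wpM2l (ltW c2) xs; have := mulr_gt0 c0 x0.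
    by move: h3 c0; rewrite mulr1; lra.
  have -> : K' * expR (- (c / 2 * x `^ s)) =
     (K + 1) * (expR c * (expR c * expR (- (c / 2 * x `^ s)))) by rewrite /K'; ring.
  rewrite ler_pM ?powR_ge0 ?mulr_ge0 ?expR_ge0//; last by rewrite ler_wpM2l ?expR_ge0.
  by rewrite (le_trans h1)// lerDr ltW.
have mW : measurable_fun Rpos (fun x : R => x `^ (s - 1) * expR (- (c / 2 * x `^ s))).
  apply: (@measurable_funS _ _ _ _ setT) => //.
  apply: measurable_funM; first exact: measurable_powR.
  apply: measurableT_comp; first exact: measurable_expR.
  apply: measurableT_comp; first exact: oppr_measurable.
  by apply: measurable_funM => //; exact: measurable_powR.
apply: (@le_lt_trans _ _ (\int[mu]_(x in Rpos)
    (K'%:E * (x `^ (s - 1) * expR (- (c / 2 * x `^ s)))%:E))%E).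
  apply: ge0_le_integral.
  - exact: mRpos.
  - by move=> x _; rewrite lee_fin powexp_ge0.
  - by apply/measurable_EFinP; exact: measurable_powexp.
  - by apply: measurable_funeM; exact/measurable_EFinP.
  - by move=> x; rewrite RposE => x0; rewrite -EFinM lee_fin dom.
have -> : (\int[mu]_(x in Rpos) (K'%:E * (x `^ (s - 1) * expR (- (c / 2 * x `^ s)))%:E) =
   K'%:E * \int[mu]_(x in Rpos) (x `^ (s - 1) * expR (- (c / 2 * x `^ s)))%:E)%E.
  apply: ge0_integralZl => //; [exact: mRpos|exact/measurable_EFinP|].
  by move=> x _; rewrite lee_fin mulr_ge0 ?powR_ge0 ?expR_ge0.
by rewrite lte_mul_pinfty// ?lee_fin//; exact: integral_weibull.
Qed.

(** Integration by parts with boundary terms that vanish at both ends. For [c = m = 1] it is the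
    functional equation of [Gamma], for [m = 2] the recursion of Gaussian moments. *)
Lemma powexp_recursion a c m : 0 < a -> 0 < c -> (0 < m)%N ->
  a * \int[mu]_(x in Rpos) powexp (a - 1) c m x =
  c * m%:R * \int[mu]_(x in Rpos) powexp (a + m%:R - 1) c m x.
Proof.
move=> a0 c0 m0.
have m1 : 1 <= m%:R :> R by rewrite ler1n.
have i1 : mu.-integrable Rpos (EFin \o powexp (a - 1) c m).
  by apply: integrable_powexp => //; lra.
have i2 : mu.-integrable Rpos (EFin \o powexp (a + m%:R - 1) c m).
  by apply: integrable_powexp => //; lra.
set f1 := powexp (a - 1) c m in i1 *; set f2 := powexp (a + m%:R - 1) c m in i2 *.
have cv f : mu.-integrable Rpos (EFin \o f) -> (forall x, 0 <= f x) ->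
    \int[mu]_(x in exhaust n) f x @[n --> \oo] --> \int[mu]_(x in Rpos) f x.
  move=> ifp f0; apply: fine_cvg; rewrite /Rintegral fineK; last exact: (integrable_fin_num mRposL ifp).
  apply: cvg_integral_exhaust => //.
  by have /integrableP[/measurable_EFinP] := ifp.
have c1 := cv _ i1 (powexp_ge0 _ _ _); have c2 := cv _ i2 (powexp_ge0 _ _ _).
have c3 : a * \int[mu]_(x in exhaust n) f1 x - c * m%:R * \int[mu]_(x in exhaust n) f2 x
    @[n --> \oo] --> a * \int[mu]_(x in Rpos) f1 x - c * m%:R * \int[mu]_(x in Rpos) f2 x.
  by apply: cvgB; [apply: cvgMl_tmp; exact: c1 | apply: cvgMl_tmp; exact: c2].
apply/eqP; rewrite -subr_eq0; apply/eqP.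
rewrite -(cvg_lim _ c3)//; apply: cvg_lim => //.
have sub n : exhaust n `<=` Rpos by move=> x /exhaust_pos; rewrite RposE.
have mE n : measurable (exhaust n : set (measurableTypeR R)) by exact: measurable_itv.
rewrite (_ : (fun n => _) = fun n : nat => powexp a c m n.+2%:R - powexp a c m n.+2%:R^-1);
  last first.
  apply/funext => n /=.
  have j1 := integrableS mRposL (mE n) (@sub n) i1.
  have j2 := integrableS mRposL (mE n) (@sub n) i2.
  rewrite -!RintegralZl// -RintegralB//; last 2 first.
  - exact: (integrableZl (mE n) a j1).
  - exact: (integrableZl (mE n) (c * m%:R) j2).
  have dF x : 0 < x -> is_derive x 1 (powexp a c m) (a * f1 x - c * m%:R * f2 x).
    by move=> x0; exact: is_derive_powexp.
  have cF x : 0 < x -> {for x, continuous (fun x => a * f1 x - c * m%:R * f2 x)}.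
    by move=> x0; apply: cvgB; (apply: cvgM; [exact: cvg_cst|exact: powexp_continuous]).
  by rewrite /Rintegral (integral_exhaust n dF cF).
rewrite -[X in _ --> X](subr0 0); apply: cvgB.
  have [K [K0 HK]] := @powR_expR_bound (a + 1) c c0.
  apply: (@squeeze_cvgr _ _ _ _ (cst 0) (fun n : nat => K * n.+2%:R^-1)).
  - near=> n; rewrite powexp_ge0/=; set x : R := n.+2%:R.
    have x1 : 1 <= x by rewrite ler1n.
    have x0 : 0 < x by exact: lt_le_trans x1.
    rewrite ler_pdivlMr// (le_trans _ (HK x x1))//.
    rewrite /powexp mulrAC -{2}(powRr1 (ltW x0)) -powRD ?(gt_eqF x0) ?implybT//.
    rewrite ler_wpM2l ?powR_ge0// ler_expR lerN2 ler_wpM2l ?(ltW c0)//.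
    exact: ler_eXnr.
  - exact: cvg_cst.
  - rewrite -[X in _ --> X](mulr0 K); apply: cvgMl_tmp.
    have := @cvg_harmonic R; rewrite -cvg_shiftS; exact.
apply: (@squeeze_cvgr _ _ _ _ (cst 0) (fun n : nat => (n.+2%:R^-1 : R) `^ a)).
- near=> n; rewrite powexp_ge0/= /powexp ler_piMr ?powR_ge0// expR_le1 oppr_le0.
  by rewrite mulr_ge0 ?(ltW c0)// exprn_ge0.
- exact: cvg_cst.
- have /cvg_at_rightP := powR_cvg0 a0; apply; split.
    by move=> n; rewrite invr_gt0.
  have := @cvg_harmonic R; rewrite -cvg_shiftS; exact.
Unshelve. all: by end_near. Qed.

End PowerExponentialIntegrals.

(** * [Gamma] at shifted integers and Gaussian moments *)

Section GammaBessel.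
Context {R : realType} (nu : R) (hnu : - (1 / 2) < nu).
Local Notation mu := (@lebesgue_measure R).
Local Notation G := (fun j : nat => Gamma (j%:R + nu + 1)).

Lemma GammaE (x : R) : Gamma x = \int[mu]_(t in Rpos) powexp (x - 1) 1 1 t.
Proof. by apply: eq_Rintegral => t _; rewrite /powexp expr1 mul1r. Qed.

Lemma GammaS (x : R) : 0 < x -> Gamma (x + 1) = x * Gamma x.
Proof.
move=> x0; have := @powexp_recursion R x 1 1 x0 ltr01 isT.
by rewrite !GammaE !mul1r => ->.
Qed.

Lemma integral_powexp_gt0 (b c : R) m : -1 < b -> 0 < c -> (0 < m)%N ->
  0 < \int[mu]_(t in Rpos) powexp b c m t.
Proof.
move=> b1 c0 m0.
have ig : mu.-integrable Rpos (EFin \o powexp b c m) by exact: integrable_powexp.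
pose k : R := 2 `^ (- `|b|) * expR (- (c * 2 ^+ m)).
have k0 : 0 < k by rewrite mulr_gt0 ?powR_gt0 ?expR_gt0.
rewrite (lt_le_trans k0)// -lee_fin /Rintegral fineK; last first.
  exact: (integrable_fin_num mRposL ig).
apply: (@le_trans _ _ (\int[mu]_(t in `[1%R, 2%R]) (powexp b c m t)%:E)%E); last first.
  apply: ge0_subset_integral => //=.
  - exact: mRposL.
  - by apply/measurable_EFinP; exact: measurable_powexp.
  - by move=> t _; rewrite lee_fin powexp_ge0.
  - by move=> t /=; rewrite RposE in_itv/= => /andP[h _]; lra.
have -> : k%:E = (\int[mu]_(t in `[1%R, 2%R]) (cst k%:E) t)%E.
  rewrite integral_cst//= lebesgue_measure_itv/= lte_fin ltr1n/= -EFinB -EFinM.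
  by congr EFin; ring.
apply: ge0_le_integral => //=.
- by move=> t _; rewrite lee_fin ltW.
- by apply/measurable_EFinP; exact: measurable_powexp.
move=> t; rewrite in_itv/= => /andP[t1 t2]; have t0 : 0 < t by lra.
rewrite lee_fin /powexp ler_pM ?powR_ge0 ?expR_ge0//; last first.
  by rewrite ler_expR lerN2 ler_pM2l// lerXn2r// nnegrE// ltW.
apply: (@le_trans _ _ (t `^ (- `|b|))).
  rewrite !powRN lef_pV2 ?posrE ?powR_gt0// ge0_ler_powR ?nnegrE//.
  by rewrite ltW.
by rewrite ler_powR// lerNl -normrN ler_norm.
Qed.

Lemma Gamma_gt0 (x : R) : 0 < x -> 0 < Gamma x.
Proof. by move=> x0; rewrite GammaE integral_powexp_gt0//; lra. Qed.

Lemma Gnu_pos j : 0 < j%:R + nu + 1.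
Proof. by have := ler0n R j; move: hnu; lra. Qed.

Lemma Gnu_gt0 j : 0 < G j.
Proof. exact/Gamma_gt0/Gnu_pos. Qed.

Lemma GnuS j : G j.+1 = (j%:R + nu + 1) * G j.
Proof.
have -> : j.+1%:R + nu + 1 = (j%:R + nu + 1) + 1 by rewrite -natr1; ring.
exact/GammaS/Gnu_pos.
Qed.

Lemma Gnu_prod j k : (j <= k)%N ->
  \prod_(j.+1 <= i < k.+1) (nu + i%:R) = G k / G j.
Proof.
elim: k => [|k IH].
  by rewrite leqn0 => /eqP ->; rewrite big_geq// divff// gt_eqF// Gnu_gt0.
rewrite leq_eqVlt => /predU1P[->|jk].
  by rewrite big_geq// divff// gt_eqF// Gnu_gt0.
rewrite big_nat_recr//= IH// GnuS -natr1; ring.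
Qed.

(** Each step multiplies by [j + nu + 1 >= (j + 1) / 2], because [nu > - 1 / 2]. *)
Lemma Gnu_lower j : G 0%N * j`!%:R / 2 ^+ j <= G j.
Proof.
elim: j => [|j IH]; first by rewrite fact0 expr0 divr1 mulr1.
rewrite GnuS factS natrM exprS invfM.
rewrite (_ : _ * _ = (j.+1%:R / 2) * (G 0%N * j`!%:R / 2 ^+ j)); last by ring.
rewrite ler_pM//.
- apply: divr_ge0; last exact: exprn_ge0.
  by apply: mulr_ge0 => //; exact/ltW/Gnu_gt0.
- by rewrite -natr1; have := ler0n R j; move: hnu; lra.
Qed.

Lemma Gnu_inv_upper j : (G j)^-1 <= (G 0%N)^-1 * 2 ^+ j / j`!%:R.
Proof.
have g0 := Gnu_gt0 0; have f0 : 0 < j`!%:R :> R by rewrite ltr0n fact_gt0.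
have -> : (G 0%N)^-1 * 2 ^+ j / j`!%:R = (G 0%N * j`!%:R / 2 ^+ j)^-1.
  by rewrite !invfM invrK; ring.
by rewrite lef_pV2 ?posrE ?Gnu_gt0 ?Gnu_lower// divr_gt0 ?exprn_gt0// mulr_gt0.
Qed.

(** The total exponent of [r^(2 j)] against the density [r^(2 nu + 1)]. *)
Definition mexp (j : nat) : R := 2 * j%:R + 2 * nu + 1.

Lemma mexp_gtN1 j : -1 < mexp j.
Proof. by rewrite /mexp; have := ler0n R j; move: hnu; lra. Qed.

Lemma powR_mexp j (r : R) : 0 < r -> r ^+ (2 * j) * r `^ (2 * nu + 1) = r `^ mexp j.
Proof.
move=> r0; rewrite -powR_mulrn ?ltW// -powRD ?(gt_eqF r0) ?implybT//.
by congr (_ `^ _); rewrite /mexp natrM; ring.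
Qed.

(** Normalised so that the moment of index [j] is this constant times [Gamma (j + nu + 1) / c^j].
    For [c > 0] its closed form is [1 / (2 c^(nu + 1))]. *)
Definition gauss_mom (c : R) : R := (\int[mu]_(r in Rpos) powexp (mexp 0) c 2 r) / G 0%N.

Lemma gauss_mom_gt0 c : 0 < c -> 0 < gauss_mom c.
Proof.
move=> c0; apply: divr_gt0; last exact: Gnu_gt0.
by apply: integral_powexp_gt0 => //; exact: mexp_gtN1.
Qed.

Lemma gauss_momE c j : 0 < c ->
  \int[mu]_(r in Rpos) powexp (mexp j) c 2 r = gauss_mom c * G j / c ^+ j.
Proof.
move=> c0; elim: j => [|j IH].
  by rewrite /gauss_mom expr0 divr1 divfK// gt_eqF// Gnu_gt0.
have a0 := Gnu_pos j.
have a20 : 0 < 2 * (j%:R + nu + 1) :> R by rewrite mulr_gt0.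
have := @powexp_recursion R _ c 2 a20 c0 isT.
rewrite (_ : _ - 1 = mexp j); last by rewrite /mexp; ring.
rewrite (_ : _ + 2%:R - 1 = mexp j.+1); last by rewrite /mexp -natr1; ring.
rewrite IH GnuS => E.
have c20 : c * 2%:R != 0 by rewrite mulf_neq0// gt_eqF.
apply: (mulfI c20); rewrite -E exprS.
by field; rewrite expf_neq0 gt_eqF.
Qed.

Lemma integrable_gauss c j : 0 < c ->
  mu.-integrable Rpos (EFin \o powexp (mexp j) c 2).
Proof. by move=> c0; apply: integrable_powexp => //; exact: mexp_gtN1. Qed.

End GammaBessel.

(** * Power series with factorially decaying coefficients *)

Section EntireSeries.
Context {R : realType}.
Implicit Types (c : nat -> R) (D x : R).

(** This class is stable under formal differentiation with the same [D], so all derivatives converge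
    everywhere. *)
Definition exp_type c D := forall k, `|c k| <= D / k`!%:R.

Lemma exp_type_diffs c D : exp_type c D -> exp_type (pseries_diffs c) D.
Proof.
move=> cD k; rewrite /pseries_diffs normrM normr_nat.
rewrite (le_trans (ler_wpM2l _ (cD k.+1)))// factS natrM.
have f0 : k`!%:R != 0 :> R by rewrite pnatr_eq0 -lt0n fact_gt0.
have k0 : k.+1%:R != 0 :> R by rewrite pnatr_eq0.
by rewrite invfM mulrCA [k.+1%:R * _]mulrA divff// mul1r.
Qed.

Lemma exp_type_cvg c D x : exp_type c D -> cvgn (pseries c x).
Proof.
move=> cD; apply: normed_cvg.
have D0 : 0 <= D by have := cD 0%N; rewrite fact0 divr1; exact: le_trans.
apply: (@series_le_cvg _ _ (fun k => D * exp_coeff `|x| k)).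
- by move=> n; exact: normr_ge0.
- by move=> n; rewrite mulr_ge0// exp_coeff_ge0.
- move=> n /=; rewrite normrM normrX /exp_coeff/= mulrA mulrAC.
  by rewrite ler_wpM2r ?exprn_ge0.
have -> : series (fun k => D * exp_coeff `|x| k) =
   fun n => D * series (exp_coeff `|x|) n.
  by apply/funext => n; rewrite /series/= mulr_sumr.
by apply: is_cvgMl_tmp; exact: is_cvg_series_exp_coeff.
Qed.

Lemma exp_type_derive c D x : exp_type c D ->
  is_derive x 1 (fun x => limn (pseries c x)) (limn (pseries (pseries_diffs c) x)).
Proof.
move=> cD; apply: (@pseries_snd_diffs _ _ (`|x| + 1)).
- exact: (exp_type_cvg cD).
- exact: (exp_type_cvg (exp_type_diffs cD)).
- exact: (exp_type_cvg (exp_type_diffs (exp_type_diffs cD))).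
- by rewrite [ltRHS]ger0_norm ?addr_ge0// ltrDl.
Qed.

End EntireSeries.
Arguments exp_type_cvg {R c D} x _.
Arguments exp_type_derive {R c D} x _.

(** * The normalised Bessel function: equation, boundedness, series *)

Section Bessel.
Context {R : realType} (nu : R) (hnu : - (1 / 2) < nu).
Local Notation G := (fun j : nat => Gamma (j%:R + nu + 1)).

(** Coefficients in the variable [u = z^2], without the prefactor [2^(-nu)]. *)
Definition bessel_coef (k : nat) : R := (-1) ^+ k / (k`!%:R * G k) / 4 ^+ k.

Lemma bessel_coef_type : exp_type bessel_coef (G 0%N)^-1.
Proof.
move=> k; rewrite /bessel_coef !normrM !normfV !normrM normrX normrN1 expr1n mul1r.
rewrite !normr_nat normrX normr_nat (gtr0_norm (Gnu_gt0 hnu k)).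
have f1 : 1 <= k`!%:R :> R by rewrite ler1n fact_gt0.
have f0 : 0 < k`!%:R :> R by exact: lt_le_trans f1.
have g0 := Gnu_gt0 hnu 0.
rewrite invfM -mulrA mulrC ler_wpM2r ?invr_ge0// ?(ltW f0)//.
rewrite ler_pdivrMr ?exprn_gt0// (le_trans (Gnu_inv_upper hnu k))//.
rewrite -!mulrA ler_wpM2l ?invr_ge0 ?(ltW g0)// ler_pdivrMr//.
apply: (@le_trans _ _ (4 ^+ k)); first by rewrite lerXn2r ?nnegrE//; lra.
by rewrite ler_peMr// exprn_ge0.
Qed.

Let h0 (u : R) : R := limn (pseries bessel_coef u).
Let h1 (u : R) : R := limn (pseries (pseries_diffs bessel_coef) u).
Let h2 (u : R) : R := limn (pseries (pseries_diffs (pseries_diffs bessel_coef)) u).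

Lemma bessel_coefS k :
  (k%:R + 1) * (k%:R + nu + 1) * bessel_coef k.+1 = - (bessel_coef k / 4).
Proof.
rewrite /bessel_coef GnuS// factS natrM -natr1 !exprS.
have p1 := Gnu_pos hnu k; have p2 := Gnu_gt0 hnu k.
have k1 : 0 < k%:R + 1 :> R by rewrite natr1 ltr0n.
have f0 : 0 < k`!%:R :> R by rewrite ltr0n fact_gt0.
move: (p1) (p2) f0 k1; move: (G k) => g.
have e4 : 4 ^+ k != 0 :> R by rewrite expf_neq0.
move: (4 ^+ k) e4 ((-1) ^+ k) (k`!%:R : R) => F F0 s f *.
by field; rewrite ?F0 ?gt_eqF.
Qed.

(** Bessel's equation in the variable [u = z^2]. Truncated after [n], [n + 1] and [n + 1] terms, the
    three sums cancel exactly by [bessel_coefS], so the limit is that of the zero sequence. *)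
Lemma bessel_ode u : u * h2 u + (nu + 1) * h1 u + h0 u / 4 = 0.
Proof.
have t0 := bessel_coef_type; have t1 := exp_type_diffs t0; have t2 := exp_type_diffs t1.
have c0 := exp_type_cvg u t0; have c1 := exp_type_cvg u t1; have c2 := exp_type_cvg u t2.
have c : (u : R) * pseries (pseries_diffs (pseries_diffs bessel_coef)) u n +
   (nu + 1) * pseries (pseries_diffs bessel_coef) u n.+1 +
   pseries bessel_coef u n.+1 / 4 @[n --> \oo] --> u * h2 u + (nu + 1) * h1 u + h0 u / 4.
  apply: cvgD; first apply: cvgD.
  - by apply: cvgMl_tmp.
  - by apply: cvgMl_tmp; rewrite (cvg_shiftS (pseries (pseries_diffs bessel_coef) u)).
  - by apply: cvgMr_tmp; rewrite (cvg_shiftS (pseries bessel_coef u)).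
rewrite -(cvg_lim _ c)//; apply: cvg_lim => //.
rewrite (_ : (fun n => _) = cst 0); first exact: cvg_cst.
apply/funext => n /=; rewrite /pseries /series/=.
elim: n => [|n IH].
  rewrite !big_nat1 big_nil mulr0 add0r !expr0 !mulr1 /pseries_diffs.
  by have := bessel_coefS 0; rewrite !add0r !mul1r; lra.
rewrite big_nat_recr//= [X in _ + _ * X + _]big_nat_recr//=.
rewrite [X in _ + X / 4]big_nat_recr//=.
have := bessel_coefS n.+1; rewrite {2 3}/pseries_diffs /pseries_diffs.
have n1 : n.+1%:R = n%:R + 1 :> R by rewrite natr1.
have n2 : n.+2%:R = n%:R + 1 + 1 :> R by rewrite -n1 natr1.
rewrite n1 n2 => E; rewrite !exprS.
set S1 := \sum_(0 <= i < n) _ in IH *; set S2 := \sum_(0 <= i < n.+1) _ in IH *.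
set S3 := \sum_(0 <= i < n.+1) _ in IH *.
apply: (@etrans _ _ ((u * S1 + (nu + 1) * S2 + S3 / 4) + u ^+ n.+1 *
   ((n%:R + 1 + 1) * (n%:R + 1 + nu + 1) * bessel_coef n.+2 + bessel_coef n.+1 / 4))).
  rewrite exprS; ring.
by rewrite IH E addNr mulr0 addr0.
Qed.

Lemma besselJnE z : besselJn nu z = 2 `^ (- nu) * h0 (z ^+ 2).
Proof.
rewrite /besselJn; congr (_ * _); rewrite /h0.
rewrite (_ : (fun n : nat => _) = pseries bessel_coef (z ^+ 2))//.
apply/funext => n; rewrite /pseries /series/=; apply: eq_bigr => k _.
have -> : (z / 2) ^+ (2 * k) = (z ^+ 2) ^+ k / 4 ^+ k.
  by rewrite exprM -expr_div_n; congr (_ ^+ k); field.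
by rewrite /bessel_coef mulrA mulrAC.
Qed.

Lemma continuous_h0 : continuous h0.
Proof.
move=> u; apply/differentiable_continuous/derivable1_diffP.
by have [] := exp_type_derive u bessel_coef_type.
Qed.

Lemma continuous_besselJn : continuous (besselJn nu).
Proof.
rewrite (_ : besselJn nu = fun z => 2 `^ (- nu) * h0 (z ^+ 2)); last first.
  by apply/funext => z; rewrite besselJnE.
move=> z; apply: cvgMl_tmp.
apply: (@continuous_comp _ _ _ (fun z : R => z ^+ 2) h0); last exact: continuous_h0.
exact: exprn_continuous.
Qed.

(* The energy [j^2 + j'^2] of [j(z) = J_nu(z) / z^nu] decreases since
   [j'' + (2 nu + 1) / z j' + j = 0]; in the variable [u = z^2] it reads
   [h0^2 + 4 u h1^2]. *)
Lemma bessel_h0_bound (u : R) : 0 <= u -> `|h0 u| <= `|h0 0|.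
Proof.
move=> u0.
have d0 x := exp_type_derive x bessel_coef_type.
have d1 x := exp_type_derive x (exp_type_diffs bessel_coef_type).
pose E (x : R) : R := h0 x * h0 x + 4 * x * (h1 x * h1 x).
have dE (x : R) : is_derive x 1 E (- 4 * (2 * nu + 1) * (h1 x) ^+ 2).
  have e1 := is_derive_funM (d0 x) (d0 x).
  have e2 := is_derive_funM (d1 x) (d1 x).
  have e3 := is_derive_funM (is_derive_funZ 4 (is_derive_monomial 1 x)) e2.
  apply: (is_derive_eq (is_deriveD e1 e3)).
  have ode := bessel_ode x; rewrite -/(h0 x) -/(h1 x) -/(h2 x) /= expr1 expr0.
  have -> : 4 * x * (h2 x * h1 x + h1 x * h2 x) = 8 * h1 x * (x * h2 x) by ring.
  have -> : x * h2 x = - ((nu + 1) * h1 x + h0 x / 4).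
    by apply/eqP; rewrite -addr_eq0 addrA ode.
  by rewrite !mulr1; field.
have [|c _ Ec] := MVT_segment u0 (fun x _ => dE x).
  apply: continuous_subspaceT => x; apply/differentiable_continuous/derivable1_diffP.
  by have [] := dE x.
have Eu : E u <= E 0.
  rewrite -subr_le0 Ec subr0 mulr_le0_ge0// mulr_le0_ge0 ?sqr_ge0//.
  by rewrite mulNr oppr_le0 mulr_ge0//; move: hnu; lra.
rewrite -ler_sqr ?nnegrE// !real_normK ?num_real//.
move: Eu; rewrite /E mulr0 mul0r addr0 -!expr2; apply: le_trans.
by rewrite lerDl mulr_ge0 ?sqr_ge0// mulr_ge0.
Qed.

Lemma besselJn_bound : exists K : R, 0 <= K /\ forall z, `|besselJn nu z| <= K.
Proof.
exists (`|2 `^ (- nu)| * `|h0 0|); split=> [|z]; first by rewrite mulr_ge0.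
by rewrite besselJnE normrM ler_wpM2l// bessel_h0_bound// sqr_ge0.
Qed.

Definition bessel_term (k : nat) (z : R) : R :=
  2 `^ (- nu) * (bessel_coef k * z ^+ (2 * k)).

Lemma cvg_bessel_term z : series (bessel_term ^~ z) @ \oo --> besselJn nu z.
Proof.
rewrite besselJnE.
rewrite (_ : series _ = fun n => 2 `^ (- nu) * pseries bessel_coef (z ^+ 2) n); last first.
  apply/funext => n; rewrite /pseries /series/= mulr_sumr.
  by apply: eq_bigr => k _; rewrite -exprM.
by apply: cvgMl_tmp; exact: (exp_type_cvg _ bessel_coef_type).
Qed.

(** A majorant uniform in [n], for dominated convergence: [z^(2 k) / (k!)^2] is the square of an
    exponential coefficient, and one of the two factors is at most [expR z]. *)
Lemma series_bessel_term_bound z n : 0 <= z ->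
  `|series (bessel_term ^~ z) n| <= 2 `^ (- nu) / G 0%N * expR (2 * z).
Proof.
move=> z0; have g0 := Gnu_gt0 hnu 0.
have p0 : 0 < 2 `^ (- nu) :> R by rewrite powR_gt0.
apply: (le_trans (ler_norm_sum _ _ _)).
apply: (@le_trans _ _ (\sum_(0 <= k < n) 2 `^ (- nu) / G 0%N * (exp_coeff z k * expR z))).
  apply: ler_sum => k _; rewrite /bessel_term normrM (gtr0_norm p0) -mulrA.
  rewrite ler_wpM2l ?(ltW p0)//.
  rewrite /bessel_coef !normrM !normfV !normrM !normrX normrN1 expr1n mul1r.
  rewrite !normr_nat (gtr0_norm (Gnu_gt0 hnu k)) (ger0_norm z0).
  have f0 : 0 < k`!%:R :> R by rewrite ltr0n fact_gt0.
  have ez : exp_coeff z k <= expR z.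
    apply: le_trans (le_series_expR k.+1 z0); rewrite seriesSr lerDr.
    by rewrite /series/= sumr_ge0// => i _; exact: exp_coeff_ge0.
  have e0 : 0 <= exp_coeff z k by exact: exp_coeff_ge0.
  apply: (@le_trans _ _ ((G 0%N)^-1 * (exp_coeff z k * exp_coeff z k))); last first.
    by rewrite ler_wpM2l ?invr_ge0 ?(ltW g0)// ler_wpM2l.
  rewrite [leLHS](_ : _ = (G k)^-1 * ((k`!%:R)^-1 * (z ^+ (2 * k) * (4 ^+ k)^-1)));
    last by rewrite invfM; ring.
  apply: (@le_trans _ _ (((G 0%N)^-1 * 2 ^+ k / k`!%:R) *
      ((k`!%:R)^-1 * (z ^+ (2 * k) * (4 ^+ k)^-1)))).
    rewrite ler_wpM2r ?Gnu_inv_upper// !mulr_ge0 ?invr_ge0 ?exprn_ge0// ltW//.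
  have -> : (G 0%N)^-1 * 2 ^+ k / k`!%:R * ((k`!%:R)^-1 * (z ^+ (2 * k) * (4 ^+ k)^-1)) =
     (G 0%N)^-1 * (exp_coeff z k * exp_coeff z k * (2 ^+ k / 4 ^+ k)).
    by rewrite /exp_coeff/= mul2n -addnn exprD; ring.
  have q1 : 2 ^+ k / 4 ^+ k <= 1 :> R.
    by rewrite ler_pdivrMr ?exprn_gt0// mul1r lerXn2r ?nnegrE//; lra.
  by rewrite ler_wpM2l ?invr_ge0 ?(ltW g0)// ler_piMr//; exact: mulr_ge0.
rewrite -mulr_sumr -mulr_suml ler_wpM2l ?divr_ge0 ?(ltW g0) ?(ltW p0)//.
have -> : expR (2 * z) = expR z * expR z by rewrite -expRD; congr expR; ring.
by rewrite ler_wpM2r ?expR_ge0//; exact: le_series_expR.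
Qed.

End Bessel.

Lemma cvg_sumr {R : realType} (I : Type) (s : seq I) (f : I -> nat -> R) (l : I -> R) :
  (forall i, f i n @[n --> \oo] --> l i) ->
  \sum_(i <- s) f i n @[n --> \oo] --> \sum_(i <- s) l i.
Proof.
move=> fl; elim: s => [|i s IH].
  by under eq_fun do rewrite big_nil; rewrite big_nil; exact: cvg_cst.
by under eq_fun do rewrite big_cons; rewrite big_cons; exact: cvgD.
Qed.

(** * Hankel transform of Gaussian monomials *)

Section HankelKernel.
Context {R : realType} (nu : R) (hnu : - (1 / 2) < nu).
Local Notation mu := (@lebesgue_measure R).
Local Notation G := (fun j : nat => Gamma (j%:R + nu + 1)).

(** The Chu-Vandermonde identity: a rising factorial expanded in falling factorials of [n], which
    have closed sums against [x^n / n!]. *)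
Lemma Gnu_vandermonde n j : G (n + j)%N / G n =
  \sum_(0 <= i < j.+1) 'C(j, i)%:R * (n ^_ i)%:R * (G j / G i).
Proof.
have gn m : G m != 0 by rewrite gt_eqF// Gnu_gt0.
elim: j => [|j IH].
  by rewrite big_nat1 bin0 ffactn0 addn0 !mul1r !divff// ?gn.
have ffS i : (n ^_ i.+1)%:R = (n%:R - i%:R) * (n ^_ i)%:R :> R.
  rewrite ffactnSr; have [ni|ni] := ltnP n i.
    by rewrite ffact_small// mul0n mulr0.
  by rewrite natrM natrB// mulrC.
rewrite addnS GnuS// -mulrA IH natrD mulr_sumr.
transitivity (\sum_(0 <= i < j.+1) 'C(j, i)%:R * (n ^_ i.+1)%:R * (G j / G i) +
  \sum_(0 <= i < j.+2) (nu + j%:R + 1 + i%:R) * ('C(j, i)%:R * (n ^_ i)%:R * (G j / G i))).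
  rewrite [X in _ = _ + X]big_nat_recr//= bin_small// !(mul0r, mulr0) addr0 -big_split/=.
  by apply: eq_bigr => i _; rewrite ffS; ring.
rewrite [X in _ + X = _]big_nat_recl//= [RHS]big_nat_recl//= !bin0 !ffactn0 GnuS//.
rewrite addrCA; congr (_ + _); first by ring.
rewrite -big_split/=; apply: eq_big_nat => i /andP[_ ij].
have Ci : i.+1%:R * 'C(j, i.+1)%:R = (j%:R - i%:R) * 'C(j, i)%:R :> R.
  by rewrite -natrM mul_bin_left natrM natrB.
have gi1 := gn i.+1; have gi := gn i; have gj := gn j.
have p1 : i%:R + nu + 1 != 0 by rewrite gt_eqF// Gnu_pos.
have E1 : (G i)^-1 = (i%:R + nu + 1) / G i.+1.
  by rewrite GnuS// invfM mulrA divff// mul1r.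
rewrite E1 binS natrD.
transitivity ((n ^_ i.+1)%:R * (G j / G i.+1) * ('C(j, i)%:R * (i%:R + nu + 1) +
  (nu + j%:R + 1) * 'C(j, i.+1)%:R + i.+1%:R * 'C(j, i.+1)%:R)); first by ring.
by rewrite Ci; ring.
Qed.

Lemma cvg_falling_exp (x : R) i :
  \sum_(0 <= n < N) x ^+ n / n`!%:R * (n ^_ i)%:R @[N --> \oo] --> x ^+ i * expR x.
Proof.
rewrite -(cvg_shiftn i).
rewrite (_ : (fun N => _) = fun N => x ^+ i * series (exp_coeff x) N); last first.
  apply/funext => N /=; rewrite (big_cat_nat (n := i))//= ?leq_addl//.
  rewrite big_nat big1 ?add0r; last first.
    by move=> n /andP[_ ni]; rewrite ffact_small// mulr0.
  rewrite (big_addn 0 (N + i) i) addnK /series/= mulr_sumr; apply: eq_bigr => n _.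
  have fi : (n + i)`!%:R = n`!%:R * ((n + i) ^_ i)%:R :> R.
    by rewrite -natrM mulnC -{3}(addnK i n) ffact_fact// leq_addl.
  have h1 : n`!%:R != 0 :> R by rewrite pnatr_eq0 -lt0n fact_gt0.
  have h2 : ((n + i) ^_ i)%:R != 0 :> R by rewrite pnatr_eq0 -lt0n ffact_gt0 leq_addl.
  by rewrite fi exprD /exp_coeff/=; field; rewrite h1 h2.
by apply: cvgMl_tmp; exact: cvg_series_expR.
Qed.

(** Its value is [1]; it is kept symbolic as a positive constant and divided out when the bound on
    [rhankel] is transferred to [dual_coef]. *)
Definition hankel_const : R := 2 `^ (- nu) * gauss_mom nu 2^-1.

Lemma hankel_const_gt0 : 0 < hankel_const.
Proof. by rewrite mulr_gt0 ?powR_gt0// gauss_mom_gt0// invr_gt0. Qed.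

(** Up to [hankel_const] this is [2^j j! L_j^nu (r^2 / 2) e^(-r^2 / 2)]. *)
Definition hankel_gauss j (r : R) : R := hankel_const * (G j *
  \sum_(0 <= i < j.+1) 'C(j, i)%:R * 2 ^+ (j - i) * ((-1) ^+ i / G i) * r ^+ (2 * i))
  * expR (- (2^-1 * r ^+ 2)).

Let half0 : 0 < 2^-1 :> R. Proof. by rewrite invr_gt0. Qed.

Lemma integral_gauss c j : 0 < c ->
  (\int[mu]_(r in Rpos) (powexp (mexp nu j) c 2 r)%:E =
   (gauss_mom nu c * G j / c ^+ j)%:E)%E.
Proof.
move=> c0; rewrite -(gauss_momE hnu j c0) /Rintegral fineK//.
by apply: (integrable_fin_num mRposL); exact: integrable_gauss.
Qed.

Lemma bessel_partial_moment j r N :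
  (\int[mu]_(s in Rpos) (series (fun k => bessel_term nu k (s * r)) N *
     powexp (mexp nu j) 2^-1 2 s)%:E =
  (hankel_const * 2 ^+ j * \sum_(0 <= n < N)
     (- (r ^+ 2 / 2)) ^+ n / n`!%:R * (G (n + j)%N / G n))%:E)%E.
Proof.
have gn m : G m != 0 by rewrite gt_eqF// Gnu_gt0.
pose cf n := 2 `^ (- nu) * bessel_coef nu n * r ^+ (2 * n).
transitivity (\int[mu]_(s in Rpos)
   (\sum_(0 <= n < N) ((cf n)%:E * (powexp (mexp nu (n + j)) 2^-1 2 s)%:E)))%E.
  apply: eq_integral => s; rewrite inE RposE => s0.
  under eq_bigr do rewrite -EFinM.
  rewrite sumEFin; congr EFin; rewrite /series/= mulr_suml; apply: eq_bigr => n _.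
  rewrite /bessel_term /cf /powexp -!powR_mexp// exprMn mulnDr exprD; ring.
rewrite integral_sum//; [|exact: mRposL|]; last first.
  by move=> n; apply: integrableZl; [exact: mRposL | exact: integrable_gauss].
transitivity (\sum_(0 <= n < N) (cf n * (gauss_mom nu 2^-1 * G (n + j)%N / 2^-1 ^+ (n + j)))%:E)%E.
  apply: eq_bigr => n _; rewrite integralZl//; [|exact: mRposL|exact: integrable_gauss].
  by rewrite integral_gauss// -EFinM.
rewrite sumEFin; congr EFin; rewrite mulr_sumr; apply: eq_bigr => n _.
have f0 : n`!%:R != 0 :> R by rewrite pnatr_eq0 -lt0n fact_gt0.
have e4 : 4 ^+ n = 2 ^+ n * 2 ^+ n :> R by rewrite -exprMn; congr (_ ^+ n); ring.
have e2 : 2 ^+ n != 0 :> R by rewrite expf_neq0.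
have x1 : (- (r ^+ 2 / 2)) ^+ n = (-1) ^+ n * (r ^+ (2 * n) / 2 ^+ n).
  by rewrite [LHS]exprNn expr_div_n exprM.
rewrite /cf /bessel_coef /hankel_const e4 x1 exprVn invrK exprD.
move: (gn n) f0 e2; move: (G n) (n`!%:R : R) (2 ^+ n : R) => g F T g0 F0 T0.
by field; do ?(apply/andP; split).
Qed.

Lemma hankel_kernel j r : 0 < r ->
  mu.-integrable Rpos (fun s => (besselJn nu (s * r) * powexp (mexp nu j) 2^-1 2 s)%:E) /\
  (\int[mu]_(s in Rpos) (besselJn nu (s * r) * powexp (mexp nu j) 2^-1 2 s)%:E =
   (hankel_gauss j r)%:E)%E.
Proof.
move=> r0; have gn m : G m != 0 by rewrite gt_eqF// Gnu_gt0.
have g0 := Gnu_gt0 hnu 0.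
pose f_ N (s : R) := (series (fun k => bessel_term nu k (s * r)) N *
  powexp (mexp nu j) 2^-1 2 s)%:E.
pose f (s : R) := (besselJn nu (s * r) * powexp (mexp nu j) 2^-1 2 s)%:E.
(* [2 s r <= s^2 / 4 + 4 r^2], so half of the Gaussian exponent absorbs the majorant of the partial
   sums. *)
pose K := 2 `^ (- nu) / G 0%N * expR (4 * r ^+ 2).
pose g (s : R) := (K%:E * (powexp (mexp nu j) 4^-1 2 s)%:E)%E.
have mbt N : measurable_fun (Rpos : set R) (fun s : R =>
    series (fun k => bessel_term nu k (s * r)) N).
  apply: (@measurable_sum _ _ _ _ _ _ (fun k (s : R) => bessel_term nu k (s * r))) => k.
  apply: (@measurable_funS _ _ _ _ setT) => //.
  apply: measurable_funM => //; apply: measurable_funM => //.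
  by apply: measurable_funX; apply: measurable_funM.
have mf_ N : measurable_fun (Rpos : set R) (f_ N).
  apply/measurable_EFinP; apply: measurable_funM; first exact: mbt.
  exact: measurable_powexp.
have mf : measurable_fun (Rpos : set R) f.
  apply/measurable_EFinP; apply: measurable_funM; last exact: measurable_powexp.
  apply: (@measurable_funS _ _ _ _ setT) => //.
  apply: continuous_measurable_fun => s.
  apply: (@continuous_comp _ _ _ (fun s : R => s * r) (besselJn nu)).
    by apply: cvgMr_tmp; exact: cvg_id.
  exact: continuous_besselJn.
have ig : mu.-integrable Rpos g.
  apply: integrableZl; first exact: mRposL.
  by apply: integrable_gauss => //; rewrite invr_gt0.
have cvf s : f_ ^~ s @ \oo --> f s.
  apply: cvg_EFin; first by near=> N.
  by apply: cvgMr_tmp; exact: cvg_bessel_term.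
have dom N s : Rpos s -> (`|f_ N s| <= g s)%E.
  rewrite RposE => s0; rewrite /f_ /g -EFinM abse_EFin lee_fin normrM.
  rewrite (ger0_norm (powexp_ge0 _ _ _ _)).
  apply: (@le_trans _ _ (2 `^ (- nu) / G 0%N * expR (2 * (s * r)) *
     powexp (mexp nu j) 2^-1 2 s)).
    rewrite ler_wpM2r ?powexp_ge0//; apply: series_bessel_term_bound => //.
    by rewrite mulr_ge0 ?ltW.
  rewrite /K -!mulrA ler_wpM2l ?powR_ge0// ler_wpM2l ?invr_ge0 ?(ltW g0)//.
  rewrite /powexp mulrCA [leRHS]mulrCA ler_wpM2l ?powR_ge0// -!expRD ler_expR.
  have : 0 <= (s / 2 - 2 * r) ^+ 2 by exact: sqr_ge0.
  have -> : (s / 2 - 2 * r) ^+ 2 = 4^-1 * s ^+ 2 - 2 * (s * r) + 4 * r ^+ 2 by field.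
  lra.
have [||||||i1 _ i3] := @dominated_convergence _ _ R mu Rpos _ f_ f g.
- exact: mRposL.
- by move=> N; exact: mf_.
- exact: mf.
- by apply: aeW => s _; exact: cvf.
- exact: ig.
- by apply: aeW => s N Ns; exact: dom.
split=> //.
have c1 : (\int[mu]_(s in Rpos) f_ N s @[N --> \oo] --> \int[mu]_(s in Rpos) f s)%E := i3.
rewrite -(cvg_lim _ c1)//; apply: cvg_lim => //.
under eq_fun do rewrite bessel_partial_moment.
apply: cvg_EFin; first by near=> N.
have -> : hankel_gauss j r = hankel_const * 2 ^+ j *
   \sum_(0 <= i < j.+1) 'C(j, i)%:R * (G j / G i) *
     ((- (r ^+ 2 / 2)) ^+ i * expR (- (r ^+ 2 / 2))).
  rewrite /hankel_gauss -[LHS]mulrA -[RHS]mulrA; congr (_ * _).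
  rewrite -[LHS]mulrA mulr_suml mulr_sumr [RHS]mulr_sumr.
  apply: eq_big_nat => i /andP[_ ij].
  have -> : (- (r ^+ 2 / 2)) ^+ i = (-1) ^+ i * (r ^+ (2 * i) / 2 ^+ i).
    by rewrite [LHS]exprNn expr_div_n exprM.
  have -> : 2 ^+ j = 2 ^+ (j - i) * 2 ^+ i :> R by rewrite -exprD subnK.
  have -> : - (2^-1 * r ^+ 2) = - (r ^+ 2 / 2) by ring.
  have e2 : 2 ^+ i != 0 :> R by rewrite expf_neq0.
  move: (gn i) e2; move: (G i) (2 ^+ i : R) => gg T gg0 T0.
  by field; do ?(apply/andP; split).
apply: cvgMl_tmp.
rewrite (_ : (fun N => _) = fun N => \sum_(0 <= i < j.+1) 'C(j, i)%:R * (G j / G i) *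
    \sum_(0 <= n < N) (- (r ^+ 2 / 2)) ^+ n / n`!%:R * (n ^_ i)%:R); last first.
  apply/funext => N; under eq_bigr do rewrite Gnu_vandermonde mulr_sumr.
  rewrite exchange_big/=; apply: eq_bigr => i _; rewrite mulr_sumr.
  by apply: eq_bigr => n _; ring.
by apply: cvg_sumr => i; apply: cvgMl_tmp; exact: cvg_falling_exp.
Unshelve. all: by end_near. Qed.

End HankelKernel.

(** * Action of the Hankel transform on Gaussian moments *)

Section HankelDuality.
Context {R : realType} (nu : R) (hnu : - (1 / 2) < nu).
Local Notation mu := (@lebesgue_measure R).
Local Notation G := (fun j : nat => Gamma (j%:R + nu + 1)).
Local Notation T := (measurableTypeR R).
Implicit Types f : R -> R.
Local Opaque besselJn.

Definition radial f (r : R) : R := f r * r `^ (2 * nu + 1).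

Definition rhankel f (s : R) : R :=
  \int[mu]_(r in Rpos) (f r * (besselJn nu (s * r) * r `^ (2 * nu + 1))).

Definition rmom f j : R :=
  \int[mu]_(r in Rpos) (radial f r * (r ^+ (2 * j) * expR (- (2^-1 * r ^+ 2)))).

Definition dcoef f j : R := (-1) ^+ j * rmom f j / G j.

Lemma integrable_mul_bounded f (g : R -> R) (K : R) :
  mu.-integrable Rpos (EFin \o f) -> measurable_fun (Rpos : set R) g ->
  (forall r, 0 < r -> `|g r| <= K) ->
  mu.-integrable Rpos (EFin \o (fun r => f r * g r)).
Proof.
move=> intf mg gK; have mf : measurable_fun (Rpos : set R) f.
  by have /integrableP[/measurable_EFinP] := intf.
have K0 : 0 <= K by apply: le_trans (gK 1 ltr01); exact: normr_ge0.
apply: (@le_integrable _ _ _ _ _ mRposL _ (fun r => K%:E * (f r)%:E)%E).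
- by apply/measurable_EFinP; exact: measurable_funM.
- move=> r; rewrite RposE => r0 /=; rewrite lee_fin !normrM (ger0_norm K0) mulrC.
  by rewrite ler_wpM2r// gK.
- exact: (integrableZl mRposL).
Qed.

Lemma measurable_gauss_factor j :
  measurable_fun (Rpos : set R) (fun r : R => r ^+ (2 * j) * expR (- (2^-1 * r ^+ 2))).
Proof.
apply: (@measurable_funS _ _ _ _ setT) => //.
apply: measurable_funM; first exact: exprn_measurable.
apply: measurableT_comp; first exact: measurable_expR.
apply: measurableT_comp; first exact: oppr_measurable.
by apply: measurable_funM => //; exact: exprn_measurable.
Qed.

Lemma gauss_factor_bound j (r : R) :
  0 <= r ^+ (2 * j) * expR (- (2^-1 * r ^+ 2)) <= 2 ^+ j * j`!%:R.
Proof.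
have x0 : 0 <= 2^-1 * r ^+ 2 by rewrite mulr_ge0 ?invr_ge0 ?sqr_ge0.
have f0 : 0 < j`!%:R :> R by rewrite ltr0n fact_gt0.
apply/andP; split; first by rewrite mulr_ge0 ?expR_ge0// exprM exprn_ge0// sqr_ge0.
have -> : r ^+ (2 * j) = 2 ^+ j * (2^-1 * r ^+ 2) ^+ j.
  by rewrite -exprMn mulrA divff// mul1r exprM.
have key : (2^-1 * r ^+ 2) ^+ j / j`!%:R <= expR (2^-1 * r ^+ 2).
  apply: le_trans (le_series_expR j.+1 x0); rewrite seriesSr lerDr.
  by rewrite /series/= sumr_ge0// => i _; exact: exp_coeff_ge0.
rewrite -mulrA ler_pM2l ?exprn_gt0// expRN ler_pdivrMr ?expR_gt0//.
by move: key; rewrite ler_pdivrMr// => key; rewrite [leRHS]mulrC.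
Qed.

Lemma integrable_rmom f j : mu.-integrable Rpos (EFin \o radial f) ->
  mu.-integrable Rpos
    (EFin \o (fun r => radial f r * (r ^+ (2 * j) * expR (- (2^-1 * r ^+ 2))))).
Proof.
move=> intf; apply: (integrable_mul_bounded (K := 2 ^+ j * j`!%:R)) => //.
  exact: measurable_gauss_factor.
by move=> r r0; have /andP[h1 h2] := gauss_factor_bound j r; rewrite ger0_norm.
Qed.

Lemma measurable_besselJn : measurable_fun [set: R] (besselJn nu).
Proof. by apply: continuous_measurable_fun; exact: continuous_besselJn. Qed.

Section Fubini.
Context (f : R -> R) (j : nat).
Context (intf : mu.-integrable Rpos (EFin \o radial f)).

Let mf : measurable_fun (Rpos : set R) (radial f).
Proof. by have /integrableP[/measurable_EFinP] := intf. Qed.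

(** Extensions by zero, so that Fubini's theorem applies on the full product space. *)
Let a : T -> R := radial f \_ Rpos.
Let b : T -> R := powexp (mexp nu j) 2^-1 2 \_ Rpos.
Let Phi : T * T -> \bar R := fun p => (a p.1 * (besselJn nu (p.2 * p.1) * b p.2))%:E.

Let half0 : 0 < 2^-1 :> R. Proof. by rewrite invr_gt0. Qed.

Let ma : measurable_fun [set: T] a.
Proof. by apply/(measurable_restrictT _ mRposL). Qed.

Let mb : measurable_fun [set: T] b.
Proof. by apply/(measurable_restrictT _ mRposL); exact: measurable_powexp. Qed.

Let b0 y : 0 <= b y.
Proof. by rewrite /b patchE; case: ifP => // _; exact: powexp_ge0. Qed.

Let mPhi : measurable_fun [set: T * T] Phi.
Proof.
apply/measurable_EFinP; apply: measurable_funM.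
  by apply: (measurableT_comp ma); exact: measurable_fst.
apply: measurable_funM; last by apply: (measurableT_comp mb); exact: measurable_snd.
apply: (measurableT_comp measurable_besselJn).
by apply: measurable_funM; [exact: measurable_snd | exact: measurable_fst].
Qed.

Let intb : (\int[mu]_y (b y)%:E < +oo)%E.
Proof.
have := integrable_gauss hnu j half0.
move=> /integrableP[_]; apply: le_lt_trans.
rewrite [leRHS]integral_mkcond le_eqVlt; apply/orP; left; apply/eqP.
apply: eq_integral => y _; rewrite /b !patchE; case: ifP => // _.
by rewrite /= ger0_norm// powexp_ge0.
Qed.

Let inta : (\int[mu]_x `|a x|%:E < +oo)%E.
Proof.
have /integrableP[_] := intf; apply: le_lt_trans.
rewrite [leRHS]integral_mkcond le_eqVlt; apply/orP; left; apply/eqP.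
by apply: eq_integral => y _; rewrite /a !patchE; case: ifP => // _; rewrite normr0.
Qed.

(** The Bessel kernel is bounded, which separates the variables in the double integral. *)
Let intPhi : (mu \x mu)%E.-integrable [set: T * T] Phi.
Proof.
apply/integrable12ltyP => //.
have [K [K0 HK]] := besselJn_bound hnu.
have bfin : (\int[mu]_y (b y)%:E)%E \is a fin_num.
  by rewrite ge0_fin_numE// integral_ge0// => y _; rewrite lee_fin.
set be := (\int[mu]_y (b y)%:E)%E in bfin *.
have be0 : (0 <= be)%E by apply: integral_ge0 => y _; rewrite lee_fin.
apply: (@le_lt_trans _ _ (\int[mu]_x ((K%:E * be) * `|a x|%:E))%E).
  apply: ge0_le_integral => //.
  - by move=> x _; apply: integral_ge0 => y _; exact: abse_ge0.
  - apply: (@measurable_fun_fubini_tonelli_F _ _ T T R mu (abse \o Phi)) => //.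
      exact: measurableT_comp.
    by move=> p; exact: abse_ge0.
  - apply: measurable_funeM; apply/measurable_EFinP.
    by apply: measurableT_comp => //; exact: ma.
  - move=> x _; rewrite -muleA [(be * _)%E]muleC muleA -EFinM -ge0_integralZl//.
    + apply: ge0_le_integral => //.
      * by apply: measurableT_comp => //; apply: measurableT_comp mPhi _; exact: measurable_pair1.
      * by apply: measurable_funeM; exact/measurable_EFinP.
      * move=> y _; rewrite /Phi/= lee_fin; move: (HK (y * x)).
        move: (besselJn nu (y * x)) => J HJ; rewrite !normrM (ger0_norm (b0 y)) mulrA.
        by rewrite ler_wpM2r// mulrC ler_wpM2r.
    + exact/measurable_EFinP.
    + by move=> y _; rewrite lee_fin.
    + by rewrite lee_fin mulr_ge0.
rewrite ge0_integralZl//.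
- rewrite lte_mul_pinfty// ?mule_ge0// ?lee_fin//.
  by rewrite fin_numM.
- by apply/measurable_EFinP; apply: measurableT_comp => //; exact: ma.
- by rewrite mule_ge0// lee_fin.
Qed.

Let inner_s x : (\int[mu]_y Phi (x, y) =
  ((fun r => radial f r * hankel_gauss nu j r) \_ Rpos x)%:E)%E.
Proof.
rewrite patchE; case: ifPn => [|xN]; last first.
  rewrite integral0_eq// => y _; rewrite /Phi/= /a patchE (negbTE xN).
  by rewrite mul0r.
rewrite inE RposE => x0; have [i1 i2] := hankel_kernel hnu j x0.
rewrite EFinM -i2 -integralZl//; last exact: mRposL.
rewrite [RHS]integral_mkcond; apply: eq_integral => y _.
rewrite /Phi/= /a /b !patchE (mem_set (_ : Rpos x)) ?RposE//.
by case: ifP => // _; rewrite !mulr0.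
Qed.

Let int_rhankel y : mu.-integrable Rpos
  (EFin \o (fun r => f r * (besselJn nu (y * r) * r `^ (2 * nu + 1)))).
Proof.
have [K [K0 HK]] := besselJn_bound hnu.
rewrite (_ : (fun r => _) = fun r => radial f r * besselJn nu (y * r)); last first.
  by apply/funext => r; rewrite /radial [besselJn _ _ * _]mulrC mulrA.
apply: (integrable_mul_bounded (K := K)) => //.
apply: (@measurable_funS _ _ _ _ setT) => //.
by apply: (measurableT_comp measurable_besselJn); exact: measurable_funM.
Qed.

Let inner_r y : (\int[mu]_x Phi (x, y) =
  ((fun s => rhankel f s * powexp (mexp nu j) 2^-1 2 s) \_ Rpos y)%:E)%E.
Proof.
rewrite patchE; case: ifPn => [|yN]; last first.
  rewrite integral0_eq// => x _; rewrite /Phi/= /b patchE (negbTE yN).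
  by rewrite !mulr0.
rewrite inE RposE => y0.
rewrite mulrC EFinM /rhankel /Rintegral fineK; last first.
  exact: (integrable_fin_num mRposL (int_rhankel y)).
rewrite -(integralZl mRposL (int_rhankel y)).
rewrite [RHS]integral_mkcond; apply: eq_integral => x _.
rewrite /Phi/= /a /b !patchE (mem_set (_ : Rpos y)) ?RposE//.
case: ifP => // _; rewrite ?mul0r// -EFinM; congr EFin.
rewrite /radial; move: (f x) (besselJn nu (y * x)) (powexp _ _ _ y) (x `^ _) => F J P p.
by ring.
Qed.

Lemma measurable_rhankel_gauss :
  measurable_fun (Rpos : set R) (fun s => rhankel f s * powexp (mexp nu j) 2^-1 2 s).
Proof.
have : measurable_fun [set: T] (fun y => \int[mu]_x Phi (x, y))%E.
  exact: (measurable_fubini_G intPhi).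
under eq_fun do rewrite inner_r.
by move=> /measurable_EFinP/(measurable_restrictT _ mRposL).
Qed.

Lemma hankel_fubini :
  \int[mu]_(s in Rpos) (rhankel f s * powexp (mexp nu j) 2^-1 2 s) =
  \int[mu]_(r in Rpos) (radial f r * hankel_gauss nu j r).
Proof.
rewrite /Rintegral; congr fine.
have -> : (\int[mu]_(s in Rpos) (rhankel f s * powexp (mexp nu j) 2^-1 2 s)%:E =
    \int[mu]_y \int[mu]_x Phi (x, y))%E.
  by rewrite integral_mkcond; apply: eq_integral => y _; rewrite inner_r !patchE; case: ifP.
have -> : (\int[mu]_(r in Rpos) (radial f r * hankel_gauss nu j r)%:E =
    \int[mu]_x \int[mu]_y Phi (x, y))%E.
  by rewrite integral_mkcond; apply: eq_integral => x _; rewrite inner_s !patchE; case: ifP.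
exact: esym (Fubini intPhi).
Qed.

End Fubini.

(** Fubini's theorem gives measurability of the product with a Gaussian weight; the weight of index
    [0] is then divided out. *)
Lemma measurable_rhankel f : mu.-integrable Rpos (EFin \o radial f) ->
  measurable_fun (Rpos : set R) (rhankel f).
Proof.
move=> intf; have m0 := measurable_rhankel_gauss 0 intf.
apply: (eq_measurable_fun (fun s : R => (rhankel f s * powexp (mexp nu 0) 2^-1 2 s) *
   powexp (- mexp nu 0) (- 2^-1) 2 s)).
  move=> s; rewrite inE RposE => s0; rewrite -mulrA /powexp mulrACA.
  rewrite -powRD ?(gt_eqF s0) ?implybT// subrr powRr0 -expRD.
  by rewrite mulNr opprK addNr expR0 !mulr1.
by apply: measurable_funM => //; exact: measurable_powexp.
Qed.

Lemma rmomE f j : rmom f j = \int[mu]_(r in Rpos) (f r * powexp (mexp nu j) 2^-1 2 r).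
Proof.
apply: eq_Rintegral => r; rewrite inE RposE => r0.
by rewrite /radial /powexp -powR_mexp//; ring.
Qed.

(** After Fubini, the coefficients [(-1)^i / G i] of [hankel_gauss] turn the moments of [f] into
    [dcoef nu f i], and the binomials with powers of two are those of [dual_coef]. *)
Lemma dcoef_rhankel f j : mu.-integrable Rpos (EFin \o radial f) ->
  dcoef (rhankel f) j = hankel_const nu * dual_coef (dcoef f) j.
Proof.
move=> intf; have gn m : G m != 0 by rewrite gt_eqF// Gnu_gt0.
have E : rmom (rhankel f) j = hankel_const nu * G j * \sum_(0 <= i < j.+1)
    ('C(j, i)%:R * 2 ^+ (j - i)) * dcoef f i.
  rewrite rmomE hankel_fubini//.
  pose cf i := hankel_const nu * G j * ('C(j, i)%:R * 2 ^+ (j - i) * ((-1) ^+ i / G i)).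
  have ii i := integrable_rmom i intf.
  transitivity (\sum_(0 <= i < j.+1) cf i * rmom f i); last first.
    by rewrite mulr_sumr; apply: eq_bigr => i _; rewrite /cf /dcoef; ring.
  suff X : (\int[mu]_(r in Rpos) (radial f r * hankel_gauss nu j r)%:E =
      (\sum_(0 <= i < j.+1) cf i * rmom f i)%:E)%E by rewrite /Rintegral X.
  rewrite -sumEFin.
  transitivity (\int[mu]_(r in Rpos) \sum_(0 <= i < j.+1)
    ((cf i)%:E * (radial f r * (r ^+ (2 * i) * expR (- (2^-1 * r ^+ 2))))%:E))%E.
    apply: eq_integral => r _; under eq_bigr do rewrite -EFinM.
    rewrite sumEFin; congr EFin; rewrite /hankel_gauss !mulr_sumr mulr_suml mulr_sumr.
    by apply: eq_bigr => i _; rewrite /cf; ring.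
  rewrite integral_sum//; [|exact: mRposL|]; last first.
    by move=> i; apply: (integrableZl mRposL); exact: ii.
  apply: eq_bigr => i _; rewrite (integralZl mRposL (ii i)) [RHS]EFinM.
  congr (mule _ _); rewrite /rmom /Rintegral fineK//.
  exact: (integrable_fin_num mRposL (ii i)).
rewrite /dcoef E /dual_coef; move: (gn j); move: (G j) => g g0.
by field.
Qed.

End HankelDuality.

(** * Laguerre inner products and bounds on the coefficients *)

Section LaguerreInner.
Context {R : realType} (nu : R) (hnu : - (1 / 2) < nu).
Local Notation mu := (@lebesgue_measure R).
Local Notation G := (fun j : nat => Gamma (j%:R + nu + 1)).
Implicit Types f : R -> R.

Definition rinner f k : R :=
  \int[mu]_(r in Rpos) (f r * (laguerre_fun nu k r * r `^ (2 * nu + 1))).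

(** The product in the Laguerre coefficient equals [G k / G j]; its denominator is the one in
    [dcoef]. *)
Lemma rinnerE f k : mu.-integrable Rpos (EFin \o radial nu f) ->
  rinner f k = G k * exp_conv (dcoef nu f) k.
Proof.
move=> intf; have ii i := integrable_rmom i intf.
pose cf j := (-1) ^+ j * (G k / G j) / ((k - j)`!%:R * j`!%:R).
have gn m : G m != 0 by rewrite gt_eqF// Gnu_gt0.
have -> : G k * exp_conv (dcoef nu f) k = \sum_(0 <= j < k.+1) cf j * rmom nu f j.
  rewrite /exp_conv mulr_sumr; apply: eq_bigr => j _.
  by rewrite /cf /dcoef invfM; ring.
suff X : (\int[mu]_(r in Rpos) (f r * (laguerre_fun nu k r * r `^ (2 * nu + 1)))%:E =
    (\sum_(0 <= j < k.+1) cf j * rmom nu f j)%:E)%E by rewrite /rinner /Rintegral X.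
rewrite -sumEFin.
transitivity (\int[mu]_(r in Rpos) \sum_(0 <= i < k.+1)
  ((cf i)%:E * (radial nu f r * (r ^+ (2 * i) * expR (- (2^-1 * r ^+ 2))))%:E))%E.
  apply: eq_integral => r _; under eq_bigr do rewrite -EFinM.
  rewrite sumEFin; congr EFin; rewrite /laguerre_fun /laguerre.
  rewrite -(big_mkord xpredT (fun j => (-1) ^+ j * (\prod_(j.+1 <= i < k.+1) (nu + i%:R))
        / ((k - j)`!%:R * j`!%:R) * (r ^+ 2) ^+ j)).
  rewrite !mulr_suml mulr_sumr; apply: eq_big_nat => j /andP[_ jk].
  rewrite Gnu_prod// /cf /radial -exprM (_ : - r ^+ 2 / 2 = - (2^-1 * r ^+ 2)); last by ring.
  by ring.
rewrite integral_sum//; [|exact: mRposL|]; last first.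
  by move=> i; apply: (integrableZl mRposL); exact: ii.
apply: eq_bigr => i _; rewrite (integralZl mRposL (ii i)) [RHS]EFinM.
congr (mule _ _); rewrite /rmom /Rintegral fineK//.
exact: (integrable_fin_num mRposL (ii i)).
Qed.

Lemma exp_coeff_le (x : R) n : 0 <= x -> exp_coeff x n <= expR x.
Proof.
move=> x0; apply: le_trans (le_series_expR n.+1 x0); rewrite seriesSr lerDr.
by rewrite /series/= sumr_ge0// => i _; exact: exp_coeff_ge0.
Qed.

(** The Gaussian factor is at most [2^j j!] and [1 / G j] is of order [2^j / j!], so [d_j] is of
    order [4^j]; the exponent [5] is [4] from this series plus [1] from [e^t]. *)
Lemma exp_conv_crude f : mu.-integrable Rpos (EFin \o radial nu f) ->
  exists2 C : R, 0 <= C & forall k (x : R), 0 <= x ->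
    `|exp_conv (dcoef nu f) k| * x ^+ k <= C * expR (5 * x).
Proof.
move=> intf; pose N1 := \int[mu]_(r in Rpos) `|radial nu f r|.
have N10 : 0 <= N1 by apply: Rintegral_ge0 => r _; exact: normr_ge0.
have g0 := Gnu_gt0 hnu 0.
have ia : mu.-integrable Rpos (EFin \o (fun r => `|radial nu f r|)).
  exact: (integrable_abse intf).
have mom j : `|rmom nu f j| <= N1 * (2 ^+ j * j`!%:R).
  apply: (le_trans (le_normr_Rintegral mRposL (integrable_rmom j intf))).
  rewrite -(RintegralZr _ mRposL ia); apply: (le_Rintegral mRposL).
  - exact: (integrable_abse (integrable_rmom j intf)).
  - exact: (integrableZr mRposL (2 ^+ j * j`!%:R) ia).
  move=> r _; have /andP[h1 h2] := gauss_factor_bound j r.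
  by rewrite normrM (ger0_norm h1) ler_wpM2l.
pose M := N1 / G 0%N.
have M0 : 0 <= M by apply: divr_ge0 => //; exact: ltW.
have db j : `|dcoef nu f j| <= M * 4 ^+ j.
  have f0 : 0 < j`!%:R :> R by rewrite ltr0n fact_gt0.
  rewrite /dcoef !normrM normrX normrN1 expr1n mul1r normfV.
  rewrite (gtr0_norm (Gnu_gt0 hnu j)).
  have h1 := mom j; have h2 := Gnu_inv_upper hnu j.
  apply: (@le_trans _ _ (N1 * (2 ^+ j * j`!%:R) * ((G 0%N)^-1 * 2 ^+ j / j`!%:R))).
    by apply: ler_pM => //; rewrite invr_ge0; exact/ltW/Gnu_gt0.
  have -> : 4 ^+ j = 2 ^+ j * 2 ^+ j :> R by rewrite -exprMn; congr (_ ^+ j); ring.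
  rewrite /M; move: (G 0%N) g0 f0; move: (j`!%:R : R) (2 ^+ j : R) => F T g gp Fp.
  rewrite le_eqVlt; apply/orP; left; apply/eqP; field.
  by rewrite !gt_eqF.
exists M => // k x x0.
rewrite (le_trans (ler_wpM2r _ (ler_norm_sum _ _ _)))// ?exprn_ge0// mulr_suml.
apply: (@le_trans _ _ (\sum_(0 <= j < k.+1) M * (exp_coeff (4 * x) j * expR x))).
  rewrite [leLHS]big_nat [leRHS]big_nat; apply: ler_sum => j /andP[_ jk].
  have -> : x ^+ k = x ^+ j * x ^+ (k - j) by rewrite -exprD subnKC.
  move: (db j); move: (dcoef nu f j) => dj dbj.
  rewrite !normrM !normfV !normr_nat.
  rewrite (_ : _ * _ = `|dj| * (exp_coeff x j * exp_coeff x (k - j)%N)); last first.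
    by rewrite /exp_coeff/=; ring.
  apply: (@le_trans _ _ (M * 4 ^+ j * (exp_coeff x j * expR x))).
    apply: ler_pM => //; first by rewrite mulr_ge0 ?exp_coeff_ge0.
    by rewrite ler_wpM2l ?exp_coeff_ge0 ?exp_coeff_le.
  rewrite /exp_coeff/= exprMn le_eqVlt; apply/orP; left; apply/eqP; ring.
rewrite -mulr_sumr ler_wpM2l// -mulr_suml.
have -> : expR (5 * x) = expR (4 * x) * expR x by rewrite -expRD; congr expR; ring.
by rewrite ler_wpM2r ?expR_ge0//; apply: le_series_expR; rewrite mulr_ge0.
Qed.

(* For [y >= 0] the Gaussian weight is split at [r = 2 sqrt y]: below this point
   [V] is at most its value there, above it [V r <= C0 + r^2 / 4] is absorbed. *)
Lemma dcoef_bound f (V : R -> R) (C C0 Wy y : R) j :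
  0 <= C -> measurable_fun (Rpos : set R) f ->
  (forall r, 0 < r -> `|f r| <= C * expR (- (2^-1 * r ^+ 2) + V r)) ->
  (forall r, 0 < r -> expR (V r) <= expR Wy + expR (C0 + 2^-1 * r ^+ 2 - y)) ->
  `|dcoef nu f j| <= C * (gauss_mom nu 1 + expR C0 * gauss_mom nu 2^-1) *
     (expR Wy + expR (- y) * 2 ^+ j).
Proof.
move=> C_ge0 mf fV HV; have half0 : 0 < 2^-1 :> R by rewrite invr_gt0.
have gj := Gnu_gt0 hnu j.
have m1 := gauss_mom_gt0 hnu ltr01; have m2 := gauss_mom_gt0 hnu half0.
have i1 := integrable_gauss hnu j ltr01; have i2 := integrable_gauss hnu j half0.
pose g r := C * expR Wy * powexp (mexp nu j) 1 2 r +
  C * expR (C0 - y) * powexp (mexp nu j) 2^-1 2 r.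
have j1 := integrableZl mRposL (C * expR Wy) i1.
have j2 := integrableZl mRposL (C * expR (C0 - y)) i2.
have ig : mu.-integrable Rpos (EFin \o g) := integrableD mRposL j1 j2.
have dom r : 0 < r -> `|f r * powexp (mexp nu j) 2^-1 2 r| <= g r.
  move=> r0; rewrite normrM (ger0_norm (powexp_ge0 _ _ _ _)).
  apply: (@le_trans _ _ (C * expR (- (2^-1 * r ^+ 2)) * (expR Wy +
     expR (C0 + 2^-1 * r ^+ 2 - y)) * powexp (mexp nu j) 2^-1 2 r)).
    rewrite ler_wpM2r ?powexp_ge0// (le_trans (fV r r0))// (expRD _ (V r)) mulrA.
    by rewrite ler_wpM2l ?HV// mulr_ge0 ?expR_ge0.
  rewrite /g /powexp le_eqVlt; apply/orP; left; apply/eqP.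
  have -> : expR (- (1 * r ^+ 2)) = expR (- (2^-1 * r ^+ 2)) * expR (- (2^-1 * r ^+ 2)).
    by rewrite -expRD; congr expR; field.
  have e1 : expR (C0 + 2^-1 * r ^+ 2 - y) * expR (- (2^-1 * r ^+ 2)) = expR (C0 - y).
    by rewrite -expRD; congr expR; ring.
  by rewrite -e1; ring.
have iff : mu.-integrable Rpos (EFin \o (fun r => f r * powexp (mexp nu j) 2^-1 2 r)).
  apply: (le_integrable mRposL _ _ ig).
    by apply/measurable_EFinP; apply: measurable_funM => //; exact: measurable_powexp.
  move=> r; rewrite RposE => r0; rewrite /= lee_fin (le_trans (dom r r0))//.
  exact: ler_norm.
have rb : `|rmom nu f j| <= C * expR Wy * (gauss_mom nu 1 * G j) +
    C * expR (C0 - y) * (gauss_mom nu 2^-1 * G j * 2 ^+ j).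
  rewrite rmomE (le_trans (le_normr_Rintegral mRposL iff))//.
  apply: (@le_trans _ _ (\int[mu]_(r in Rpos) g r)).
    apply: (le_Rintegral mRposL) => //; first exact: (integrable_abse iff).
    by move=> r; rewrite RposE => r0; exact: dom.
  rewrite (RintegralD mRposL j1 j2) (RintegralZl _ mRposL i1) (RintegralZl _ mRposL i2).
  rewrite !gauss_momE// expr1n divr1 exprVn invrK.
  by rewrite lexx.
rewrite /dcoef !normrM normrX normrN1 expr1n mul1r normfV (gtr0_norm gj).
rewrite ler_pdivrMr// (le_trans rb)//.
have eC : expR (C0 - y) = expR C0 * expR (- y) by rewrite -expRD.
rewrite eC.
have w0 := expR_ge0 Wy; have y0 := expR_ge0 (- y); have c0 := expR_ge0 C0.
have t0 : 0 <= 2 ^+ j :> R by exact: exprn_ge0.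
move: (G j) gj (gauss_mom nu 1) m1 (gauss_mom nu 2^-1) m2 => g0 gp a ap b bp.
move: (2 ^+ j) t0 (expR Wy) w0 (expR (- y)) y0 (expR C0) c0 => T T0 X X0 Y Y0 Z Z0.
rewrite -subr_ge0.
have -> : C * (a + Z * b) * (X + Y * T) * g0 - (C * X * (a * g0) +
  C * (Z * Y) * (b * g0 * T)) = C * g0 * (a * (Y * T) + Z * b * X) by ring.
by rewrite mulr_ge0 ?mulr_ge0 ?addr_ge0 ?mulr_ge0 ?(ltW gp) ?(ltW ap) ?(ltW bp).
Qed.

(** The free parameter [y] is set to [x]: the first term sums to [expR (W x + x)], and in the second
    [expR (- x)] lowers [expR (2 * x)] to [expR x]. *)
Lemma exp_dominated_of_bound (d : nat -> R) (W : R -> R) (K E B al : R) :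
  0 <= K -> 0 <= E -> 0 <= B ->
  (forall y j, 0 <= y -> `|d j| <= K * (expR (W y) + expR (- y) * 2 ^+ j)) ->
  (forall y, 0 <= y -> W y <= E + B * y `^ al) ->
  exp_dominated d (2 * K * expR E) B al.
Proof.
move=> K0 E0 B0 dK WE x n x0.
apply: (@le_trans _ _ (\sum_(0 <= j < n) (K * expR (W x) * exp_coeff x j +
   K * expR (- x) * exp_coeff (2 * x) j))).
  apply: ler_sum => j _.
  rewrite (le_trans (ler_wpM2r _ (dK x j x0)))// ?exp_coeff_ge0//.
  by rewrite /exp_coeff/= exprMn le_eqVlt; apply/orP; left; apply/eqP; ring.
rewrite big_split/= -!mulr_sumr.
have s1 := le_series_expR n x0.
have x20 : 0 <= 2 * x by rewrite mulr_ge0.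
have s2 := le_series_expR n x20.
apply: (@le_trans _ _ (K * expR (W x) * expR x + K * expR (- x) * expR (2 * x))).
  by rewrite lerD// ler_wpM2l// mulr_ge0 ?expR_ge0.
have -> : K * expR (- x) * expR (2 * x) = K * expR x.
  by rewrite -mulrA -expRD; congr (_ * expR _); ring.
have -> : 2 * K * expR E * expR (x + B * x `^ al) =
    K * expR (E + B * x `^ al) * expR x + K * expR (E + B * x `^ al) * expR x.
  by rewrite !expRD; ring.
rewrite lerD// ler_wpM2r ?expR_ge0//.
  by rewrite ler_wpM2l// ler_expR WE.
by rewrite ler_peMr// -expR0 ler_expR addr_ge0// mulr_ge0// powR_ge0.
Qed.

End LaguerreInner.

(** * Bounds on inner products and their form with the Young conjugate *)

Section Final.
Context {R : realType}.
Local Notation mu := (@lebesgue_measure R).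

(** Beyond [X] the factor [x^(al - 1)] is at most [eta], chosen so that [c * eta <= 1 / 4]. *)
Lemma powR_sublinear (A k al : R) : 0 <= A -> 0 <= k -> 0 < al -> al < 1 ->
  exists C0 : R, forall x, 0 <= x -> A * (k * x) `^ al <= C0 + x / 4.
Proof.
move=> A0 k0 al0 al1; pose c := A * k `^ al.
have c0 : 0 <= c by rewrite mulr_ge0// powR_ge0.
pose eta := (4 * (c + 1))^-1.
have c1 : 0 < c + 1 by rewrite ltr_wpDl.
have eta0 : 0 < eta by rewrite invr_gt0 mulr_gt0.
pose X := eta `^ (- (1 - al)^-1).
have X0 : 0 < X by rewrite powR_gt0.
exists (c * X `^ al) => x x0.
rewrite powRM// mulrA -/c.
have [xX|Xx] := leP x X.
  rewrite (@le_trans _ _ (c * X `^ al))//; last by rewrite lerDl divr_ge0.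
  by rewrite ler_wpM2l// ge0_ler_powR ?nnegrE ?(ltW al0) ?(ltW X0).
have xp : 0 < x by exact: lt_trans Xx.
have h1 : x `^ al <= eta * x.
  have -> : x `^ al = x `^ (al - 1) * x.
    by rewrite -{3}(powRr1 x0) -powRD ?(gt_eqF xp) ?implybT// subrK.
  rewrite ler_wpM2r//.
  have -> : eta = X `^ (al - 1).
    rewrite /X -powRrM (_ : - (1 - al)^-1 * (al - 1) = 1) ?powRr1 ?(ltW eta0)//.
    by field; rewrite subr_eq0 gt_eqF.
  have -> : al - 1 = - (1 - al) by ring.
  rewrite !powRN lef_pV2 ?posrE ?powR_gt0//.
  by rewrite ge0_ler_powR ?nnegrE ?(ltW X0) ?(ltW Xx)// subr_ge0 ltW.
have h2 : c * (eta * x) <= x / 4.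
  rewrite mulrA [leRHS]mulrC ler_wpM2r//.
  by rewrite /eta ler_pdivrMr ?mulr_gt0//; lra.
have h3 := ler_wpM2l c0 h1.
have h4 : 0 <= c * X `^ al by rewrite mulr_ge0// powR_ge0.
lra.
Qed.

(** [L] is fixed before [f], so that one value serves the real and the imaginary part of the given
    function. *)
Theorem rinner_bound_hardy (nu q lam : R) (w : R -> R) :
  - (1 / 2) < nu -> 0 < q -> 0 < lam -> weight_function w -> weight_growth w ->
  exists2 L : R, 0 < L & forall (f : R -> R) (C : R), 0 < C ->
    mu.-integrable Rpos (EFin \o radial nu f) ->
    (forall r, 0 < r -> `|f r| <= C * expR (- (2^-1 * r ^+ 2) + lam * w (q * r))) ->
    (forall s, 0 < s ->
      `|rhankel nu f s| <= C * expR (- (2^-1 * s ^+ 2) + lam * w (q * s))) ->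
    exists2 C' : R, 0 < C' & forall (k : nat) (u : R), 0 <= u ->
      `|rinner nu f k| <= C' * Gamma (k%:R + nu + 1) *
         expR (2 * k%:R * ln q - 2 * k%:R * u + L * w (expR u)).
Proof.
move=> hnu q0 lam0 hw hg; have [w0 [wnd _]] := hw.
have [R0 [D [al [[R00 D0 al0 al1] HD]]]] := weight_power_growth hw hg.
have ca0 : 0 < cos (al * (pi / 2)) :> R.
  have pi20 : 0 < (pi / 2 : R) by rewrite divr_gt0 ?pi_gt0.
  have : al * (pi / 2) < pi / 2 by rewrite gtr_pMl.
  have : 0 < al * (pi / 2) by rewrite mulr_gt0.
  by move=> h1 h2; apply: cos_gt0_pihalf; apply/andP; split; lra.
set ca := cos _ in ca0.
pose L := lam * D * (1 + 4 `^ al / ca).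
have L0 : 0 < L.
  by rewrite !mulr_gt0// ltr_wpDr// divr_ge0 ?powR_ge0// ltW.
exists L => // f C C_gt0 intf fb hb.
have mrad : measurable_fun (Rpos : set R) (radial nu f).
  by have /integrableP[/measurable_EFinP] := intf.
have mf : measurable_fun (Rpos : set R) f.
  apply: (eq_measurable_fun (fun r : R => radial nu f r * r `^ (- (2 * nu + 1)))).
    move=> r; rewrite inE RposE => r0.
    by rewrite /radial -mulrA -powRD ?(gt_eqF r0) ?implybT// subrr powRr0 mulr1.
  by apply: measurable_funM => //; apply: (@measurable_funS _ _ _ _ setT) => //;
    exact: measurable_powR.
have mh := measurable_rhankel hnu intf.
have wR0 : 0 <= w R0 by rewrite w0// ltW.
(* The growth inequality at [R0] yields [lam * w (q * r) <= C0 + r^2 / 4]; for [r >= 2 sqrt y] this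
   is at most [C0 + r^2 / 2 - y]. *)
have [C0' HC0'] : exists C0 : R, forall x, 0 <= x ->
    (lam * (D * w R0)) * ((q ^+ 2 / R0 ^+ 2) * x) `^ al <= C0 + x / 4.
  apply: powR_sublinear => //; first by rewrite !mulr_ge0// ltW.
  by rewrite divr_ge0// sqr_ge0.
pose C0 := lam * (D * w R0) + C0'.
(* The weight at the splitting point [r = 2 sqrt y]. *)
pose W y := lam * w (2 * q * Num.sqrt y).
have HV y r : 0 <= y -> 0 < r ->
    expR (lam * w (q * r)) <= expR (W y) + expR (C0 + 2^-1 * r ^+ 2 - y).
  move=> y0 r0; have [ry|yr] := leP r (2 * Num.sqrt y).
    rewrite ler_wpDr ?expR_ge0// ler_expR ler_wpM2l ?(ltW lam0)// wnd//.
      by rewrite mulr_ge0// ltW.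
    by rewrite [2 * q]mulrC -mulrA ler_pM2l.
  rewrite ler_wpDl ?expR_ge0// ler_expR.
  have y4 : 4 * y <= r ^+ 2.
    have -> : 4 * y = (2 * Num.sqrt y) ^+ 2 by rewrite exprMn sqr_sqrtr//; ring.
    by rewrite lerXn2r ?nnegrE ?mulr_ge0 ?sqrtr_ge0 ?(ltW yr) ?(ltW r0).
  have h1 : w (q * r) <= D * w R0 * (1 + ((q * r) ^+ 2 / R0 ^+ 2) `^ al).
    by apply: HD => //; rewrite mulr_ge0// ltW.
  have h2 := ler_wpM2l (ltW lam0) h1.
  have h3 := HC0' _ (sqr_ge0 r).
  have E : (q * r) ^+ 2 / R0 ^+ 2 = q ^+ 2 / R0 ^+ 2 * r ^+ 2 by rewrite exprMn mulrAC.
  rewrite E mulrDr mulr1 mulrDr !mulrA in h2; rewrite !mulrA in h3.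
  rewrite /C0 !mulrA; lra.
pose K0 := C * (gauss_mom nu 1 + expR C0 * gauss_mom nu 2^-1).
have half0 : 0 < 2^-1 :> R by rewrite invr_gt0.
have m1 := gauss_mom_gt0 hnu ltr01; have m2 := gauss_mom_gt0 hnu half0.
have K00 : 0 < K0 by rewrite mulr_gt0// addr_gt0// mulr_gt0 ?expR_gt0.
have ka0 := hankel_const_gt0 hnu.
pose K := K0 * (1 + (hankel_const nu)^-1).
have kV : 0 < (hankel_const nu)^-1 by rewrite invr_gt0.
have Kp : 0 < K by rewrite mulr_gt0// addr_gt0.
have KK0 : K0 <= K by rewrite ler_peMr ?(ltW K00)// lerDl ltW.
have pos y j : 0 <= expR (W y) + expR (- y) * 2 ^+ j.
  by rewrite addr_ge0 ?expR_ge0// mulr_ge0 ?expR_ge0// exprn_ge0.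
have d1 y j : 0 <= y -> `|dcoef nu f j| <= K * (expR (W y) + expR (- y) * 2 ^+ j).
  move=> y0; apply: (@le_trans _ _ (K0 * (expR (W y) + expR (- y) * 2 ^+ j))).
    by apply: (dcoef_bound hnu j (ltW C_gt0) mf fb) => r r0; exact: HV.
  by rewrite ler_wpM2r.
have d2 y j : 0 <= y -> `|dual_coef (dcoef nu f) j| <= K * (expR (W y) + expR (- y) * 2 ^+ j).
  move=> y0.
  have -> : dual_coef (dcoef nu f) j = (hankel_const nu)^-1 * dcoef nu (rhankel nu f) j.
    by rewrite dcoef_rhankel// mulrA mulVf ?gt_eqF// mul1r.
  rewrite normrM (gtr0_norm kV).
  apply: (@le_trans _ _ ((hankel_const nu)^-1 * (K0 * (expR (W y) + expR (- y) * 2 ^+ j)))).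
    rewrite ler_wpM2l ?(ltW kV)//.
    by apply: (dcoef_bound hnu j (ltW C_gt0) mh hb) => r r0; exact: HV.
  rewrite mulrA ler_wpM2r// /K [leLHS]mulrC ler_wpM2l ?(ltW K00)//.
  by rewrite lerDr.
clearbody K.
pose Cf := 2 * (2 * K) * expR 3.
have Cf0 : 0 < Cf by rewrite !mulr_gt0// expR_gt0.
have main k (r : R) : R0 <= r ->
    `|exp_conv (dcoef nu f) k| * (r ^+ 2 / q ^+ 2) ^+ k <= Cf * expR (L * w r).
  move=> Rr; have rp : 0 < r by exact: lt_le_trans Rr.
  have wr0 : 0 <= w r by rewrite w0// ltW.
  pose E := lam * (D * w r).
  have E0 : 0 <= E by rewrite !mulr_ge0// ltW.
  (* The growth inequality at [r] is applied to [v = 2 q sqrt y], for which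
     [v^2 / r^2 = (4 q^2 / r^2) y]. *)
  pose B := E * (4 * q ^+ 2 / r ^+ 2) `^ al.
  have B0 : 0 <= B by rewrite mulr_ge0// powR_ge0.
  have q2 : 0 < q ^+ 2 by rewrite exprn_gt0.
  have r2 : 0 < r ^+ 2 by rewrite exprn_gt0.
  have WE y : 0 <= y -> W y <= E + B * y `^ al.
    move=> y0; have k0 : 0 <= 4 * q ^+ 2 / r ^+ 2 by rewrite divr_ge0 ?mulr_ge0 ?ltW.
    have -> : B * y `^ al = E * (4 * q ^+ 2 / r ^+ 2 * y) `^ al.
      by rewrite /B (powRM _ k0 y0) mulrA.
    rewrite /W.
    have h1 := HD r (2 * q * Num.sqrt y) Rr.
    have h2 : 0 <= 2 * q * Num.sqrt y by rewrite !mulr_ge0 ?sqrtr_ge0// ltW.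
    have := ler_wpM2l (ltW lam0) (h1 h2).
    have -> : (2 * q * Num.sqrt y) ^+ 2 / r ^+ 2 = 4 * q ^+ 2 / r ^+ 2 * y.
      by rewrite !exprMn sqr_sqrtr//; field; rewrite gt_eqF.
    by move=> h3; apply: (le_trans h3); rewrite /E; lra.
  have rho0 : 0 < r ^+ 2 / q ^+ 2 by rewrite divr_gt0.
  have e1 := exp_dominated_of_bound (ltW Kp) E0 B0 d1 WE.
  have e2 := exp_dominated_of_bound (ltW Kp) E0 B0 d2 WE.
  have CE : 0 < 2 * K * expR E by rewrite !mulr_gt0// expR_gt0.
  have := exp_conv_growth k CE B0 al0 al1 rho0 e1 e2.
  move=> /le_trans; apply.
  have -> : B / cos (al * (pi / 2)) * (r ^+ 2 / q ^+ 2) `^ al = E * (4 `^ al / ca).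
    have -> : 4 `^ al = (4 * q ^+ 2 / r ^+ 2) `^ al * (r ^+ 2 / q ^+ 2) `^ al.
      rewrite -powRM ?ltW ?divr_gt0 ?mulr_gt0//; congr (_ `^ al).
      by field; rewrite !gt_eqF.
    by rewrite /B -/ca; ring.
  have -> : L * w r = E + E * (4 `^ al / ca) by rewrite /L /E; ring.
  by rewrite (expRD E) /Cf le_eqVlt; apply/orP; left; apply/eqP; ring.
exists (Cf * expR (L * w R0)) => [|k u u0]; first by rewrite mulr_gt0// expR_gt0.
have gk := Gnu_gt0 hnu k.
rewrite rinnerE// normrM (gtr0_norm gk) [leLHS]mulrC.
rewrite [leRHS]mulrAC ler_wpM2r ?(ltW gk)//.
(* [main] requires a radius of at least [R0], while [u >= 0] only gives [expR u >= 1]; enlarging the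
   radius costs the factor [expR (L * w R0)]. *)
pose r1 := Num.max R0 (expR u).
have r1R : R0 <= r1 by rewrite le_max lexx.
have r1u : expR u <= r1 by rewrite le_max lexx orbT.
have := main k r1 r1R.
have lnq : expR (ln q) = q by rewrite lnK// posrE.
pose rho := expR (2 * u - 2 * ln q).
have rhoE : rho = expR u ^+ 2 / q ^+ 2.
  by rewrite /rho expRB !(expRM_natl 2) lnq.
have rk : rho ^+ k <= (r1 ^+ 2 / q ^+ 2) ^+ k.
  rewrite lerXn2r ?nnegrE ?expR_ge0 ?divr_ge0 ?sqr_ge0// rhoE.
  rewrite ler_wpM2r ?invr_ge0 ?sqr_ge0// lerXn2r ?nnegrE ?expR_ge0//.
  by rewrite (le_trans (expR_ge0 u)).
have wr1 : w r1 <= w R0 + w (expR u).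
  have wu0 : 0 <= w (expR u) by rewrite w0// expR_ge0.
  by rewrite /r1 maxEle; case: ifP => _; [rewrite lerDr | rewrite lerDl].
move=> H.
have H1 : `|exp_conv (dcoef nu f) k| * rho ^+ k <=
    Cf * expR (L * w R0) * expR (L * w (expR u)).
  apply: (@le_trans _ _ (Cf * expR (L * w r1))).
    by apply: le_trans H; rewrite ler_wpM2l.
  rewrite -mulrA -expRD -mulrDr ler_wpM2l ?(ltW Cf0)// ler_expR.
  by rewrite ler_wpM2l// ltW.
have rhok : rho ^+ k = expR (- (2 * k%:R * ln q - 2 * k%:R * u)).
  by rewrite /rho -expRM_natl; congr expR; ring.
rewrite rhok expRN ler_pdivrMr ?expR_gt0// in H1.
rewrite (le_trans H1)// le_eqVlt; apply/orP; left; apply/eqP.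
by rewrite [in RHS]expRD; ring.
Qed.

Theorem rinner_bound_crude (nu q : R) (f : R -> R) : - (1 / 2) < nu -> 0 < q ->
  mu.-integrable Rpos (EFin \o radial nu f) ->
  exists2 C' : R, 0 < C' & forall (k : nat) (u : R), 0 <= u ->
    `|rinner nu f k| <= C' * Gamma (k%:R + nu + 1) *
       expR (2 * k%:R * ln q - 2 * k%:R * u + 5 / q ^+ 2 * expR (2 * u)).
Proof.
move=> hnu q0 intf; have [C C_ge0 HC] := exp_conv_crude hnu intf.
exists (C + 1) => [|k u u0]; first by rewrite ltr_wpDl.
have gk := Gnu_gt0 hnu k.
rewrite rinnerE// normrM (gtr0_norm gk) [leLHS]mulrC.
rewrite [leRHS]mulrAC ler_wpM2r ?(ltW gk)//.
have lnq : expR (ln q) = q by rewrite lnK// posrE.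
pose rho := expR (2 * u - 2 * ln q).
have rhoE : rho = expR (2 * u) / q ^+ 2.
  by rewrite /rho expRB (expRM_natl 2 (ln q)) lnq.
have := HC k rho (expR_ge0 _).
have rhok : rho ^+ k = expR (- (2 * k%:R * ln q - 2 * k%:R * u)).
  by rewrite /rho -expRM_natl; congr expR; ring.
rewrite rhok expRN ler_pdivrMr ?expR_gt0// => H.
rewrite (le_trans H)// rhoE.
have -> : 5 * (expR (2 * u) / q ^+ 2) = 5 / q ^+ 2 * expR (2 * u) by ring.
rewrite [leRHS](_ : _ = (C + 1) * expR (5 / q ^+ 2 * expR (2 * u)) *
  expR (2 * k%:R * ln q - 2 * k%:R * u)); last by rewrite expRD; ring.
by rewrite ler_wpM2r ?expR_ge0// ler_wpM2r ?expR_ge0// lerDl.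
Qed.

(** An estimate for every [u] passes to the supremum. If [X > 0] the estimate itself makes the
    conjugate finite; if [X = 0] the conjugate may be infinite, and nonnegativity of the right-hand
    side settles the claim. *)
Lemma le_young (phi : R -> R) (l A x0 X v : R) : 0 < l -> 0 < A -> 0 <= X ->
  (forall u, 0 <= u -> X <= A * expR (x0 - l^-1 * (u * v - phi u))) ->
  (X%:E <= A%:E * expeR (x0%:E - (l^-1)%:E * young phi v))%E.
Proof.
move=> l0 A0; rewrite le_eqVlt => /predU1P[<- _|X0 H].
  by rewrite mule_ge0 ?expeR_ge0// lee_fin ltW.
pose t := ln (X / A).
have XE : X = A * expR t.
  by rewrite /t lnK ?posrE ?divr_gt0// mulrC divfK// gt_eqF.
have yub : (young phi v <= (l * (x0 - t))%:E)%E.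
  apply: ge_ereal_sup => _ /= [u + <-]; rewrite in_itv/= andbT => u0.
  rewrite lee_fin; have := H u u0.
  rewrite XE ler_pM2l// ler_expR => h.
  have h2 : l^-1 * (u * v - phi u) <= x0 - t by lra.
  by rewrite -ler_pdivrMl.
have ylb : ((0 * v - phi 0)%:E <= young phi v)%E.
  by apply: ereal_sup_ubound; exists 0 => //=; rewrite in_itv/= lexx.
case: (young phi v) yub ylb => [y| |]//= yub _.
rewrite -EFinM lee_fin XE ler_pM2l// ler_expR.
move: yub; rewrite lee_fin => yub.
have : l^-1 * y <= x0 - t by rewrite ler_pdivrMl.
lra.
Qed.

Lemma integrable_radial (nu : R) (f : R -> R[i]) (g : R -> R) :
  Lnu nu 1 f -> measurable_fun Rpos g -> (forall r, `|g r| <= cmod (f r)) ->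
  mu.-integrable Rpos (EFin \o radial nu g).
Proof.
move=> [mR [mI fin]] mg gf; apply/integrableP.
have mp : measurable_fun (Rpos : set R) (fun r : R => r `^ (2 * nu + 1)).
  by apply: (@measurable_funS _ _ _ _ setT) => //; exact: measurable_powR.
have mrad : measurable_fun (Rpos : set R) (radial nu g) by exact: measurable_funM.
have mcmod : measurable_fun (Rpos : set R) (fun r => cmod (f r)).
  apply: (@measurableT_comp _ _ _ _ _ _ (@Num.sqrt R)).
    by apply: continuous_measurable_fun; exact: sqrt_continuous.
  by apply: measurable_funD; exact: measurable_funX.
split; first exact/measurable_EFinP.
apply: le_lt_trans fin; apply: ge0_le_integral.
- exact: mRposL.
- by move=> r _; exact: abse_ge0.
- by apply: measurableT_comp => //; exact/measurable_EFinP.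
- by apply/measurable_EFinP; apply: measurable_funM.
move=> r _; rewrite /= lee_fin /radial normrM expr1 (ger0_norm (powR_ge0 _ _)).
by rewrite ler_wpM2r ?powR_ge0.
Qed.

Lemma cintegralM (f : R -> R[i]) (h : R -> R) :
  cintegral (fun r => f r * cR (h r)) = complex.Complex
    (\int[mu]_(r in Rpos) (complex.Re (f r) * h r))
    (\int[mu]_(r in Rpos) (complex.Im (f r) * h r)).
Proof.
congr complex.Complex; apply: eq_Rintegral => r _; case: (f r) => a b /=.
  by rewrite mulr0 subr0.
by rewrite mulr0 add0r.
Qed.

End Final.

Theorem theorem5p1 (R : realType) (nu p q lam : R) (w : R -> R) (f : R -> R[i]) :
  - (1 / 2) < nu -> 0 < p -> 0 < q -> 0 < lam ->
  weight_function w -> weight_growth w ->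
  E_Hnu nu p q lam w f ->
  (1 <= p ->
   exists l C : R, 0 < l /\ 0 < C /\
   forall k : nat,
     ((cmod (inner nu f (laguerre_fun nu k)))%:E <=
       (C * 2 ^+ (2 * k) * Gamma (k%:R + nu + 1))%:E *
       expeR ((2 * k%:R * ln q)%:E
              - (l^-1)%:E * young (fun t => w (expR t)) (2 * l * k%:R)%R))%E) /\
  (p < 1 ->
   exists l C : R, 0 < l /\ 0 < C /\
   forall k : nat,
     ((cmod (inner nu f (laguerre_fun nu k)))%:E <=
       (C * 2 ^+ (2 * k) * Gamma (k%:R + nu + 1))%:E *
       expeR ((2 * k%:R * ln q)%:E
              - (l^-1)%:E *
                young (fun t => (1 / (4 * q ^+ 2) * Num.sqrt ((1 - p) / (1 + p))
                                  * expR (2 * t) + w (expR t))%R)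
                      (2 * l * k%:R)%R))%E).
Proof.
move=> hnu p0 q0 lam0 hw hg [L1 [_ [C [C_gt0 [fb hb]]]]].
have [mR [mI _]] := L1; have [w0 _] := hw.
pose fR r := complex.Re (f r); pose fI r := complex.Im (f r).
have iR : (@lebesgue_measure R).-integrable Rpos (EFin \o radial nu fR).
  by apply: (integrable_radial L1) => // r; exact: Re_le_cmod.
have iI : (@lebesgue_measure R).-integrable Rpos (EFin \o radial nu fI).
  by apply: (integrable_radial L1) => // r; exact: Im_le_cmod.
have innE k : cmod (inner nu f (laguerre_fun nu k)) <= `|rinner nu fR k| + `|rinner nu fI k|.
  by rewrite /inner cintegralM; exact: cmod_le_ReIm.
have hanE s : hankel nu f s = complex.Complex (rhankel nu fR s) (rhankel nu fI s).
  exact: cintegralM.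
have gk k : 0 < Gamma (k%:R + nu + 1) by exact: Gnu_gt0.
have fin (L C1 C2 : R) (phi : R -> R) : 0 < L -> 0 < C1 -> 0 < C2 ->
    (forall (k : nat) (u : R), 0 <= u -> `|rinner nu fR k| <= C1 * Gamma (k%:R + nu + 1) *
       expR (2 * k%:R * ln q - 2 * k%:R * u + L * phi u)) ->
    (forall (k : nat) (u : R), 0 <= u -> `|rinner nu fI k| <= C2 * Gamma (k%:R + nu + 1) *
       expR (2 * k%:R * ln q - 2 * k%:R * u + L * phi u)) ->
    exists l C : R, 0 < l /\ 0 < C /\ forall k : nat,
     ((cmod (inner nu f (laguerre_fun nu k)))%:E <=
       (C * 2 ^+ (2 * k) * Gamma (k%:R + nu + 1))%:E *
       expeR ((2 * k%:R * ln q)%:E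
              - (l^-1)%:E * young phi (2 * l * k%:R)%R))%E.
  (* With [l = 1 / L], the quantity [l^-1 * young phi (2 l k)] is the supremum of
     [2 k u - L * phi u] over [u >= 0]. *)
  move=> L0 C10 C20 H1 H2; exists L^-1, (C1 + C2).
  split; first by rewrite invr_gt0.
  split; first exact: addr_gt0.
  have C12 := addr_gt0 C10 C20.
  move=> k; apply: le_young.
  - by rewrite invr_gt0.
  - by apply: mulr_gt0 => //; apply: mulr_gt0 => //; exact: exprn_gt0.
  - exact: cmod_ge0.
  move=> u u0; apply: (le_trans (innE k)).
  apply: (le_trans (lerD (H1 k u u0) (H2 k u u0))).
  have -> : 2 * k%:R * ln q - L^-1^-1 * (u * (2 * L^-1 * k%:R) - phi u) =
     2 * k%:R * ln q - 2 * k%:R * u + L * phi u.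
    by rewrite invrK; field; rewrite gt_eqF.
  rewrite -!mulrDl ler_wpM2r ?expR_ge0// ler_wpM2r ?(ltW (gk k))//.
  rewrite ler_peMr ?(ltW C12)//.
  by rewrite exprn_ege1// ler1n.
split=> [p1|p1].
  have [L L0 HL] := rinner_bound_hardy hnu q0 lam0 hw hg.
  have le_p (x y : R) : C * expR (- p * x ^+ 2 / 2 + y) <= C * expR (- (2^-1 * x ^+ 2) + y).
    rewrite ler_pM2l// ler_expR lerD2r.
    have := ler_wpM2r (sqr_ge0 x) p1; rewrite mul1r; lra.
  have [||C1 C10 H1] := HL fR C C_gt0 iR.
  - move=> r r0; apply: le_trans (le_p _ _); apply: le_trans (fb r r0); exact: Re_le_cmod.
  - move=> s s0; apply: le_trans (le_p _ _); apply: le_trans (hb s s0); rewrite hanE.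
    exact: (Re_le_cmod (complex.Complex _ _)).
  have [||C2 C20 H2] := HL fI C C_gt0 iI.
  - move=> r r0; apply: le_trans (le_p _ _); apply: le_trans (fb r r0); exact: Im_le_cmod.
  - move=> s s0; apply: le_trans (le_p _ _); apply: le_trans (hb s s0); rewrite hanE.
    exact: (Im_le_cmod (complex.Complex _ _)).
  exact: fin L0 C10 C20 H1 H2.
set c := 1 / (4 * q ^+ 2) * Num.sqrt ((1 - p) / (1 + p)).
have c0 : 0 < c.
  rewrite mulr_gt0// ?divr_gt0 ?mulr_gt0 ?exprn_gt0// sqrtr_gt0 divr_gt0 ?subr_gt0//.
  by rewrite addr_gt0.
(* [L * c = 5 / q ^+ 2], so the first term of [zeta] reproduces the crude exponent, and the weight
   adds a nonnegative amount. *)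
pose L := 5 / q ^+ 2 / c.
have L0 : 0 < L by rewrite !divr_gt0// exprn_gt0.
have mon (k : nat) u : expR (2 * k%:R * ln q - 2 * k%:R * u + 5 / q ^+ 2 * expR (2 * u)) <=
   expR (2 * k%:R * ln q - 2 * k%:R * u + L * (c * expR (2 * u) + w (expR u))).
  rewrite ler_expR lerD2l mulrDr mulrA /L divfK ?gt_eqF// lerDl.
  by rewrite mulr_ge0 ?(ltW L0)// w0// expR_ge0.
have [C1 C10 H1] := rinner_bound_crude hnu q0 iR.
have [C2 C20 H2] := rinner_bound_crude hnu q0 iI.
apply: (fin L C1 C2 _ L0 C10 C20) => k u u0.
  apply: (le_trans (H1 k u u0)); rewrite ler_wpM2l//.
  by apply: mulr_ge0; exact: ltW.
apply: (le_trans (H2 k u u0)); rewrite ler_wpM2l//.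
by apply: mulr_ge0; exact: ltW.
Qed.
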